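(* Let $\mathcal C\subset S_n$ be any union of shifted dual equivalence classes of $S_n$ such that $f=\sum_{\pi\in\mathcal C}F_{\mathrm{ID}(\pi)}$ is symmetric. Then $$f=\sum_{\lambda\vdash n}|\{\pi\in\mathcal C:\mathrm{rev}(\pi)\in\mathrm{SYam}(\lambda)\}|\cdot s_{\lambda'}=\sum_{\lambda\vdash n}|\{\pi\in\mathcal C:\mathrm{flip}(\pi)\in\mathrm{SYam}(\lambda)\}|\cdot s_\lambda,$$ where $s_\lambda$ is the Schur function and $\lambda'$ the conjugate partition. In particular, $f$ is Schur positive (a nonnegative integer combination of Schur functions).
   Context: Permutations are in one-line notation. $\mathrm{ID}(\pi)$ is the set of $i\in[n-1]$ such that $i$ occurs to the right of $i+1$. $\mathrm{rev}(\pi)$ is $\pi$ read from right to left; $\mathrm{flip}(\pi)$ is obtained from $\mathrm{rev}(\pi)$ by replacing each value $v$ by $n+1-v$. For $D\subseteq[n-1]$, $F_D=\sum x_{j_1}\cdots x_{j_n}$ over $j_1\le\cdots\le j_n$ such that $j_k=j_{k+1}$ implies $k\notin D$. Shifted dual equivalence. For $n=4$, $h_1$ swaps the values $x$ and $y$ when the permutation has one of the forms $1x2y$, $x12y$, $1x4y$, $x14y$, $4x1y$, $x41y$, $4x3y$, $x43y$ ($\{x,y\}$ being the two remaining values of $\{1,2,3,4\}$ in either order), and is the identity otherwise. For $n>4$ and $1\le i\le n-3$, $h_i$ fixes all values outside $I=[i,i+3]$ and permutes the values in $I$ so that $\mathrm{fl}(h_i(\pi)|_I)=h_1(\mathrm{fl}(\pi|_I))$,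 where $\pi|_I$ is the subword of values in $I$ and $\mathrm{fl}$ replaces a word by the permutation in the same relative order. For $n\le3$ the action is trivial. Two permutations are shifted dual equivalent if connected by a sequence of $h_i$'s. Standardized Yamanouchi words. For $\lambda\vdash n$, drawn in French notation (rows numbered bottom to top), $U_\lambda$ is the standard Young tableau with bottom row $1,\dots,\lambda_1$, second row $\lambda_1+1,\dots,\lambda_1+\lambda_2$, and so on. $\mathrm{SYam}(\lambda)=\{\pi\in S_n:P(\pi)=U_\lambda\}$, where $P(\pi)$ is the RSK (row) insertion tableau of $\pi$. *)

(* Defs.v *)
From HB Require Import structures.
From mathcomp Require Import all_boot all_order all_fingroup all_algebra.
Set Implicit Arguments.
Unset Strict Implicit.
Unset Printing Implicit Defensive.
Import GRing.Theory.

(* A formal power series in x_0, x_1, x_2, ... is given by its coefficients.  The monomial x_{m_1} ... x_{m_d} is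
   represented by the word [:: m_1; ...; m_d], in any order: the coefficient
   functions defined below only depend on the multiset of letters. *)
Definition series := seq nat -> int.

(* The formal sum of x_{w_1} ... x_{w_d} over all the words w satisfying P.
   The words whose monomial is m are the distinct rearrangements of m, which
   [permutations m] lists without repetition. *)
Definition gen_series (P : pred (seq nat)) : series :=
  fun m => Posz (count P (permutations m)).

Definition symmetric_series (f : series) : Prop :=
  forall s : nat -> nat, bijective s -> forall m, f (map s m) = f m.

(* [nth 0 j k.-1] is j_k, for k >= 1. *)
Definition F (n : nat) (D : seq nat) : series :=
  gen_series (fun j =>
    [&& size j == n, sorted leq j
      & all (fun k => (nth 0 j k.-1 == nth 0 j k) ==> (k \notin D))
            (iota 1 n.-1)]).

Definition is_partition (n : nat) (s : seq nat) : bool :=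
  [&& sorted geq s, all (leq 1) s & sumn s == n].

(* The bound n on the length and on the parts makes the type finite; by
   [partitionP] it does not exclude any partition of n. *)
Record partition_of (n : nat) := PartitionOf {
  part_bseq : n.-bseq 'I_n.+1;
  part_bseqP : is_partition n (map val part_bseq) }.

HB.instance Definition _ n := [isSub for @part_bseq n].
HB.instance Definition _ n := [Finite of partition_of n by <:].

Definition parts (n : nat) (la : partition_of n) : seq nat :=
  map val (part_bseq la).

Lemma partitionP (n : nat) (s : seq nat) :
  reflect (exists la : partition_of n, parts la = s) (is_partition n s).
Proof.
apply: (iffP idP) => [ps | [la <-]]; last exact: part_bseqP.
have /and3P[_ s_gt0 /eqP sumE] := ps.
have le_part : all (fun v => v < n.+1) s.
  apply/allP => v vs; rewrite ltnS -sumE.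
  by rewrite (perm_sumn (perm_to_rem vs)) /= leq_addr.
have le_size : size s <= n.
  rewrite -sumE; elim: s s_gt0 {ps sumE le_part} => //= v s IHs /andP[v_gt0 /IHs].
  by rewrite -add1n; apply: leq_add.
have mapK : map val (map (@inord n) s) = s.
  rewrite -map_comp -[RHS]map_id; apply/eq_in_map => v /(allP le_part) vn /=.
  by rewrite inordK.
have szb : size (map (@inord n) s) <= n by rewrite size_map.
have pb : is_partition n (map val (Bseq szb)) by rewrite /= mapK.
by exists (PartitionOf pb); rewrite /parts /= mapK.
Qed.

Definition conj_part (s : seq nat) : seq nat :=
  [seq count (fun r => i < r) s | i <- iota 0 (head 0 s)].

(* French notation: a tableau is the list of its rows, from bottom to top. *)

Definition column_strict (lower upper : seq nat) : bool :=
  all (fun j => nth 0 lower j < nth 0 upper j) (iota 0 (size upper)).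

Definition semistandard (t : seq (seq nat)) : bool :=
  all (sorted leq) t && sorted column_strict t.

(* [reshape la w] cuts the word w into the successive rows of a filling of the
   diagram of la; each filling of the diagram arises from exactly one word of
   size |la|. *)
Definition schur (la : seq nat) : series :=
  gen_series (fun w => (size w == sumn la) && semistandard (reshape la w)).

(* If no entry of the row r exceeds x, then k = size r and [set_nth] appends
   x; otherwise x replaces the leftmost entry greater than x. *)
Fixpoint rsk_insert (x : nat) (t : seq (seq nat)) : seq (seq nat) :=
  if t is r :: t' then
    let k := find (fun y => x < y) r in
    set_nth 0 r k x :: (if k < size r then rsk_insert (nth 0 r k) t' else t')
  else [:: [:: x]].

Definition rsk_P (w : seq nat) : seq (seq nat) :=
  foldl (fun t x => rsk_insert x t) [::] w.

Definition U (la : seq nat) : seq (seq nat) := reshape la (iota 1 (sumn la)).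

Definition SYam (la : seq nat) : pred (seq nat) :=
  fun w => perm_eq w (iota 1 (sumn la)) && (rsk_P w == U la).

(* 'S_n permutes {0, ..., n-1}; the one-line notation uses {1, ..., n}. *)
Definition word (n : nat) (p : 'S_n) : seq nat :=
  [seq (nat_of_ord (p k)).+1 | k <- enum 'I_n].

Definition ID (n : nat) (p : 'S_n) : seq nat :=
  [seq i <- iota 1 n.-1 | index i.+1 (word p) < index i (word p)].

Definition rev_word (n : nat) (p : 'S_n) : seq nat := rev (word p).

Definition flip_word (n : nat) (p : 'S_n) : seq nat :=
  [seq n.+1 - v | v <- rev_word p].

Definition h1 (w : seq nat) : seq nat :=
  match w with
  | [:: 1; x; 2; y] => [:: 1; y; 2; x]
  | [:: x; 1; 2; y] => [:: y; 1; 2; x]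
  | [:: 1; x; 4; y] => [:: 1; y; 4; x]
  | [:: x; 1; 4; y] => [:: y; 1; 4; x]
  | [:: 4; x; 1; y] => [:: 4; y; 1; x]
  | [:: x; 4; 1; y] => [:: y; 4; 1; x]
  | [:: 4; x; 3; y] => [:: 4; y; 3; x]
  | [:: x; 4; 3; y] => [:: y; 4; 3; x]
  | _ => w
  end.

Definition fl (w : seq nat) : seq nat :=
  [seq (count (fun b => b < a) w).+1 | a <- w].

Definition in_window (i v : nat) : bool := i <= v <= i + 3.

(* [is_h i p q] says that q = h_i(p). *)
Definition is_h (n i : nat) (p q : 'S_n) : bool :=
  [forall k : 'I_n, ~~ in_window i (p k).+1 ==> (q k == p k)]
  && (fl (filter (in_window i) (word q))
      == h1 (fl (filter (in_window i) (word p)))).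

(* For n <= 3 the list of indices is empty, so that the action is trivial. *)
Definition shifted_dual_equiv (n : nat) : rel 'S_n :=
  connect (fun p q => has (fun i => is_h i p q) (iota 1 (n - 3))).

Definition sde_class (n : nat) (p : 'S_n) : {set 'S_n} :=
  [set q | shifted_dual_equiv p q].

Definition union_of_sde_classes (n : nat) (C : {set 'S_n}) : Prop :=
  exists A : {set 'S_n}, C = \bigcup_(p in A) sde_class p.

Local Open Scope ring_scope.

Definition ID_series (n : nat) (C : {set 'S_n}) : series :=
  fun m => \sum_(p in C) F n (ID p) m.

Definition schur_positive (n : nat) (f : series) : Prop :=
  exists c : partition_of n -> nat,
    f =1 (fun m => \sum_(la : partition_of n) (c la)%:Z * schur (parts la) m).

(* Main.v *)
(** In terms of inverse permutations and after flipping, the moves h_i become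
    Knuth moves on four consecutive letters, and f is the generating series of
    the words whose standardization lies in a set closed under these moves.
    When f is symmetric, its coefficient on s_mu is the signed count of such
    words whose weight is in the dot orbit of mu.  In a word that is not
    lattice, let k+1 be the first letter, from right to left, that breaks the
    lattice condition: the crystal reflection exchanging k and k+1, applied to
    the letters before it, is a sign-reversing involution.  The words that
    remain are lattice, and these standardize to SYam(mu).

    The key point is that the reflection stays inside the shifted dual
    equivalence class: a crystal operator that leaves at least one letter k+1
    unmatched amounts to sliding an unmatched letter through the matched pairs
    by Knuth moves, and the next unmatched letter provides the fourth letter
    of each move.  For the tableaux of a given shape all Knuth moves are
    available, so that Schur functions are symmetric, and the same count shows
    that their coefficients are as expected.

    This gives the second expansion.  Complementing descent sets exchanges
    s_la and s_la' and replaces each permutation by its reverse, so the first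
    expansion follows by applying the same argument to reversed
    permutations. *)

Require Import Defs.
From HB Require Import structures.
From mathcomp Require Import all_boot all_order all_fingroup all_algebra.
From mathcomp Require Import zify ring.
Set Implicit Arguments.
Unset Strict Implicit.
Unset Printing Implicit Defensive.
Import Order.TTheory GRing.Theory Num.Theory.

(** * Crystal operators and lattice words *)

(** The obstacle is that a shifted class allows a Knuth move only next to a suitable fourth letter,
    so an operator that changes the only unmatched k+1 may leave the class. The involution never
    meets this case: the letter k+1 that breaks the lattice condition is itself unmatched and stands
    to the right of the reflected prefix, so each operator used in the reflection acts on a whole
    word with at least two unmatched k+1, one of which survives.

    The same choice explains the dot action: the reflection exchanges the two counts in the prefix,
    while the rest of the word has exactly one more k+1 than k.

    Coefficients are extracted by a norm argument: a dominant weight is the unique shortest element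
    of its dot orbit, so a symmetric series of fixed degree whose signed sums all vanish is zero.
    This is applied to f minus its expected expansion; for a Schur function the involution leaves a
    single lattice word.

    Symmetry of f is used a second time, to reverse the alphabet: this replaces each permutation by
    its flip without changing f. *)

Section Crystal.
Variable k : nat.

(* Each letter k.+1 opens a parenthesis, and each k closes one: [phi] and [eps]
   count the unmatched letters k, resp. k.+1.  The operator [raise] changes the
   first unmatched k.+1 into k, [lower] the last unmatched k into k.+1. *)
Fixpoint phi (v : seq nat) : nat :=
  if v is x :: v' then
    if x == k then (phi v').+1 else if x == k.+1 then (phi v').-1 else phi v'
  else 0.

Fixpoint eps (v : seq nat) : nat :=
  if v is x :: v' then ((x == k.+1) && (phi v' == 0)) + eps v' else 0.

Fixpoint raise (v : seq nat) : seq nat :=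
  if v is x :: v' then
    if (x == k.+1) && (phi v' == 0) then k :: v' else x :: raise v'
  else [::].

Fixpoint lower (v : seq nat) : seq nat :=
  if v is x :: v' then
    if (x == k) && (phi v' == 0) then k.+1 :: v' else x :: lower v'
  else [::].

Let neqS : (k.+1 == k) = false. Proof. by rewrite gtn_eqF. Qed.
Let neqS' : (k == k.+1) = false. Proof. by rewrite ltn_eqF. Qed.

Lemma phi_raise v : 0 < eps v -> phi (raise v) = (phi v).+1.
Proof.
elim: v => //= x v IHv; case: ifP => [/andP[/eqP-> /eqP p0] _|h /IHv e] /=.
  by rewrite !eqxx neqS p0.
rewrite e; case: (x =P k) => // _; case: (x =P k.+1) h => //= _ /negbT.
by case: (phi v).
Qed.

Lemma eps_raise v : 0 < eps v -> eps (raise v) = (eps v).-1.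
Proof.
elim: v => //= x v IHv; case: ifP => [_ _|h ev] /=.
  by rewrite neqS'.
by rewrite (phi_raise ev) andbF IHv.
Qed.

Lemma raiseK v : 0 < eps v -> lower (raise v) = v.
Proof.
elim: v => //= x v IHv; case: ifP => [/andP[/eqP-> /eqP p0] _|h ev] /=.
  by rewrite eqxx p0.
by rewrite (phi_raise ev) andbF IHv.
Qed.

Lemma phi_lower v : 0 < phi v -> phi (lower v) = (phi v).-1.
Proof.
elim: v => //= x v IHv; case: (x =P k) => [->|nk] /=.
  case: eqP => [p0|p0] _ /=; first by rewrite neqS eqxx p0.
  by rewrite eqxx IHv //; lia.
case: (x =P k) => // _; case: (x =P k.+1) => [_ p1|_ p1]; rewrite IHv; lia.
Qed.

Lemma eps_lower v : 0 < phi v -> eps (lower v) = (eps v).+1.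
Proof.
elim: v => //= x v IHv; case: (x =P k) => [->|nk] /=.
  case: eqP => [p0|p0] _ /=; first by rewrite p0 neqS' eqxx.
  by rewrite neqS' IHv //; lia.
case: (x =P k.+1) => [_ p1|_ p1] /=; last by rewrite IHv.
by rewrite phi_lower ?IHv; lia.
Qed.

Lemma lowerK v : 0 < phi v -> raise (lower v) = v.
Proof.
elim: v => //= x v IHv; case: (x =P k) => [->|nk] /=.
  case: eqP => [p0|p0] _ /=; first by rewrite p0 eqxx.
  by rewrite neqS' IHv //; lia.
case: (x =P k.+1) => [_ p1|_ p1] /=; last by rewrite IHv.
rewrite phi_lower ?IHv; try lia.
by case: eqP => //; lia.
Qed.

Lemma phi_cat u y : phi y = 0 -> phi (u ++ y) = phi u.
Proof. by move=> y0; elim: u => //= x u ->. Qed.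

Lemma eps_cat u y : phi y = 0 -> eps (u ++ y) = eps u + eps y.
Proof. by move=> y0; elim: u => //= x u ->; rewrite phi_cat // addnA. Qed.

Lemma raise_cat u y : phi y = 0 -> 0 < eps u -> raise (u ++ y) = raise u ++ y.
Proof.
move=> y0; elim: u => //= x u IHu; rewrite phi_cat //.
by case: ifP => //= _ /IHu->.
Qed.

Definition swap_letters (i : nat) : nat :=
  if i == k then k.+1 else if i == k.+1 then k else i.

Lemma swap_lettersK : involutive swap_letters.
Proof.
move=> i; rewrite /swap_letters; case: (i =P k) => [->|ik].
  by rewrite neqS eqxx.
by case: (i =P k.+1) => [->|ik1]; [rewrite eqxx | case: eqP => //; case: eqP].
Qed.

(** The matched letters k and k.+1 are equally many. *)
Lemma count_eps_phi v :
  count_mem k v + eps v = count_mem k.+1 v + phi v.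
Proof.
elim: v => //= x v IHv; case: (x =P k) => [->|xk] /=.
  by rewrite neqS'; lia.
case: (x =P k.+1) => [_|xk1] /=; last by lia.
by case: eqP; lia.
Qed.

Lemma count_raise i v : 0 < eps v ->
  count_mem i (raise v) + (i == k.+1) = count_mem i v + (i == k).
Proof.
elim: v => //= x v IHv; case: ifP => [/andP[/eqP-> _] _|_ /IHv] /=; last by lia.
by rewrite ![_ == i]eq_sym; lia.
Qed.

Lemma count_lower i v : 0 < phi v ->
  count_mem i (lower v) + (i == k) = count_mem i v + (i == k.+1).
Proof.
move=> pv; rewrite -{2}(lowerK pv) count_raise //.
by rewrite eps_lower.
Qed.

Lemma size_raise v : size (raise v) = size v.
Proof. by elim: v => //= x v IHv; case: ifP => //= _; rewrite IHv. Qed.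

Lemma size_lower v : size (lower v) = size v.
Proof. by elim: v => //= x v IHv; case: ifP => //= _; rewrite IHv. Qed.

Lemma iter_raiseP m v : m <= eps v ->
  [/\ phi (iter m raise v) = phi v + m, eps (iter m raise v) = eps v - m
    & iter m lower (iter m raise v) = v].
Proof.
elim: m => [|m IHm] mv; first by rewrite addn0 subn0.
have [p e l] := IHm (ltnW mv); rewrite !iterS phi_raise ?eps_raise; try lia.
split; try lia; rewrite -iterS iterSr raiseK //; lia.
Qed.

Lemma iter_lowerP m v : m <= phi v ->
  [/\ phi (iter m lower v) = phi v - m, eps (iter m lower v) = eps v + m
    & iter m raise (iter m lower v) = v].
Proof.
elim: m => [|m IHm] mv; first by rewrite addn0 subn0.
have [p e l] := IHm (ltnW mv); rewrite !iterS phi_lower ?eps_lower; try lia.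
split; try lia; rewrite -iterS iterSr lowerK //; lia.
Qed.

(** The Lascoux-Schützenberger reflection: the word of the same string of [raise] and [lower] in
    which [eps] and [phi] are exchanged. *)
Definition reflect_word (v : seq nat) : seq nat :=
  if phi v <= eps v then iter (eps v - phi v) raise v
  else iter (phi v - eps v) lower v.

Lemma phi_reflect v : phi (reflect_word v) = eps v.
Proof.
rewrite /reflect_word; case: leqP => h.
  by have [-> _ _] := @iter_raiseP (eps v - phi v) v ltac:(lia); lia.
by have [-> _ _] := @iter_lowerP (phi v - eps v) v ltac:(lia); lia.
Qed.

Lemma eps_reflect v : eps (reflect_word v) = phi v.
Proof.
rewrite /reflect_word; case: leqP => h.
  by have [_ -> _] := @iter_raiseP (eps v - phi v) v ltac:(lia); lia.
by have [_ -> _] := @iter_lowerP (phi v - eps v) v ltac:(lia); lia.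
Qed.

Lemma reflect_wordK : involutive reflect_word.
Proof.
move=> v; rewrite {1}/reflect_word phi_reflect eps_reflect /reflect_word.
case: (ltngtP (phi v) (eps v)) => h; last by rewrite h subnn.
  by have [_ _ ->] := @iter_raiseP (eps v - phi v) v ltac:(lia).
by have [_ _ ->] := @iter_lowerP (phi v - eps v) v ltac:(lia).
Qed.

Lemma size_reflect v : size (reflect_word v) = size v.
Proof.
rewrite /reflect_word; case: ifP => _; set m := (X in iter X).
  by elim: m => //= m; rewrite size_raise.
by elim: m => //= m; rewrite size_lower.
Qed.

Lemma count_reflect i v :
  count_mem i (reflect_word v) = count_mem (swap_letters i) v.
Proof.
have other j : j != k -> j != k.+1 ->
    count_mem j (reflect_word v) = count_mem j v.
  move=> jk jk1; rewrite /reflect_word; case: leqP => h.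
    have: eps v - phi v <= eps v by lia.
    elim: (eps v - phi v) => //= m IHm mv.
    have := @count_raise j (iter m raise v); have [_ -> _] := iter_raiseP (ltnW mv).
    by rewrite (negPf jk) (negPf jk1) !addn0 => ->; [apply: IHm | ]; lia.
  have: phi v - eps v <= phi v by lia.
  elim: (phi v - eps v) => //= m IHm mv.
  have := @count_lower j (iter m lower v); have [-> _ _] := iter_lowerP (ltnW mv).
  by rewrite (negPf jk) (negPf jk1) !addn0 => ->; [apply: IHm | ]; lia.
(* The operators preserve this sum, and [count_eps_phi] gives the difference, since [phi] and [eps]
   are exchanged; together they determine both counts. *)
have kE : count_mem k (reflect_word v) + count_mem k.+1 (reflect_word v)
    = count_mem k v + count_mem k.+1 v.
  rewrite /reflect_word; case: leqP => h.
    have: eps v - phi v <= eps v by lia.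
    elim: (eps v - phi v) => //= m IHm mv.
    have ev : 0 < eps (iter m raise v) by have [_ -> _] := iter_raiseP (ltnW mv); lia.
    have := count_raise k ev; have := count_raise k.+1 ev; have := IHm (ltnW mv).
    by rewrite !eqxx neqS neqS' /=; lia.
  have: phi v - eps v <= phi v by lia.
  elim: (phi v - eps v) => //= m IHm mv.
  have ev : 0 < phi (iter m lower v) by have [-> _ _] := iter_lowerP (ltnW mv); lia.
  have := count_lower k ev; have := count_lower k.+1 ev; have := IHm (ltnW mv).
  by rewrite !eqxx neqS neqS' /=; lia.
have := count_eps_phi (reflect_word v); have := count_eps_phi v.
rewrite phi_reflect eps_reflect /swap_letters.
case: (i =P k) => [->|ik]; first lia.
case: (i =P k.+1) => [->|ik1]; first lia.
by move=> _ _; apply: other; apply/eqP.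
Qed.

(** The suffix y has no unmatched k, so operators on u act in the same way on u ++ y, and its
    unmatched k.+1 raises [eps] of the whole word above 1. Lowering is treated as the inverse of
    raising. *)
Lemma reflect_invariant (H : pred (seq nat)) y :
    phi y = 0 -> 0 < eps y ->
    (forall v, 1 < eps v -> H (raise v) = H v) ->
  forall u, H (reflect_word u ++ y) = H (u ++ y).
Proof.
move=> y0 y1 Hraise u.
have Hup u' m : m <= eps u' -> H (iter m raise u' ++ y) = H (u' ++ y).
  elim: m => //= m IHm mu; rewrite -(IHm (ltnW mu)).
  have [_ e _] := iter_raiseP (ltnW mu).
  rewrite -raise_cat // ?Hraise // ?eps_cat // ?e; lia.
rewrite /reflect_word; case: leqP => h; first by apply: Hup; lia.
have [_ e l] := @iter_lowerP (phi u - eps u) u ltac:(lia).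
by rewrite -[in RHS]l Hup //; lia.
Qed.
End Crystal.

(** * Lattice words, read from right to left, and the sign-reversing involution *)

Fixpoint lattice (v : seq nat) : bool :=
  if v is x :: v' then
    lattice v' && ((x == 0) || (count_mem x v' < count_mem x.-1 v'))
  else true.

Lemma lattice_catr u v : lattice (u ++ v) -> lattice v.
Proof. by elim: u => //= x u IHu /andP[/IHu]. Qed.

Lemma lattice_count v i : lattice v -> count_mem i.+1 v <= count_mem i v.
Proof.
elim: v => //= x v IHv /andP[/IHv lv]; case: (x =P i.+1) => [->|xi] /=.
  by rewrite gtn_eqF //; lia.
by lia.
Qed.

Lemma lattice_eps k v : lattice v -> eps k v = 0.
Proof.
elim: v => //= x v IHv /andP[lv]; rewrite IHv // addn0.
case: (x =P k.+1) => [->|] //= h; case: eqP => // p0.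
by have := count_eps_phi k v; rewrite IHv //=; lia.
Qed.

Lemma lattice_phi k v : lattice v ->
  phi k v = count_mem k v - count_mem k.+1 v.
Proof. by move=> lv; have := count_eps_phi k v; rewrite (lattice_eps k lv); lia. Qed.


Fixpoint lattice_start (v : seq nat) : nat :=
  if v is x :: v' then if lattice v then 0 else (lattice_start v').+1 else 0.

Lemma lattice_start_lattice v : lattice v -> lattice_start v = 0.
Proof. by case: v => //= x v ->. Qed.

Lemma lattice_start_cat u x s : lattice s -> ~~ lattice (x :: s) ->
  lattice_start (u ++ x :: s) = (size u).+1.
Proof.
move=> ls ns; elim: u => [|y u IHu].
  by rewrite [LHS]/= -/(lattice (x :: s)) (negPf ns) lattice_start_lattice.
rewrite [LHS]/= -/(lattice (y :: (u ++ x :: s))) IHu.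
by case: ifP => // /(@lattice_catr (y :: u)); rewrite (negPf ns).
Qed.

Lemma not_latticeP v : ~~ lattice v ->
  exists u k s, [/\ v = u ++ k.+1 :: s, lattice s & ~~ lattice (k.+1 :: s)].
Proof.
elim: v => // x v IHv nl; case lv: (lattice v).
  by case: x nl => [|k] nl; [rewrite /= lv in nl | exists [::], k, v].
by have [u [k [s [-> ls ns]]]] := IHv (negbT lv); exists (x :: u), k, s.
Qed.

(** The violation means that s has equally many letters k and k.+1; as s is lattice, all of them are
    matched, and the added letter is the only unmatched one. *)
Lemma violation_phi k s : lattice s -> ~~ lattice (k.+1 :: s) ->
  phi k (k.+1 :: s) = 0 /\ eps k (k.+1 :: s) = 1.
Proof.
move=> ls; rewrite /= ls /= -leqNgt => h.
have p0 : phi k s = 0 by rewrite lattice_phi //=; lia.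
by rewrite eqxx p0 (lattice_eps k ls) gtn_eqF.
Qed.

(* The letter just before the longest lattice suffix is the first one, reading
   from right to left, to break the lattice condition; what precedes it is
   reflected. *)
Definition star (v : seq nat) : seq nat :=
  let p := (lattice_start v).-1 in
  reflect_word (nth 0 v p).-1 (take p v) ++ drop p v.

Lemma starE u k s : lattice s -> ~~ lattice (k.+1 :: s) ->
  star (u ++ k.+1 :: s) = reflect_word k u ++ k.+1 :: s.
Proof.
move=> ls ns; rewrite /star lattice_start_cat //= nth_cat ltnn subnn /=.
by rewrite take_size_cat // drop_size_cat.
Qed.

Lemma starK v : ~~ lattice v -> star (star v) = v.
Proof.
by move=> /not_latticeP[u [k [s [-> ls ns]]]]; rewrite !starE // reflect_wordK.
Qed.

(** The suffix that breaks the lattice condition is left in place. On a lattice word the reflected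
    prefix is empty, so [star] is the identity. *)
Lemma lattice_star v : lattice (star v) = lattice v.
Proof.
case lv: (lattice v); first by rewrite /star lattice_start_lattice //= take0 drop0.
have [u [k [s [-> ls ns]]]] := not_latticeP (negbT lv); rewrite starE //.
by apply: contraNF ns => /lattice_catr.
Qed.

Lemma size_star v : size (star v) = size v.
Proof.
case lv: (lattice v); first by rewrite /star lattice_start_lattice //= take0 drop0.
have [u [k [s [-> ls ns]]]] := not_latticeP (negbT lv).
by rewrite starE // !size_cat size_reflect.
Qed.

(** The shift by one comes from the suffix that is not reflected, where k.+1 occurs once more than
    k. The weight thus changes by the dot action of a simple transposition. *)
Lemma count_star v : ~~ lattice v -> exists k,
  [/\ k.+1 \in v, forall i, i != k -> i != k.+1 ->
        count_mem i (star v) = count_mem i v,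
      (count_mem k (star v)).+1 = count_mem k.+1 v
    & count_mem k.+1 (star v) = (count_mem k v).+1].
Proof.
move=> /not_latticeP[u [k [s [-> ls ns]]]]; exists k; rewrite starE //.
rewrite mem_cat mem_head orbT; split=> // [i ik ik1||].
- rewrite !count_cat count_reflect /swap_letters.
  by rewrite (negPf ik) (negPf ik1).
all: have ks : count_mem k.+1 s = count_mem k s
  by have := lattice_count k ls; move: ns; rewrite /= ls /=; lia.
all: rewrite !count_cat count_reflect /swap_letters /= !eqxx.
all: by rewrite ?(gtn_eqF (ltnSn k)) ?(ltn_eqF (ltnSn k)) /=; move: ks => /=; lia.
Qed.

Lemma star_invariant (H : pred (seq nat)) v :
    (forall k v', size v' = size v -> 1 < eps k v' -> H (raise k v') = H v') ->
  H (star v) = H v.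
Proof.
move=> Hr; case lv: (lattice v).
  by rewrite /star lattice_start_lattice //= take0 drop0.
have [u [k [s [vE ls ns]]]] := not_latticeP (negbT lv).
have [p0 e1] := violation_phi ls ns; rewrite vE starE //.
(* The hypothesis only covers words of the size of v, while [reflect_invariant] asks for all
   words. *)
pose H' := [pred w | (size w == size v) && H w].
have Hr' w : 1 < eps k w -> H' (raise k w) = H' w.
  by move=> ew; rewrite /H' /= size_raise; case: eqP => //= sw; apply: Hr.
have e0 : 0 < eps k (k.+1 :: s) by rewrite e1.
have := reflect_invariant p0 e0 Hr' u.
by rewrite /H' /= vE !size_cat size_reflect eqxx.
Qed.

(** * Alternating sums over dot orbits *)

Local Open Scope ring_scope.

Section Weights.
Variables N : nat.
Implicit Types (al mu : {ffun 'I_N -> int}) (s : 'S_N).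

Definition wt (v : seq nat) : {ffun 'I_N -> int} :=
  [ffun i => (count_mem (val i) v)%:Z].

(* The symmetric group permutes the entries of mu - (0, 1, 2, ...). *)
Definition dot mu s : {ffun 'I_N -> int} :=
  [ffun i => mu (s i) - (s i)%:Z + i%:Z].

Definition weight_norm al : int := \sum_i al i ^+ 2.

Definition dominant mu : Prop := forall i j : 'I_N, (i <= j)%N -> mu j <= mu i.

Lemma dotM mu s t : dot (dot mu s) t = dot mu (t * s)%g.
Proof. by apply/ffunP=> i; rewrite !ffunE permM; ring. Qed.

Lemma dot1 mu : dot mu 1%g = mu.
Proof. by apply/ffunP=> i; rewrite ffunE perm1; ring. Qed.

(** The decomposition by thresholds t on which [rearrangement] rests. *)
Lemma ord_sum_lt (i : 'I_N) : i%:Z = \sum_(t < N) (t < i)%N%:Z.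
Proof.
have -> : \sum_(t < N) (t < i)%N%:Z = (\sum_(t < N) (t < i)%N)%:Z.
  by rewrite (big_morph Posz PoszD (erefl (Posz 0))).
congr Posz; rewrite -(big_mkord xpredT (fun t => (t < i)%N : nat)).
rewrite (big_cat_nat (n := i)) //=; last exact: ltnW.
rewrite big_nat (eq_bigr (fun=> 1%N)) => [|t /andP[_ ->]] //.
rewrite -big_nat sum_nat_const_nat muln1 subn0.
rewrite big_nat big1 ?addn0 // => t /andP[it _].
by rewrite ltnNge it.
Qed.

(* Rearrangement: both sums over t of the indicators of [t < s j] and [t < j]
   count the same set, so mu j may be replaced by mu j - mu t. *)
Lemma rearrangement mu s : dominant mu ->
  0 <= \sum_j ((s j)%:Z - j%:Z) * mu j.
Proof.
move=> dmu.
have -> : \sum_j ((s j)%:Z - j%:Z) * mu j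
   = \sum_(t < N) \sum_j ((t < s j)%N%:Z - (t < j)%N%:Z) * (mu j - mu t).
  transitivity (\sum_(t < N) \sum_j ((t < s j)%N%:Z - (t < j)%N%:Z) * mu j).
    rewrite exchange_big; apply: eq_bigr => j _ /=.
    by rewrite -mulr_suml sumrB -!ord_sum_lt.
  apply: eq_bigr => t _; under [RHS]eq_bigr do rewrite mulrBr.
  rewrite sumrB -[RHS in _ = _ - RHS]mulr_suml sumrB.
  rewrite [X in _ - (_ - X) * _](reindex_inj (@perm_inj _ s)) /=.
  by rewrite subrr mul0r subr0.
apply: sumr_ge0 => t _; apply: sumr_ge0 => j _.
case: (ltnP t j) => tj.
  have := dmu _ _ (ltnW tj); case: (t < s j)%N => /=; nia.
have := dmu _ _ tj; case: (t < s j)%N => /=; nia.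
Qed.

(** Expanding the squares leaves the sum of the (s i - i)^2, positive for s != 1, and a cross term
    which, after reindexing by s, is that of [rearrangement] for the inverse of s. *)
Lemma weight_norm_dot mu s : dominant mu -> s != 1%g ->
  weight_norm mu < weight_norm (dot mu s).
Proof.
move=> dmu s1.
rewrite -subr_gt0.
have -> : weight_norm (dot mu s) - weight_norm mu
   = \sum_(i < N) ((s i)%:Z - i%:Z) ^+ 2
     + 2 * \sum_i (((s^-1)%g i)%:Z - i%:Z) * mu i.
  rewrite /weight_norm [X in _ - X](reindex_inj (@perm_inj _ s)) /= -sumrB.
  rewrite [X in _ + 2 * X](reindex_inj (@perm_inj _ s)) /= mulr_sumr.
  rewrite -big_split /=; apply: eq_bigr => i _.
  by rewrite ffunE permK; ring.
apply: ltr_pwDl; last by rewrite mulr_ge0 ?rearrangement.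
have [i si] : exists i, s i != i.
  apply/existsP; apply: contraNT s1 => /existsPn h.
  by apply/eqP/permP=> i; rewrite perm1; apply/eqP; have := h i; rewrite negbK.
rewrite (bigD1 i) //= ltr_pwDl ?sumr_ge0 // => [|j _]; last exact: sqr_ge0.
by rewrite lt_neqAle sqr_ge0 eq_sym sqrf_eq0 subr_eq0 andbT.
Qed.

(* By [weight_norm_dot] all the terms but the one of s = 1 have a norm larger
   than that of mu, so g vanishes by descending induction on the norm; the
   inner induction sorts the weight. *)
Lemma alternating_sums_eq0 (n : nat) (g : {ffun 'I_N -> int} -> int) :
    (forall al, g al != 0 -> (forall i, 0 <= al i) /\ \sum_i al i = n%:Z) ->
    (forall al (i j : 'I_N), j = i.+1 :> nat ->
       g [ffun x => al (tperm i j x)] = g al) ->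
    (forall mu, (forall i, 0 <= mu i) -> \sum_i mu i = n%:Z -> dominant mu ->
       \sum_s (-1) ^+ odd_perm s * g (dot mu s) = 0) ->
  forall al, g al = 0.
Proof.
move=> supp sym alt.
(* Nonnegative entries of sum n have norm at most n^2, so d can measure the room left for the norm.
   The second measure decreases when an ascent al i < al i.+1 is exchanged, which keeps the norm. *)
suff H (d e : nat) al : n%:Z ^+ 2 - weight_norm al < d%:Z ->
    \sum_(i < N) i%:Z * al i < e%:Z -> g al = 0.
  move=> al; apply: (H (absz (n%:Z ^+ 2 - weight_norm al)).+1
                       (absz (\sum_(i < N) i%:Z * al i)).+1); lia.
elim: d e al => [|d IHd] e al.
  move=> hd _; apply/eqP; apply: contraTT isT => /supp[al0 aln].
  suff: weight_norm al <= n%:Z ^+ 2 by lia.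
  rewrite -aln expr2 mulr_suml; apply: ler_sum => i _.
  rewrite expr2; apply: ler_wpM2l => //; rewrite (bigD1 i) //= lerDl.
  by apply: sumr_ge0.
elim: e al => [|e IHe] al hd he; apply/eqP; apply: contraTT isT => g_neq0.
  have [al0 _] := supp _ g_neq0.
  suff: 0 <= \sum_(i < N) i%:Z * al i by lia.
  by apply: sumr_ge0 => i _; rewrite mulr_ge0.
have [al0 aln] := supp _ g_neq0.
have [dal|[i [j [ji lt_al]]]] : dominant al \/
    exists i j : 'I_N, j = i.+1 :> nat /\ al i < al j.
- case: (boolP [exists i : 'I_N, exists j : 'I_N, (j == i.+1 :> nat) && (al i < al j)]).
    by move=> /existsP[i /existsP[j /andP[/eqP ji lt]]]; right; exists i, j.
  move=> /existsPn h; left=> i j; have [m] := ubnP (j - i)%N.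
  elim: m j => // m IHm j jm ij; have [->|/eqP nij] := altP (i =P j); first by [].
  have ij1 : (j.-1 < N)%N by apply: leq_ltn_trans (ltn_ord j); apply: leq_pred.
  have nij' : i != j :> nat by apply/eqP=> /val_inj.
  apply: le_trans (IHm (Ordinal ij1) _ _) => /=; try lia.
  have /existsPn/(_ j) := h (Ordinal ij1).
  by rewrite negb_and -leNgt /=; case: eqP => //=; lia.
- have := alt al al0 aln dal; rewrite (bigD1 1%g) //= dot1 odd_perm1 mul1r.
  rewrite big1 => [/eqP|s s1]; first by rewrite addr0 (negPf g_neq0).
  rewrite (IHd (absz (\sum_(i < N) i%:Z * dot al s i)).+1) ?mulr0 //; last by lia.
  by have := weight_norm_dot dal s1; lia.
- have ij : i != j by apply/eqP=> /(congr1 val) /=; lia.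
  pose al' := [ffun x => al (tperm i j x)].
  suff: g al' = 0 by rewrite sym // => g0'; rewrite g0' eqxx in g_neq0.
  have tp x : x != i -> x != j -> tperm i j x = x.
    by move=> xi xj; rewrite tpermD // eq_sym.
  apply: IHe.
    suff -> : weight_norm al' = weight_norm al by [].
    rewrite /weight_norm [RHS](reindex_inj (@perm_inj _ (tperm i j))) /=.
    by apply: eq_bigr => x _; rewrite ffunE.
  have split2 (h : 'I_N -> int) :
      \sum_x h x = h i + (h j + \sum_(x | (x != i) && (x != j)) h x).
    by rewrite (bigD1 i) // (bigD1 j) 1?eq_sym.
  move: he; rewrite !split2.
  under [X in _ -> is_true (_ + (_ + X) < _)]eq_bigr => x /andP[xi xj]
    do rewrite ffunE tp //.
  rewrite !ffunE tpermL tpermR ji intS !mulrDl !mul1r.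
  move: (\sum_(x | _) _) (i%:Z * al i) (i%:Z * al j) => x y z. lia.
Qed.
End Weights.

(** * Coefficients in finitely many variables and their signed sums *)

Definition of_size (n : nat) (H : pred (seq nat)) : pred (seq nat) :=
  fun v => (size v == n) && H v.

Definition adjacent_symmetric (f : series) : Prop :=
  forall k m, f (map (swap_letters k) m) = f m.

(** The bound 1, rather than 0, is what shifted classes afford: an unmatched k.+1 must remain after
    raising. *)
Definition raise_closed (n : nat) (H : pred (seq nat)) : Prop :=
  forall k v, size v = n -> (1 < eps k v)%N -> H (raise k v) = H v.

Lemma sum_wt_size N v : all (fun x => x < N)%N v ->
  \sum_i wt N v i = (size v)%:Z.
Proof.
elim: v => [|x v IHv] /=.
  by move=> _; rewrite big1 // => i _; rewrite ffunE.
move=> /andP[xN /IHv E]; rewrite intS -E (bigD1 (Ordinal xN)) //=.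
rewrite [X in _ = 1 + X](bigD1 (Ordinal xN)) //= addrA !ffunE /= eqxx.
rewrite PoszD; congr (_ + _); apply: eq_bigr => i ix; rewrite !ffunE /=.
by case: eqP => // xi; case/eqP: ix; apply/val_inj.
Qed.

Lemma count_sum (T : Type) (s : seq T) (P Q : pred T) :
  (count (predI P Q) s)%:Z = \sum_(x <- s | P x) (Q x)%:Z.
Proof.
elim: s => [|x s IHs]; first by rewrite big_nil.
by rewrite big_cons /= PoszD IHs; case: (P x) => //=; rewrite add0r.
Qed.

Section Multiplicities.
Variables N n : nat.

Definition words : seq (seq nat) :=
  [seq map val (tval t) | t : n.-tuple 'I_N].

Lemma mem_words v : (v \in words) = (size v == n) && all (fun x => x < N)%N v.
Proof.
apply/imageP/andP => [[t _ ->]|[/eqP sv /allP vN]].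
  rewrite size_map size_tuple eqxx; split=> //.
  by apply/allP => x /mapP[i _ ->]; apply: ltn_ord.
have sv' : size (pmap (insub : nat -> option 'I_N) v) == n.
  by rewrite size_pmap_sub -sv -[eqbRHS]count_predT; apply/eqP/eq_in_count.
exists (Tuple sv') => //=; rewrite pmap_filter; last exact: insubK.
by rewrite -[LHS]filter_predT; apply/eq_in_filter => x /vN xN; rewrite /= isSome_insub.
Qed.

Lemma uniq_words : uniq words.
Proof.
by rewrite map_inj_uniq ?enum_uniq // => s t /(inj_map val_inj)/val_inj.
Qed.

Lemma sum_wt v : v \in words -> \sum_i wt N v i = n%:Z.
Proof. by rewrite mem_words => /andP[/eqP <- /sum_wt_size]. Qed.

Lemma perm_words m v : m \in words ->
  perm_eq v m = (v \in words) && (wt N v == wt N m).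
Proof.
rewrite !mem_words => /andP[/eqP sm /allP mN]; apply/idP/idP.
  move=> vm; rewrite (perm_size vm) sm eqxx (perm_all _ vm) /=.
  apply/andP; split; first exact/allP.
  by apply/eqP/ffunP=> i; rewrite !ffunE (seq.permP vm).
move=> /andP[/andP[_ /allP vN] /eqP/ffunP E]; apply/allP => x /= xvm.
have xN : (x < N)%N by move: xvm; rewrite mem_cat => /orP[/vN|/mN].
by have := E (Ordinal xN); rewrite !ffunE /= => -[->].
Qed.

Definition mult (H : pred (seq nat)) (al : {ffun 'I_N -> int}) : int :=
  \sum_(v <- words | H v) (wt N v == al)%:Z.

Lemma gen_series_mult H m : m \in words ->
  gen_series (of_size n H) m = mult H (wt N m).
Proof.
move=> mw.
have /seq.permP E : perm_eq (permutations m) [seq v <- words | wt N v == wt N m].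
  apply: uniq_perm; rewrite ?permutations_uniq ?filter_uniq ?uniq_words //.
  by move=> v; rewrite mem_permutations perm_words // mem_filter andbC.
rewrite /gen_series E count_filter /mult -count_sum; congr Posz.
apply: eq_in_count => v; rewrite mem_words => /andP[sv _].
by rewrite /= /of_size sv.
Qed.

Lemma mult_neq0 H al : mult H al != 0 -> exists2 v, v \in words & wt N v = al.
Proof.
rewrite /mult -count_sum eqz_nat -lt0n -has_count => /hasP[v vw /andP[_ /eqP <-]].
by exists v.
Qed.

Lemma all_swap_letters k v : (k.+1 < N)%N -> all (fun x => x < N)%N v ->
  all (fun x => x < N)%N (map (swap_letters k) v).
Proof.
move=> kN /allP vN; rewrite all_map; apply/allP => x /vN /= xN.
by rewrite /swap_letters; case: eqP => // _; case: eqP => // _; apply: ltnW.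
Qed.

Lemma count_swap_letters k i v :
  count_mem i (map (swap_letters k) v) = count_mem (swap_letters k i) v.
Proof.
rewrite count_map; apply: eq_count => x /=.
by rewrite (inv_eq (@swap_lettersK k)).
Qed.

Lemma swap_letters_tperm (i j x : 'I_N) : j = i.+1 :> nat ->
  swap_letters i x = tperm i j x :> nat.
Proof.
move=> ji; rewrite /swap_letters -ji; case: tpermP => [->|->|/eqP xi /eqP xj].
- by rewrite eqxx.
- by rewrite ji eqxx gtn_eqF.
by rewrite -!val_eqE in xi xj; rewrite (negPf xi) (negPf xj).
Qed.

Lemma wt_swap_letters (i j : 'I_N) v : j = i.+1 :> nat ->
  wt N (map (swap_letters i) v) = [ffun x => wt N v (tperm i j x)].
Proof.
move=> ji; apply/ffunP=> x; rewrite !ffunE count_swap_letters.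
by rewrite (swap_letters_tperm x ji).
Qed.

Lemma mult_sym H (i j : 'I_N) (al : {ffun 'I_N -> int}) :
  adjacent_symmetric (gen_series (of_size n H)) -> j = i.+1 :> nat ->
  mult H [ffun x => al (tperm i j x)] = mult H al.
Proof.
move=> symH ji.
have key v : v \in words ->
    mult H [ffun x => wt N v (tperm i j x)] = mult H (wt N v).
  move=> vw; rewrite -wt_swap_letters // -!gen_series_mult //.
  move: vw; rewrite !mem_words size_map => /andP[-> vN].
  by apply: all_swap_letters; rewrite // -ji.
(* Symmetry is available at weights of words only, and a weight of nonzero multiplicity is one. *)
case: (mult H al =P 0) => [al0|/eqP/mult_neq0[v vw <-]]; last exact: key.
rewrite al0; case: (mult H [ffun x => al (tperm i j x)] =P 0) => // /eqP/mult_neq0[v vw vE].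
have E : al = [ffun x => wt N v (tperm i j x)].
  by apply/ffunP=> x; rewrite vE !ffunE tpermK.
by rewrite -vE -key // -E al0.
Qed.

Lemma star_words v : (star v \in words) = (v \in words).
Proof.
rewrite !mem_words size_star; congr (_ && _).
case lv: (lattice v); first by rewrite /star lattice_start_lattice //= take0 drop0.
have [k [k1v other c1 c2]] := count_star (negbT lv).
have km : k.+1 \in star v by rewrite -has_pred1 has_count c2.
apply/allP/allP => h x xv.
  have k1N := h _ km; case: (x =P k) => [->|/eqP xk]; first exact: ltnW.
  case: (x =P k.+1) => [->//|/eqP xk1].
  by apply: h; rewrite -has_pred1 has_count other // -has_count has_pred1.
have k1N := h _ k1v; case: (x =P k) => [->|/eqP xk]; first exact: ltnW.
case: (x =P k.+1) => [->//|/eqP xk1].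
by apply: h; rewrite -has_pred1 has_count -other // -has_count has_pred1.
Qed.

(** For a dominant mu the entries of mu - (0, 1, 2, ...) are distinct, so at most one term is
    nonzero. *)
Definition dot_sign mu (al : {ffun 'I_N -> int}) : int :=
  \sum_s (-1) ^+ odd_perm s * (al == dot mu s)%:Z.

Lemma dot_sign_star mu v : v \in words -> ~~ lattice v ->
  dot_sign mu (wt N (star v)) = - dot_sign mu (wt N v).
Proof.
rewrite mem_words => /andP[_ /allP vN] nl.
have [k [/vN k1N other c1 c2]] := count_star nl.
pose i := Ordinal (ltnW k1N); pose j := Ordinal k1N.
have ij : i != j by rewrite -val_eqE /= ltn_eqF.
rewrite /dot_sign (reindex_inj (mulgI (tperm i j))) -sumrN /=.
apply: eq_bigr => s _; rewrite odd_permM odd_tperm ij /= signrN mulNr.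
congr (- (_ * _)); congr (Posz (nat_of_bool _)).
have wi : wt N (star v) i + 1 = wt N v j by rewrite !ffunE /= -c1 intS addrC.
have wj : wt N (star v) j = wt N v i + 1 by rewrite !ffunE /= c2 intS addrC.
have wo x : x != i -> x != j -> wt N (star v) x = wt N v x.
  by move=> xi xj; rewrite !ffunE other.
apply/eqP/eqP => [E|E]; apply/ffunP=> x.
  have [->|xi] := eqVneq x i.
    apply: (addIr 1); rewrite -wj E !ffunE permM tpermR /= ?intS; lia.
  have [->|xj] := eqVneq x j; first by rewrite -wi E !ffunE permM tpermL /= ?intS; lia.
  by rewrite -wo // E !ffunE permM tpermD // eq_sym.
have [->|xi] := eqVneq x i.
  apply: (addIr 1); rewrite wi E !ffunE permM tpermL /= ?intS; lia.
have [->|xj] := eqVneq x j; first by rewrite wj E !ffunE permM tpermR /= ?intS; lia.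
by rewrite wo // E !ffunE permM tpermD // eq_sym.
Qed.

Lemma lattice_dominant v : lattice v -> dominant (wt N v).
Proof.
move=> lv i j; rewrite !ffunE lez_nat /=.
move: (nat_of_ord i) (nat_of_ord j) => a b; elim: b => [|b IHb].
  by rewrite leqn0 => /eqP->.
rewrite leq_eqVlt => /orP[/eqP->//|/IHb]; apply: leq_trans.
exact: lattice_count.
Qed.

(** Two dominant weights related by a nontrivial s would each have a smaller norm than the other. *)
Lemma dot_sign_lattice mu v : dominant mu -> lattice v ->
  dot_sign mu (wt N v) = (wt N v == mu)%:Z.
Proof.
move=> dmu lv; rewrite /dot_sign (bigD1 1%g) //= dot1 odd_perm1 mul1r.
rewrite big1 ?addr0 // => s s1; case: eqP => [E|]; last by rewrite mulr0.
have := weight_norm_dot dmu s1; rewrite -E => lt1.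
have s1' : (s^-1)%g != 1%g by rewrite invg_eq1.
have := weight_norm_dot (lattice_dominant lv) s1'.
rewrite E dotM mulVg dot1 -E => lt2.
by have := lt_trans lt1 lt2; rewrite ltxx.
Qed.

Lemma alternating_mult H mu : raise_closed n H -> dominant mu ->
  \sum_s (-1) ^+ odd_perm s * mult H (dot mu s) = mult (predI H lattice) mu.
Proof.
move=> Hr dmu.
transitivity (\sum_(v <- words | H v) dot_sign mu (wt N v)).
  rewrite exchange_big /=; apply: eq_bigr => s _.
  by rewrite mulr_sumr.
rewrite (bigID lattice) /= [X in _ + X](_ : _ = 0) ?addr0.
  by apply: eq_bigr => v /andP[_ lv]; rewrite dot_sign_lattice.
set S := (X in X = 0).
(* The involution [star] permutes the words that are not lattice and reverses [dot_sign]. *)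
suff : S = - S by lia.
rewrite {1}/S -big_filter.
have /(perm_big _) <- : perm_eq (map star [seq v <- words | H v && ~~ lattice v])
    [seq v <- words | H v && ~~ lattice v].
  apply: uniq_perm.
  - rewrite map_inj_in_uniq ?filter_uniq ?uniq_words // => u v.
    rewrite !mem_filter => /andP[/andP[_ lu] _] /andP[/andP[_ lv] _] E.
    by rewrite -(starK lu) E starK.
  - by rewrite filter_uniq ?uniq_words.
  have st v : (H v && ~~ lattice v) && (v \in words) ->
      (H (star v) && ~~ lattice (star v)) && (star v \in words).
    move=> /andP[/andP[Hv lv] vw]; rewrite lattice_star star_words lv vw.
    by rewrite star_invariant ?Hv // => k v' sv'; apply: Hr;
      move: vw; rewrite mem_words sv' => /andP[/eqP].
  move=> v; apply/mapP/idP => [[u + ->]|]; first by rewrite !mem_filter; apply: st.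
  rewrite mem_filter => /[dup] /andP[/andP[_ lv] _] h.
  by exists (star v); rewrite ?mem_filter ?st ?starK.
rewrite big_map big_filter -sumrN big_seq_cond [RHS]big_seq_cond.
by apply: eq_bigr => v /andP[vw /andP[_ lv]]; apply: dot_sign_star.
Qed.
End Multiplicities.

(** * Schur functions as generating series of reading words *)

Local Open Scope nat_scope.

Lemma gen_series_reindex (P Q : pred (seq nat)) (h h' : seq nat -> seq nat)
    (m m' : seq nat) :
    (forall v, perm_eq v m -> [/\ perm_eq (h v) m', h' (h v) = v & Q (h v) = P v]) ->
    (forall v, perm_eq v m' -> perm_eq (h' v) m /\ h (h' v) = v) ->
  gen_series P m = gen_series Q m'.
Proof.
move=> hP hP'; rewrite /gen_series; congr Posz.
have /seq.permP <- : perm_eq (map h (permutations m)) (permutations m').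
  apply: uniq_perm; rewrite ?permutations_uniq //.
    rewrite map_inj_in_uniq ?permutations_uniq // => u v.
    rewrite !mem_permutations => /hP[_ Eu _] /hP[_ Ev _] E.
    by rewrite -Eu E Ev.
  move=> v; rewrite mem_permutations; apply/mapP/idP => [[u + ->]|].
    by rewrite mem_permutations => /hP[].
  by move=> /hP'[p E]; exists (h' v); rewrite ?mem_permutations.
rewrite count_map; apply: eq_in_count => v.
by rewrite mem_permutations => /hP[_ _ E] /=.
Qed.

(** When every raising operator is allowed, the reflection of the whole word preserves H; it is an
    involution that exchanges the numbers of k and k.+1. *)
Lemma raise_closed_symmetric (n : nat) (H : pred (seq nat)) :
    (forall k v, size v = n -> 0 < eps k v -> H (raise k v) = H v) ->
  adjacent_symmetric (gen_series (of_size n H)).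
Proof.
move=> Hr k m.
have perm_reflect v w : perm_eq v w ->
    perm_eq (reflect_word k v) (map (swap_letters k) w).
  move=> /seq.permP vw; apply/allP=> x _; apply/eqP => /=.
  by rewrite count_reflect vw count_swap_letters.
have inv (v : seq nat) : map (swap_letters k) (map (swap_letters k) v) = v.
  by rewrite -map_comp map_id_in // => x _ /=; rewrite swap_lettersK.
symmetry.
apply: (@gen_series_reindex _ _ (reflect_word k) (reflect_word k)) => v vm.
  split; [exact: perm_reflect | exact: reflect_wordK | ].
  rewrite /of_size size_reflect; case: eqP => //= sv.
  rewrite /reflect_word; case: leqP => h.
    have: eps k v - phi k v <= eps k v by lia.
    elim: (_ - _) => //= i IHi mi; rewrite Hr ?IHi //; try lia.
      by rewrite -sv; elim: (i) => //= j; rewrite size_raise.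
    by have [_ -> _] := iter_raiseP (ltnW mi); lia.
  have: phi k v - eps k v <= phi k v by lia.
  elim: (_ - _) => //= i IHi mi; rewrite -IHi; try lia.
  have [p e _] := iter_lowerP (ltnW mi).
  have pos : 0 < phi k (iter i (lower k) v) by rewrite p; lia.
  rewrite -[in RHS](lowerK pos) Hr ?eps_lower //.
  by rewrite size_lower -sv; elim: (i) => //= j; rewrite size_lower.
by split; [rewrite -(inv m); apply: perm_reflect | apply: reflect_wordK].
Qed.

(* The word v lists the rows of the tableau from top to bottom. *)
Definition reading_ssyt (la : seq nat) : pred (seq nat) :=
  fun v => semistandard (rev (reshape (rev la) v)).

Lemma sumn_rev (s : seq nat) : sumn (rev s) = sumn s.
Proof. by apply: perm_sumn; rewrite perm_rev. Qed.

Lemma flatten_rev_reshape la (v : seq nat) : size v = sumn la ->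
  flatten (rev (reshape (rev la) (flatten (rev (reshape la v))))) = v.
Proof.
move=> sv.
have -> : rev la = shape (rev (reshape la v)).
  by rewrite /shape map_rev -/(shape _) reshapeKl ?sv.
by rewrite flattenK revK reshapeKr ?sv.
Qed.

(** The definition of [schur] lists the rows from the bottom, the reading word from the top;
    rearranging the rows as blocks is a bijection on words that keeps the monomial. *)
Lemma schur_reading la m :
  schur la m = gen_series (of_size (sumn la) (reading_ssyt la)) m.
Proof.
have perm_fl mu (v : seq nat) : size v = sumn mu ->
    perm_eq (flatten (rev (reshape mu v))) v.
  move=> sv; rewrite -[X in perm_eq _ X](@reshapeKr _ mu v) ?sv //.
  by apply: perm_flatten; rewrite perm_rev.
case: (size m =P sumn la) => sm; last first.
  rewrite /schur /gen_series; congr Posz; transitivity 0; [|symmetry];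
    rewrite -[RHS](count_pred0 (permutations m)); apply: eq_in_count => v;
    by rewrite mem_permutations /of_size => /perm_size->; case: eqP.
apply: (@gen_series_reindex _ _ (fun v => flatten (rev (reshape la v)))
   (fun v => flatten (rev (reshape (rev la) v)))) => v vm;
  have sv : size v = sumn la by rewrite (perm_size vm).
  split; first by rewrite (perm_trans (perm_fl _ _ sv)).
    exact: flatten_rev_reshape.
  rewrite /of_size (perm_size (perm_fl _ _ sv)) sv; congr (_ && _).
  rewrite /reading_ssyt.
  have -> : rev la = shape (rev (reshape la v)).
    by rewrite /shape map_rev -/(shape _) reshapeKl ?sv.
  by rewrite flattenK revK.
split; first by rewrite (perm_trans (perm_fl _ _ _)) ?sumn_rev.
by rewrite -[X in reshape X _]revK flatten_rev_reshape ?sumn_rev.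
Qed.

(** * Superstandard tableaux and lattice reading words *)

Fixpoint constant_rows (i : nat) (la : seq nat) : seq (seq nat) :=
  if la is a :: la' then nseq a i :: constant_rows i.+1 la' else [::].

(** Listed from the bottom row, this is the weakly increasing word of weight la; the reading word is
    its rearrangement [flatten (rev (constant_rows 0 la))]. *)
Definition superstandard_word (la : seq nat) : seq nat :=
  flatten (constant_rows 0 la).

Lemma shape_constant_rows i la : shape (constant_rows i la) = la.
Proof. by elim: la i => //= a la IHla i; rewrite size_nseq IHla. Qed.

Lemma count_constant_rows i la j : count_mem j (flatten (constant_rows i la)) =
  if j < i then 0 else nth 0 la (j - i).
Proof.
elim: la i => [|a la IHla] i /=; first by rewrite nth_nil; case: ifP.
rewrite count_cat IHla count_nseq /=; case: (ltngtP i j) => ij /=.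
- by rewrite ltnS leqNgt ij -(subnSK ij).
- by rewrite ltnS (ltnW ij).
- by rewrite ij ltnSn subnn mul1n addn0.
Qed.

Lemma count_superstandard la j : count_mem j (superstandard_word la) = nth 0 la j.
Proof. by rewrite count_constant_rows subn0. Qed.

Lemma size_superstandard la : size (superstandard_word la) = sumn la.
Proof. by rewrite size_flatten shape_constant_rows. Qed.

Lemma semistandard_constant_rows i la : sorted geq la ->
  semistandard (constant_rows i la).
Proof.
move=> sla; apply/andP; split.
  elim: la i {sla} => //= a la IHla i; rewrite IHla andbT.
  by elim: a => //= -[|a] //= ->; rewrite leqnn.
elim: la i sla => //= a [|b la] IHla i //= /andP[ab] /(IHla i.+1) /= ->.
rewrite andbT /column_strict size_nseq; apply/allP => j.
rewrite mem_iota add0n /= => jb; rewrite !nth_nseq jb.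
by rewrite (leq_trans jb ab).
Qed.

Lemma lattice_nseq a i s : lattice s -> count_mem i s = 0 ->
  (i == 0) || (a <= count_mem i.-1 s) -> lattice (nseq a i ++ s).
Proof.
move=> ls i0; elim: a => //= a IHa ai; rewrite IHa; last first.
  by case: (i == 0) ai => //=; apply: ltnW.
case: eqP ai => //= /eqP; rewrite -lt0n => ipos ai.
rewrite !count_cat i0 !count_nseq /= eqxx mul1n addn0.
by rewrite (leq_trans ai) // leq_addl.
Qed.

Lemma lattice_constant_rows i la s : sorted geq la -> lattice s ->
  all (fun x => x < i) s ->
  (i == 0) || (head 0 la <= count_mem i.-1 s) ->
  lattice (flatten (rev (constant_rows i la)) ++ s).
Proof.
elim: la i s => //= a la IHla i s sla ls si hi.
rewrite rev_cons flatten_rcons -catA.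
have i0 : count_mem i s = 0.
  apply/count_memPn; apply: contraTN isT => /(allP si).
  by rewrite ltnn.
apply: IHla.
- exact: path_sorted sla.
- exact: lattice_nseq.
- rewrite all_cat; apply/andP; split; first by rewrite all_nseq ltnSn orbT.
  by apply: sub_all si => x xi; apply: ltnW.
- rewrite /= count_cat i0 addn0 count_nseq /= eqxx mul1n.
  by case: la sla => //= b la /andP[].
Qed.

(** Here s holds the rows below, with letters less than i. If y ends the lowest row of t, the
    lattice condition on y :: s forces y = 0 or y.-1 in s, so y <= i; as this row starts with a
    letter at least i, it is constant. Of the column conditions only the first column is needed. *)
Lemma lattice_rows i t s :
    all (fun x => x < i) s -> all (sorted leq) t -> all (fun r => r != [::]) t ->
    sorted (fun r r' => head 0 r < head 0 r') t ->
    (t == [::]) || (i <= head 0 (head [::] t)) ->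
    lattice (flatten (rev t) ++ s) ->
  t = constant_rows i (shape t).
Proof.
elim: t i s => //= r t IHt i s si /andP[sr st] /andP[r0 t0] srt ir.
rewrite rev_cons flatten_rcons -catA => lrt.
have rE : r = nseq (size r) i.
  apply/all_pred1P/allP => x xr; rewrite /= eqn_leq; apply/andP; split.
    case/lastP: r r0 sr xr lrt {ir srt} => // q y _ sr xr.
    have xy : x <= y.
      move: xr; rewrite mem_rcons inE => /orP[/eqP->//|xq].
      move: sr; rewrite (sorted_pairwise leq_trans) pairwise_rcons.
      by move=> /andP[/allP/(_ x xq)].
    rewrite cat_rcons => /lattice_catr/lattice_catr /= /andP[_ /orP[/eqP y0|]].
      by move: xy; rewrite y0 leqn0 => /eqP->.
    move=> /(leq_ltn_trans (leq0n _)); rewrite -has_count has_pred1 => /(allP si).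
    by lia.
  apply: leq_trans ir _; case: r sr xr {r0 srt lrt} => //= y r sr.
  rewrite inE => /orP[/eqP->//|]; move: x; apply/allP.
  exact: order_path_min leq_trans sr.
rewrite /= -rE; congr (_ :: _); apply: (IHt i.+1 (r ++ s)) => //.
- rewrite all_cat; apply/andP; split; first by rewrite rE all_nseq ltnSn orbT.
  by apply: sub_all si => x xi; apply: ltnW.
- exact: path_sorted srt.
case: t srt {IHt st t0 lrt} => //= r' t /andP[+ _].
by apply: leq_ltn_trans.
Qed.

Lemma reading_ssyt_lattice la v : all (leq 1) la -> size v = sumn la ->
  reading_ssyt la v -> lattice v -> v = flatten (rev (constant_rows 0 la)).
Proof.
move=> la1 sv /andP[st ct] lv.
set t := rev _ in st ct.
have sh : shape t = la.
  by rewrite /shape map_rev -/(shape _) reshapeKl ?revK ?sumn_rev ?sv.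
have vE : v = flatten (rev t) by rewrite revK reshapeKr ?sumn_rev ?sv.
have t0 : all (fun r => r != [::]) t.
  by move: la1; rewrite -sh all_map; apply: sub_all => r /=; rewrite lt0n size_eq0.
rewrite vE -[in RHS]sh -(@lattice_rows 0 t [::]) ?cats0 -?vE //.
  elim: (t) ct t0 => // r [|r' t'] IHt // /andP[c ct] /andP[r0 t0].
  apply/andP; split; last exact: IHt.
  case/andP: t0 => r'0 _; move/allP: c => /(_ 0); rewrite mem_iota -!nth0; apply.
  by rewrite /= add0n lt0n size_eq0.
by rewrite orbT.
Qed.

Lemma is_partitionP n la : is_partition n la ->
  [/\ sorted geq la, all (leq 1) la & sumn la = n].
Proof. by case/and3P=> ? ? /eqP. Qed.

Lemma reading_ssyt_superstandard la : sorted geq la ->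
  reading_ssyt la (flatten (rev (constant_rows 0 la))).
Proof.
move=> sla; rewrite /reading_ssyt -[in rev la](shape_constant_rows 0 la).
rewrite /shape -map_rev -/(shape _) flattenK revK.
exact: semistandard_constant_rows.
Qed.

Lemma sorted_geq_size la : all (leq 1) la -> size la <= sumn la.
Proof. by elim: la => //= a la IHla /andP[a0 /IHla]; lia. Qed.

Local Open Scope ring_scope.

Lemma superstandard_words N n la : is_partition n la -> (n <= N)%N ->
  superstandard_word la \in words N n.
Proof.
move=> /is_partitionP[_ la1 <-] nN; rewrite mem_words size_superstandard eqxx.
apply/allP => x; rewrite -has_pred1 has_count count_superstandard => x0.
apply: leq_trans (leq_trans (sorted_geq_size la1) nN).
by rewrite ltnNge; apply: contraTN x0 => h; rewrite nth_default.
Qed.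

Lemma mult_reading_ssyt N n la (mu : {ffun 'I_N -> int}) :
    is_partition n la -> (n <= N)%N ->
  mult n (predI (reading_ssyt la) lattice) mu
    = (mu == wt N (superstandard_word la))%:Z.
Proof.
move=> pla nN; have [sla la1 sumla] := is_partitionP pla.
pose u := flatten (rev (constant_rows 0 la)).
have uw : perm_eq u (superstandard_word la).
  by apply: perm_flatten; rewrite perm_rev.
have u_words : u \in words N n.
  have := superstandard_words pla nN.
  by rewrite !mem_words (perm_size uw) (perm_all _ uw).
have wtu : wt N u = wt N (superstandard_word la).
  by apply/ffunP=> i; rewrite !ffunE (seq.permP uw).
rewrite /mult -count_sum -wtu; congr Posz.
rewrite (@eq_in_count _ _ (fun v => (v == u) && (mu == wt N u))); last first.
  move=> v; rewrite mem_words => /andP[/eqP sv _] /=.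
  apply/idP/idP => [/andP[/andP[rv lv] /eqP <-]|/andP[/eqP-> /eqP->]].
    by rewrite (reading_ssyt_lattice la1 _ rv lv) ?sv // !eqxx.
  rewrite eqxx andbT reading_ssyt_superstandard //=.
  rewrite -[X in lattice X]cats0; exact: lattice_constant_rows.
case: eqP => _ /=; last first.
  by rewrite (eq_count (a2 := pred0)) ?count_pred0 // => v; rewrite andbF.
rewrite (eq_count (a2 := pred1 u)) ?count_uniq_mem ?uniq_words ?u_words //.
by move=> v; rewrite andbT.
Qed.

Lemma filter_positive_nth (s : seq nat) i : sorted geq s ->
  nth 0%N (filter (leq 1) s) i = nth 0%N s i.
Proof.
elim: s i => //= x s IHs i xs; case: (leqP 1 x) => [x0|].
  by case: i => //= i; rewrite IHs // (path_sorted xs).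
rewrite ltnS leqn0 => /eqP x0; rewrite x0 in xs *.
have s0 : all (pred1 0%N) s.
  apply: sub_all (order_path_min (rev_trans leq_trans) xs) => y /=.
  by rewrite leqn0.
have -> : filter (leq 1) s = [::].
  by apply/eqP; rewrite -[_ == _]negbK -has_filter; apply/hasPn => y /(allP s0)/eqP->.
have /all_pred1P -> := s0; rewrite nth_nil; case: i => //= i.
by rewrite nth_nseq; case: ifP.
Qed.

Lemma positive_nth_inj (s t : seq nat) : all (leq 1) s -> all (leq 1) t ->
  (forall i, nth 0%N s i = nth 0%N t i) -> s = t.
Proof.
elim: s t => [|x s IHs] [|y t] //=.
- by move=> _ /andP[y0 _] /(_ 0%N) /= E; rewrite -E in y0.
- by move=> /andP[y0 _] _ /(_ 0%N) /= E; rewrite E in y0.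
move=> /andP[_ s0] /andP[_ t0] E; have /= -> := E 0%N.
by rewrite (IHs t) // => i; apply: (E i.+1).
Qed.

Lemma lattice_content N n v : v \in words N n -> lattice v ->
  exists la : partition_of n, wt N v = wt N (superstandard_word (parts la)).
Proof.
move=> vw lv; pose c := mkseq (fun i => count_mem i v) N.
have sc : sorted geq c.
  apply/(sortedP 0%N) => i; rewrite size_mkseq => iN.
  by rewrite !nth_mkseq ?(ltnW iN) //; apply: lattice_count.
have pc : is_partition n (filter (leq 1) c).
  apply/and3P; split; first exact: sorted_filter (rev_trans leq_trans) _ _ sc.
    exact: filter_all.
  have /eqP := sum_wt vw; under eq_bigr do rewrite ffunE.
  rewrite -(big_morph Posz PoszD (erefl (Posz 0))) eqz_nat => /eqP <-.
  rewrite sumnE big_filter -(big_mkord xpredT (fun i => count_mem i v)).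
  rewrite /c /mkseq big_map_id big_mkcond; apply/eqP.
  rewrite /index_iota subn0; apply: eq_bigr => i _.
  by case: (count_mem i v).
have /partitionP[la laE] := pc; exists la.
apply/ffunP=> i; rewrite !ffunE count_superstandard laE filter_positive_nth //.
by rewrite nth_mkseq ?ltn_ord.
Qed.

Lemma superstandard_inj N n (la mu : partition_of n) : (n <= N)%N ->
  wt N (superstandard_word (parts la)) = wt N (superstandard_word (parts mu)) ->
  la = mu.
Proof.
move=> nN /ffunP E; have [_ la1 sla] := is_partitionP (part_bseqP la).
have [_ mu1 smu] := is_partitionP (part_bseqP mu).
apply: val_inj; apply: val_inj; apply: (inj_map val_inj).
apply: positive_nth_inj => // i; case: (ltnP i N) => iN.
  by have := E (Ordinal iN); rewrite !ffunE !count_superstandard => -[].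
rewrite !nth_default //; apply: leq_trans iN; apply: leq_trans nN.
  exact: leq_trans (sorted_geq_size mu1) (eq_leq smu).
exact: leq_trans (sorted_geq_size la1) (eq_leq sla).
Qed.

(** * Shifted Knuth moves *)

Local Open Scope nat_scope.

(* Among the moves that the h_i induce on the inverses of the flipped
   permutations, these are the ones that the proof needs: Knuth moves followed
   by a letter larger than the smallest one (first kind), resp. the middle one
   (second kind), of the three letters. *)
Definition shifted_knuth_closed (G : pred (seq nat)) : Prop :=
  (forall al be a x y w, a < x -> x < y -> a < w -> w != x -> w != y ->
     G (al ++ [:: x; y; a; w] ++ be) = G (al ++ [:: x; a; y; w] ++ be)) /\
  (forall al be a b y w, a < b -> b < y -> b < w -> w != y ->
     G (al ++ [:: y; a; b; w] ++ be) = G (al ++ [:: a; y; b; w] ++ be)).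

Definition knuth_closed (G : pred (seq nat)) : Prop :=
  (forall al be a x y, a < x -> x < y ->
     G (al ++ [:: x; y; a] ++ be) = G (al ++ [:: x; a; y] ++ be)) /\
  (forall al be a b y, a < b -> b < y ->
     G (al ++ [:: y; a; b] ++ be) = G (al ++ [:: a; y; b] ++ be)).

(** Erasing the letters from M on allows a large letter to be added as the fourth letter of a
    shifted move and then forgotten. If the largest letter of a move is erased, the two sides
    coincide. *)
Lemma knuth_closed_shifted G M : knuth_closed G ->
  shifted_knuth_closed (fun z => G (filter (fun i => i < M) z)).
Proof.
move=> [K1 K2]; split=> al be a.
  move=> x y w ax xy aw _ _; rewrite !filter_cat /=.
  case: (ltnP y M) => yM; case: (ltnP a M) => aM; case: (ltnP x M) => xM //; try lia.
  by case: ifP => _; [exact: (K1 _ (w :: _)) | exact: K1].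
move=> b y w ab bY bw _; rewrite !filter_cat /=.
case: (ltnP y M) => yM; case: (ltnP a M) => aM; case: (ltnP b M) => bM //; try lia.
by case: ifP => _; [exact: (K2 _ (w :: _)) | exact: K2].
Qed.

(** Used with C the positions of matched letters k and D those of their partners k.+1, which are
    smaller entry by entry. *)
Fixpoint interleave (C D : seq nat) : seq nat :=
  match C, D with c :: C', d :: D' => c :: d :: interleave C' D' | _, _ => [::] end.

Lemma interleave_cat C1 C2 D1 D2 : size C1 = size D1 ->
  interleave (C1 ++ C2) (D1 ++ D2) = interleave C1 D1 ++ interleave C2 D2.
Proof. by elim: C1 D1 => [|c C1 IHC] [|d D1] //= [/IHC->]. Qed.

Lemma all2_size (T U : Type) (r : T -> U -> bool) s t :
  all2 r s t -> size s = size t.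
Proof. by rewrite all2E => /andP[/eqP]. Qed.

Lemma all2_cat (T U : Type) (r : T -> U -> bool) s1 s2 t1 t2 :
  size s1 = size t1 ->
  all2 r (s1 ++ s2) (t1 ++ t2) = all2 r s1 t1 && all2 r s2 t2.
Proof. by elim: s1 t1 => [|x s1 IHs] [|y t1] //= [/IHs->]; rewrite andbA. Qed.

Lemma all2_behead c C D :
  path ltn c C -> all2 ltn D (belast c C) -> all2 ltn D C.
Proof.
elim: C c D => [|c2 C IHC] c [|d D] //= /andP[c_c2 pC] /andP[dc DC].
by rewrite (ltn_trans dc c_c2) (IHC c2).
Qed.

Lemma all2_belast x C D :
  path ltn x C -> path ltn x D -> all2 ltn D C -> all2 ltn (belast x D) C.
Proof.
elim: D C x => [|d D IHD] [|c C] x //= /andP[xc pC] /andP[xd pD] /andP[dc DC].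
rewrite xc IHD //.
by case: C pC {DC} => //= c' C /andP[/(ltn_trans dc) -> ->].
Qed.

Section ShiftedKnuth.
Variable G : pred (seq nat).
Hypothesis G_closed : shifted_knuth_closed G.

Definition equiv_in (z z' : seq nat) : Prop :=
  forall al be, G (al ++ z ++ be) = G (al ++ z' ++ be).

Lemma equiv_refl z : equiv_in z z. Proof. by []. Qed.

Lemma equiv_sym z z' : equiv_in z z' -> equiv_in z' z.
Proof. by move=> h al be; rewrite h. Qed.

Lemma equiv_trans z2 z1 z3 : equiv_in z1 z2 -> equiv_in z2 z3 -> equiv_in z1 z3.
Proof. by move=> h h' al be; rewrite h. Qed.

Lemma equiv_catl u z z' : equiv_in z z' -> equiv_in (u ++ z) (u ++ z').
Proof. by move=> h al be; rewrite -!catA catA h -catA. Qed.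

Lemma equiv_catr u z z' : equiv_in z z' -> equiv_in (z ++ u) (z' ++ u).
Proof. by move=> h al be; rewrite -!catA h. Qed.

Lemma equiv_cons x z z' : equiv_in z z' -> equiv_in (x :: z) (x :: z').
Proof. exact: (@equiv_catl [:: x]). Qed.

(** From left to right, each d is exchanged with the entry of C before it. The preceding entry,
    between the two in size, permits the Knuth move; the fourth letter is the next entry of C, or y
    at the last pair. *)
Lemma shift_pairs c C D y :
    path ltn c C -> sorted ltn (rcons D y) -> all2 ltn D (belast c C) ->
    y \notin c :: C ->
  equiv_in (c :: interleave C D ++ [:: y]) (interleave (c :: C) (rcons D y)).
Proof.
elim: C c D => [|c2 C IHC] c [|d D] //= /andP[c_c2 pC] sD /andP[dc DC].
rewrite !inE !negb_or => /and3P[yc yc2 yC].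
have d_y : d < y.
  have /allP := order_path_min ltn_trans sD; apply.
  by rewrite mem_rcons mem_head.
apply: (@equiv_trans (c :: d :: c2 :: interleave C D ++ [:: y])); last first.
  do 2!apply: equiv_cons; apply: IHC => //; first exact: path_sorted sD.
  by rewrite inE negb_or yc2.
case: C D {IHC} pC sD DC yC => [|c3 C] [|d3 D] //= pC sD DC yC al be.
  exact: (G_closed.1 al be).
have /andP[c23 _] := pC.
have /= := G_closed.1 al (d3 :: interleave C D ++ [:: y] ++ be) d c c2 c3.
by rewrite -catA; apply; lia.
Qed.

(** By induction without the first letter c of C and the last letter y of D: the remaining letters
    are paired off by rank, and [shift_pairs] inserts c and y by shifting the pairing. *)
Lemma split_pairs C D :
    sorted ltn C -> sorted ltn D -> all2 ltn D C -> uniq (C ++ D) ->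
  equiv_in (C ++ D) (interleave C D).
Proof.
elim: C D => [|c C IHC] [|d0 D0] //; case/lastP: (d0 :: D0) (isT) => // D y _.
move=> sC sD DC; rewrite cat_cons cons_uniq => /andP[cCD uCD].
have szD : size D = size C by have := all2_size DC; rewrite size_rcons /= => -[].
have DC' : all2 ltn D (belast c C).
  by move: DC; rewrite lastI -!cats1 all2_cat ?size_belast // => /andP[].
have yC : y \notin c :: C.
  have cy : y != c.
    by move: cCD; rewrite mem_cat mem_rcons in_cons !negb_or eq_sym => /and3P[].
  rewrite in_cons negb_or cy /=.
  move: uCD; rewrite cat_uniq => /and3P[_ /hasPn/(_ y) + _].
  by rewrite mem_rcons mem_head => ->.
apply: equiv_trans (shift_pairs sC sD DC' yC); apply: equiv_cons.
rewrite -cats1 catA; apply: equiv_catr; apply: IHC.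
- exact: path_sorted sC.
- by move: sD; rewrite -cats1 => /cat_sorted2[].
- exact: all2_behead DC'.
by move: uCD; rewrite -cats1 catA cat_uniq => /andP[].
Qed.

(** From right to left, moves of the second kind exchange c and x before d, where x < d < c; the
    fourth letter is again the next entry of C, or y. *)
Lemma pass_pairs x C D y :
    sorted ltn C -> path ltn x (rcons D y) -> all2 ltn D C -> y \notin C ->
  equiv_in (interleave C (belast x D) ++ [:: last x D; y])
           (x :: interleave C D ++ [:: y]).
Proof.
elim: C x D => [|c C IHC] x [|d D] //= sC /andP[xd pD] /andP[dc DC].
rewrite inE negb_or => /andP[yc yC].
apply: (@equiv_trans (c :: x :: d :: interleave C D ++ [:: y])).
  by do 2!apply: equiv_cons; apply: IHC => //; apply: path_sorted sC.
have dy : d < y.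
  have /allP := order_path_min ltn_trans pD; apply.
  by rewrite mem_rcons mem_head.
case: C D {IHC pD} sC DC yC => [|c3 C] [|d3 D] //= sC DC yC al be.
  exact: (G_closed.2 al be).
have /andP[cc3 _] := sC.
have /= := G_closed.2 al (d3 :: interleave C D ++ [:: y] ++ be) x d c c3.
by rewrite -catA; apply; lia.
Qed.

(* The words on both sides list the positions of the letters k, then those of
   the letters k.+1; the position x changes side.  Both are brought to a form
   where the matched pairs are adjacent, through which x is moved. *)
Lemma move_unmatched C1 C2 D1 D2 x y :
    sorted ltn (C1 ++ x :: C2) -> sorted ltn (D1 ++ x :: rcons D2 y) ->
    all2 ltn D1 C1 -> all2 ltn D2 C2 ->
    uniq (C1 ++ C2 ++ D1 ++ x :: rcons D2 y) ->
  equiv_in (C1 ++ C2 ++ D1 ++ x :: rcons D2 y)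
           (C1 ++ x :: C2 ++ D1 ++ rcons D2 y).
Proof.
move=> sC sD DC1 DC2 un.
have sz1 := all2_size DC1; have sz2 := all2_size DC2.
have [sC1 /= pC2] := (cat_sorted2 sC).
have [sD1 /= pD2] := (cat_sorted2 sD).
have sCC : sorted ltn (C1 ++ C2).
  by apply: (subseq_sorted ltn_trans _ sC); rewrite cat_subseq ?subseq_cons.
have sDD : sorted ltn (D1 ++ D2).
  apply: (subseq_sorted ltn_trans _ sD); rewrite cat_subseq //.
  by rewrite -cats1 -cat_cons (subseq_trans (subseq_cons _ x)) ?prefix_subseq.
have DC2' : all2 ltn (belast x D2) C2.
  by apply: all2_belast => //; move: pD2; rewrite rcons_path => /andP[].
have yC : y \notin C1 ++ C2.
  move: un; rewrite catA cat_uniq => /and3P[_ /hasPn/(_ y) + _]; apply.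
  by rewrite mem_cat inE mem_rcons mem_head !orbT.
have uCD : uniq ((C1 ++ C2) ++ D1 ++ x :: D2).
  move: un; rewrite -cats1 -cat_cons !catA cat_uniq => /andP[].
  by rewrite -!catA.
(* C1 ++ C2 is paired with the letters of D1, x and D2 except the last; then x passes leftwards
   through the pairs of C2 and D2. *)
have step1 : equiv_in (C1 ++ C2 ++ D1 ++ x :: rcons D2 y)
    (interleave C1 D1 ++ x :: interleave C2 D2 ++ [:: y]).
  apply: (@equiv_trans (interleave (C1 ++ C2) (D1 ++ belast x D2) ++ [:: last x D2; y])).
    have -> : C1 ++ C2 ++ D1 ++ x :: rcons D2 y
       = ((C1 ++ C2) ++ (D1 ++ belast x D2)) ++ [:: last x D2; y].
      by rewrite -rcons_cons (lastI x D2) -!cats1 -!catA.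
    apply: equiv_catr; apply: split_pairs => //.
    + apply: (subseq_sorted ltn_trans _ sD); rewrite cat_subseq //.
      by rewrite -rcons_cons lastI -!cats1 -!catA prefix_subseq.
    + by rewrite all2_cat // DC1.
    apply: subseq_uniq uCD; rewrite lastI cat_subseq // cat_subseq //.
    by rewrite -cats1 prefix_subseq.
  rewrite interleave_cat // -catA; apply: equiv_catl; apply: pass_pairs => //.
    by apply: (subseq_sorted ltn_trans _ sCC); rewrite suffix_subseq.
  by move: yC; rewrite mem_cat negb_or => /andP[].
apply: equiv_trans step1 _; apply: equiv_sym.
have xy : x < y.
  have /allP := order_path_min ltn_trans pD2; apply.
  by rewrite mem_rcons mem_head.
(* The letter n that follows x in the common form takes the part of y in [shift_pairs]. *)
have [n [t [nE xn nC]]] : exists n t, [/\ interleave C2 D2 ++ [:: y] = n :: t,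
    x < n & n \notin C1 ++ [:: x]].
  case: C2 D2 sz2 sC un yC {pC2 pD2 DC2 sD sCC sDD DC2' uCD sD1 sC1}
    => [|c C2] [|d D2] //= _ sC un yC.
    exists y, [::]; split=> //; rewrite cats0 in yC.
    by rewrite mem_cat (negPf yC) inE gtn_eqF.
  exists c, (d :: interleave C2 D2 ++ [:: y]); split=> //.
    by case/cat_sorted2: sC => _ /= /andP[].
  have := sorted_uniq ltn_trans ltnn sC; rewrite -cat_rcons cat_uniq cats1.
  by move=> /and3P[_ /hasPn/(_ c (mem_head _ _))].
case: C1 D1 sz1 sC sD DC1 un sC1 pC2 sD1 pD2 sCC sDD yC uCD nC
  => [|c1 C1] [|d1 D1] //= sz1 sC sD DC1 un sC1 pC2 sD1 pD2 sCC sDD yC uCD nC.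
  rewrite -cats1; apply: equiv_cons; rewrite catA; apply: equiv_catr.
  apply: split_pairs => //.
  by apply: subseq_uniq uCD; rewrite cat_subseq // subseq_cons.
rewrite nE.
(* With c1 set aside, the rest of C1, x and C2 together are as many as the letters of d1 :: D1 and
   D2, and can be paired with them. *)
apply: (@equiv_trans (c1 :: interleave (rcons C1 x) (d1 :: D1) ++ n :: t)).
  apply: equiv_cons; rewrite -nE.
  have -> : C1 ++ x :: C2 ++ d1 :: D1 ++ rcons D2 y
     = ((rcons C1 x ++ C2) ++ (d1 :: D1) ++ D2) ++ [:: y].
    by rewrite -!cats1 -!catA.
  rewrite [X in equiv_in _ X]catA -interleave_cat ?size_rcons; last exact: esym.
  apply: equiv_catr; apply: split_pairs.
  - by rewrite cat_rcons; apply: path_sorted sC.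
  - exact: sDD.
  - rewrite all2_cat ?size_rcons //.
    rewrite DC2 andbT; apply: (@all2_behead c1); last by rewrite belast_rcons.
    by move: sC; rewrite -cat_rcons cat_path => /andP[].
  - have up : perm_eq (c1 :: y :: (rcons C1 x ++ C2) ++ d1 :: D1 ++ D2)
        (c1 :: C1 ++ C2 ++ d1 :: D1 ++ x :: rcons D2 y).
      apply/seq.permP=> p; rewrite -!cats1.
      by rewrite /= ?count_cat /= ?count_cat /= ?count_cat /= ?count_cat; clear; lia.
    by have := perm_uniq up; rewrite /= un => /and3P[].
have -> : c1 :: interleave (rcons C1 x) (d1 :: D1) ++ n :: t
   = (c1 :: interleave (rcons C1 x) (d1 :: D1) ++ [:: n]) ++ t.
  by rewrite cat_cons -catA.
have -> : [:: c1, d1 & interleave C1 D1 ++ [:: x, n & t]]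
   = interleave (c1 :: rcons C1 x) (rcons (d1 :: D1) n) ++ t.
  rewrite -rcons_cons -!cats1 interleave_cat //= -?catA //.
apply: equiv_catr; apply: shift_pairs.
- by move: sC; rewrite -cat_rcons cat_path => /andP[].
- have sdx : sorted ltn (rcons (d1 :: D1) x).
    by move: sD; rewrite -cat_rcons cat_path => /andP[].
  move: sdx; rewrite -!cats1 /= !cat_path => /andP[-> /= /andP[h _]].
  by rewrite (ltn_trans h xn).
- by rewrite belast_rcons.
by rewrite -cats1.
Qed.
End ShiftedKnuth.

(** * Standardization *)

Definition positions (x : nat) (v : seq nat) : seq nat :=
  [seq i <- iota 0 (size v) | nth 0 v i == x].

Definition standard_lt (v : seq nat) : rel nat :=
  fun i j => (nth 0 v i < nth 0 v j) || ((nth 0 v i == nth 0 v j) && (i < j)).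

Lemma standard_lt_trans v : transitive (standard_lt v).
Proof. by move=> j i k; rewrite /standard_lt; lia. Qed.

Lemma standard_lt_irr v : irreflexive (standard_lt v).
Proof. by move=> i; rewrite /standard_lt; lia. Qed.

(* The inverse, in one-line notation and with values from 0, of the
   standardization of v. *)
Definition inv_std (v : seq nat) : seq nat :=
  flatten [seq positions x v | x <- iota 0 (sumn v).+1].

Lemma mem_positions i x v : (i \in positions x v) = (nth 0 v i == x) && (i < size v).
Proof. by rewrite mem_filter mem_iota add0n. Qed.

Lemma mem_flatten_positions i v s :
  (i \in flatten [seq positions x v | x <- s]) = (nth 0 v i \in s) && (i < size v).
Proof.
apply/flatten_mapP/andP => [[x xs]|[h iv]].
  by rewrite mem_positions => /andP[/eqP-> ->].
by exists (nth 0 v i); rewrite // mem_positions eqxx.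
Qed.

Lemma sorted_flatten_positions v m N :
  sorted (standard_lt v) (flatten [seq positions x v | x <- iota m N]).
Proof.
rewrite (sorted_pairwise (@standard_lt_trans v)).
elim: N m => //= N IHN m; rewrite pairwise_cat IHN andbT; apply/andP; split.
  apply/allrelP => i j; rewrite mem_positions mem_flatten_positions mem_iota.
  by rewrite /standard_lt; lia.
rewrite -(sorted_pairwise (@standard_lt_trans v)).
apply: (@sub_in_sorted _ (fun i => nth 0 v i == m) ltn).
- by move=> i j /eqP + /eqP; rewrite /standard_lt => -> -> /= ->; rewrite eqxx orbT.
- exact: filter_all.
exact: sorted_filter ltn_trans _ _ (iota_ltn_sorted _ _).
Qed.

Lemma leq_sumn x v : x \in v -> x <= sumn v.
Proof. by move=> /perm_to_rem/perm_sumn->; apply: leq_addr. Qed.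

Lemma nth_leq_sumn i v : nth 0 v i <= sumn v.
Proof.
case: (ltnP i (size v)) => iv; last by rewrite nth_default.
by apply: leq_sumn; apply: mem_nth.
Qed.

Lemma sorted_inv_std v : sorted (standard_lt v) (inv_std v).
Proof. exact: sorted_flatten_positions. Qed.

Lemma mem_inv_std i v : (i \in inv_std v) = (i < size v).
Proof. by rewrite mem_flatten_positions mem_iota /= ltnS nth_leq_sumn. Qed.

Lemma inv_stdE v z : sorted (standard_lt v) z -> z =i iota 0 (size v) ->
  inv_std v = z.
Proof.
move=> sz zi; apply: (irr_sorted_eq (@standard_lt_trans v) (@standard_lt_irr v)) => //.
  exact: sorted_inv_std.
by move=> i; rewrite mem_inv_std zi mem_iota.
Qed.

Lemma perm_inv_std v : perm_eq (inv_std v) (iota 0 (size v)).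
Proof.
apply: uniq_perm; rewrite ?iota_uniq //.
  exact: sorted_uniq (@standard_lt_trans v) (@standard_lt_irr v) _ (sorted_inv_std v).
by move=> i; rewrite mem_inv_std mem_iota.
Qed.

Lemma inv_std_positions v N : all (fun x => x < N) v ->
  inv_std v = flatten [seq positions x v | x <- iota 0 N].
Proof.
move=> /allP vN; apply: inv_stdE; first exact: sorted_flatten_positions.
move=> i; rewrite mem_flatten_positions !mem_iota !add0n /= andbC.
by case: ltnP => //= iv; rewrite vN ?mem_nth.
Qed.

Lemma positions_cat x u v :
  positions x (u ++ v) = positions x u ++ map (addn (size u)) (positions x v).
Proof.
rewrite /positions size_cat iotaD filter_cat; congr (_ ++ _).
  by apply: eq_in_filter => i; rewrite mem_iota add0n nth_cat /= => ->.
rewrite add0n -{1}[size u]addn0 iotaDl filter_map; congr (map _ _).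
by apply: eq_filter => i /=; rewrite nth_cat ltnNge leq_addr /= addKn.
Qed.

Lemma positions_cons x y v :
  positions x (y :: v) = nseq (y == x) 0 ++ map S (positions x v).
Proof.
rewrite -cat1s positions_cat /=; congr (_ ++ _).
by rewrite /positions /=; case: eqP.
Qed.

Lemma size_positions x v : size (positions x v) = count_mem x v.
Proof.
by elim: v => // y v IHv; rewrite positions_cons size_cat size_nseq size_map IHv.
Qed.

Lemma sorted_positions x v : sorted ltn (positions x v).
Proof. exact: sorted_filter ltn_trans _ _ (iota_ltn_sorted _ _). Qed.

Lemma raiseP k v : 0 < eps k v -> exists u w,
  [/\ v = u ++ k.+1 :: w, raise k v = u ++ k :: w, phi k w = 0, eps k u = 0
    & eps k v = (eps k w).+1].
Proof.
elim: v => //= x v IHv; case: ifP => [/andP[/eqP-> /eqP p0] _|h ev].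
  by exists [::], v.
have [u [w [vE rE pw eu ew]]] := IHv ev.
have p1 : phi k (k.+1 :: w) = 0 by rewrite /= pw gtn_eqF ?eqxx.
have hu : (x == k.+1) && (phi k u == 0) = false by rewrite -h vE phi_cat.
by exists (x :: u), w; split; rewrite /= ?hu ?eu ?rE -?vE.
Qed.

(** No prefix has more than [phi] letters k in excess of its letters k.+1. So the matching by
    nesting may be replaced by a matching by rank, which gives sorted lists of positions. *)
Lemma positions_matched k v i : phi k v <= i -> i < count_mem k v ->
  nth 0 (positions k.+1 v) (i - phi k v) < nth 0 (positions k v) i.
Proof.
elim: v i => // x v IHv i; rewrite !positions_cons /=.
have pk : count_mem k v <= phi k v + count_mem k.+1 v by have := count_eps_phi k v; lia.
case: (x =P k) => [->|xk] /=.
  rewrite ltn_eqF //=; case: i => // i; rewrite add1n !ltnS subSS => pi ik /=.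
  rewrite !(nth_map 0) ?size_positions //=; first exact: IHv.
  by move: pk ik pi => /=; lia.
case: (x =P k.+1) => [_|xk1] /=; last first.
  move=> pi; rewrite add0n => ik; rewrite !(nth_map 0) ?size_positions //=.
    exact: IHv.
  by move: pk ik pi => /=; lia.
move=> pi ik; rewrite add0n in ik; rewrite (nth_map 0) ?size_positions //.
case E: (i - (phi k v).-1) => [|j] //=.
have jk : j < count_mem k.+1 v by move: pk ik pi E => /=; lia.
rewrite (nth_map 0) ?size_positions //.
rewrite ltnS; case: (posnP (phi k v)) => p0; last first.
  have -> : j = i - phi k v by lia.
  by apply: IHv => //; lia.
have h : nth 0 (positions k.+1 v) (i - phi k v) < nth 0 (positions k v) i.
  by apply: IHv => //; lia.
apply: leq_ltn_trans h; apply: (sorted_leq_nth leq_trans leqnn 0).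
- by apply: sub_sorted (sorted_positions _ _) => a b; apply: ltnW.
- by rewrite inE size_positions.
- by rewrite inE size_positions; move: pk ik pi E => /=; lia.
by lia.
Qed.

Lemma all2_nthP (C D : seq nat) : size D = size C ->
  (forall i, i < size C -> nth 0 D i < nth 0 C i) -> all2 ltn D C.
Proof.
elim: C D => [|c C IHC] [|d D] //= [sDC] h.
by rewrite (h 0) //= IHC // => i iC; apply: (h i.+1).
Qed.

Lemma positions_split k v : exists A C,
  [/\ positions k v = A ++ C,
      eps k v = 0 -> all2 ltn (positions k.+1 v) C
    & phi k v = 0 -> A = [::] /\ exists D E,
        [/\ positions k.+1 v = D ++ E, all2 ltn D C & size E = eps k v]].
Proof.
have pk := count_eps_phi k v; rewrite -!size_positions in pk.
exists (take (phi k v) (positions k v)), (drop (phi k v) (positions k v)).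
split; first by rewrite cat_take_drop.
  move=> e0; apply: all2_nthP; first by rewrite size_drop; lia.
  move=> i; rewrite size_drop nth_drop => ik.
  have := @positions_matched k v (phi k v + i); rewrite addKn; apply; first lia.
  by rewrite -size_positions; lia.
move=> p0; rewrite p0 take0 drop0; split=> //.
exists (take (size (positions k v)) (positions k.+1 v)).
exists (drop (size (positions k v)) (positions k.+1 v)).
split; first by rewrite cat_take_drop.
  apply: all2_nthP => [|i ik]; first by rewrite size_take; case: ltnP; lia.
  rewrite nth_take //; have := @positions_matched k v i; rewrite p0 subn0; apply=> //.
  by rewrite -size_positions.
by rewrite size_drop; lia.
Qed.

Lemma positions_raise k v x : x != k -> x != k.+1 ->
  positions x (raise k v) = positions x v.
Proof.
elim: v => //= y v IHv xk xk1; case: ifP => [/andP[/eqP-> _]|_].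
  by rewrite !positions_cons ![_ == x]eq_sym (negPf xk) (negPf xk1).
by rewrite !positions_cons IHv.
Qed.

(** In [inv_std] only the adjacent blocks of k and k.+1 change: the position [size u] of the raised
    letter goes from the second to the first. This is the situation of [move_unmatched]. *)
Lemma inv_std_raise (G : pred (seq nat)) k v :
  shifted_knuth_closed G -> 1 < eps k v -> G (inv_std (raise k v)) = G (inv_std v).
Proof.
move=> G_closed ev; have [u [w [vE rE pw eu ew]]] := raiseP (ltnW ev).
(* A common bound on the letters of both words that also exceeds k.+1. *)
pose N := (maxn (sumn v) (sumn (raise k v)) + k.+2).
have bound z : sumn z < N -> all (fun x => x < N) z.
  by move=> zN; apply/allP => x /leq_sumn h; apply: leq_ltn_trans zN.
rewrite (@inv_std_positions v N); last by apply: bound; rewrite /N; lia.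
rewrite (@inv_std_positions (raise k v) N); last by apply: bound; rewrite /N; lia.
have -> : iota 0 N = iota 0 k ++ [:: k; k.+1] ++ iota k.+2 (N - k.+2).
  have -> : N = k + (2 + (N - k.+2)) by rewrite /N; lia.
  rewrite !iotaD /= add0n; congr (_ ++ [:: _, _ & iota _ _]); lia.
rewrite !map_cat !flatten_cat /= cats0.
have same s : all (fun x => (x != k) && (x != k.+1)) s ->
    [seq positions x (raise k v) | x <- s] = [seq positions x v | x <- s].
  move=> /allP h; apply/eq_in_map => x /h /andP[xk xk1].
  exact: positions_raise.
rewrite !same; first last.
- by apply/allP => x; rewrite mem_iota; lia.
- by apply/allP => x; rewrite mem_iota; lia.
set al := flatten _; set be := flatten _.
have [A [C1 [Au DC1 _]]] := positions_split k u.
have [A2 [C2 [Aw _ /(_ pw)[A2E [D2 [E [DE DC2 sE]]]]]]] := positions_split k w.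
rewrite {A2}A2E /= in Aw.
(* Since 1 < eps k v, a surplus k.+1 remains to the right of the raised letter; its position y ends
   the part of the second block that is moved. *)
case: E DE sE => [|y E] DE sE; first by move: sE => /=; lia.
have {}DC1 := DC1 eu.
pose f := addn (size u).+1.
have fE s : map (addn (size u)) (map S s) = map f s.
  by rewrite -map_comp; apply: eq_map => i; rewrite /f /= addnS.
have kv : positions k v = A ++ C1 ++ map f C2.
  rewrite vE positions_cat positions_cons gtn_eqF //= fE Au Aw.
  by rewrite catA.
have k1v : positions k.+1 v = positions k.+1 u ++ size u :: map f D2 ++ map f (y :: E).
  by rewrite vE positions_cat positions_cons eqxx /= addn0 fE DE map_cat.
have kr : positions k (raise k v) = A ++ C1 ++ size u :: map f C2.
  by rewrite rE positions_cat positions_cons eqxx /= addn0 fE Au Aw catA.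
have k1r : positions k.+1 (raise k v) = positions k.+1 u ++ map f D2 ++ map f (y :: E).
  by rewrite rE positions_cat positions_cons ltn_eqF //= fE DE map_cat.
rewrite kv k1v kr k1r.
have := @move_unmatched G G_closed C1 (map f C2) (positions k.+1 u) (map f D2) (size u) (f y).
have sr := sorted_positions k (raise k v); rewrite kr in sr.
have [_ {}sr] := cat_sorted2 sr.
have sv := sorted_positions k.+1 v; rewrite k1v /= in sv.
have cE : positions k.+1 u ++ size u :: map f D2 ++ map f (y :: E)
    = (positions k.+1 u ++ size u :: rcons (map f D2) (f y)) ++ map f E.
  by rewrite -catA /= cat_rcons.
rewrite cE in sv; have [{}sv _] := cat_sorted2 sv.
have DC2' : all2 ltn (map f D2) (map f C2).
  elim: (D2) (C2) DC2 => [|d D IHD] [|c C] //= /andP[dc /IHD ->].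
  by rewrite /f ltn_add2l dc.
have un : uniq (positions k v ++ positions k.+1 v).
  rewrite cat_uniq !(sorted_uniq ltn_trans ltnn (sorted_positions _ _)) andbT /=.
  by apply/hasPn => i; rewrite !mem_positions => /andP[/eqP-> _]; rewrite gtn_eqF.
have {}un : uniq (C1 ++ map f C2 ++ positions k.+1 u ++ size u :: rcons (map f D2) (f y)).
  apply: subseq_uniq un; rewrite kv k1v cE !catA -!catA.
  apply: subseq_trans (suffix_subseq A _); rewrite !catA; exact: prefix_subseq.
move=> /(_ sr sv DC1 DC2' un) eqv.
rewrite -[in RHS]catA cE.
have := eqv (al ++ A) (map f E ++ be).
by rewrite -!catA /= !cat_rcons -!catA /= => ->; rewrite cat_rcons.
Qed.

Lemma raise_closed_inv_std n (G : pred (seq nat)) :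
  shifted_knuth_closed G -> raise_closed n (fun v => G (inv_std v)).
Proof. by move=> G_closed k v _; apply: inv_std_raise. Qed.

(** * Linear extensions of Young diagrams *)

Lemma index_inv_std v i j : i < size v -> j < size v ->
  (index i (inv_std v) < index j (inv_std v)) = standard_lt v i j.
Proof.
move=> iv jv.
have sub := sorted_ltn_index (@standard_lt_trans v) (sorted_inv_std v).
have iz : i \in inv_std v by rewrite mem_inv_std.
have jz : j \in inv_std v by rewrite mem_inv_std.
apply/idP/idP => [|ij]; first exact: sub.
rewrite ltnNge; apply/negP; rewrite leq_eqVlt.
case/orP=> [/eqP/(index_inj 0 jz iz) E|/(sub _ _ jz iz) ji].
  by rewrite E standard_lt_irr in ij.
by have := standard_lt_trans ij ji; rewrite standard_lt_irr.
Qed.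

(* Rows are numbered from the bottom and read from the top one. *)
Definition cell_position (la : seq nat) (r c : nat) : nat :=
  sumn (drop r.+1 la) + c.

Definition cells (la : seq nat) : seq (nat * nat) :=
  [seq (r, c) | r <- iota 0 (size la), c <- iota 0 (nth 0 la r)].

Lemma mem_cells la r c : ((r, c) \in cells la) = (c < nth 0 la r).
Proof.
apply/allpairsPdep/idP => [[r' [c' [_ + [-> ->]]]]|cr]; first by rewrite mem_iota.
exists r, c; rewrite !mem_iota; split=> //=.
by rewrite ltnNge; apply: contraTN cr => ?; rewrite nth_default.
Qed.

(** A standard Young tableau of shape la, encoded by the list of the reading positions of its cells
    in the order of their entries. *)
Definition linear_extension (la z : seq nat) : bool :=
  perm_eq z (iota 0 (sumn la)) &&
  all (fun p => all (fun q =>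
      [&& p.1 <= q.1, p.2 <= q.2 & p != q] ==>
        (index (cell_position la p.1 p.2) z < index (cell_position la q.1 q.2) z))
    (cells la)) (cells la).

Lemma linear_extensionP la z :
  reflect (perm_eq z (iota 0 (sumn la)) /\
     forall r c r' c', r <= r' -> c <= c' -> (r, c) != (r', c') ->
       c < nth 0 la r -> c' < nth 0 la r' ->
       index (cell_position la r c) z < index (cell_position la r' c') z)
   (linear_extension la z).
Proof.
apply: (iffP andP) => -[zn h]; split=> //.
  move=> r c r' c' rr cc ne cr cr'; rewrite -mem_cells in cr; rewrite -mem_cells in cr'.
  by move/allP: h => /(_ _ cr)/allP/(_ _ cr')/implyP; apply; rewrite rr cc.
apply/allP => -[r c]; rewrite mem_cells => cr.
apply/allP => -[r' c']; rewrite mem_cells => cr'.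
by apply/implyP => /and3P[rr cc ne]; apply: h.
Qed.

Section Shape.
Variable la : seq nat.
Hypothesis la_sorted : sorted geq la.
Local Notation pos := (cell_position la).

Lemma part_geq r r' : r <= r' -> nth 0 la r' <= nth 0 la r.
Proof.
move=> rr; case: (ltnP r' (size la)) => r's; last by rewrite (nth_default _ r's).
apply: (sorted_leq_nth (rev_trans leq_trans) leqnn 0 la_sorted) => //.
by rewrite inE (leq_ltn_trans rr).
Qed.

Lemma sumn_drop r : sumn (drop r la) = nth 0 la r + sumn (drop r.+1 la).
Proof.
case: (ltnP r (size la)) => rs; first by rewrite (drop_nth 0).
by rewrite nth_default // !drop_oversize // (leq_trans rs).
Qed.

Lemma sumn_drop_leq r r' : r <= r' -> sumn (drop r' la) <= sumn (drop r la).
Proof.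
elim: r' => [|r' IHr]; first by rewrite leqn0 => /eqP->.
rewrite leq_eqVlt => /orP[/eqP->//|/IHr]; apply: leq_trans.
by rewrite (sumn_drop r') leq_addl.
Qed.

Lemma cell_position_row r c r' c' : c' < nth 0 la r' -> r < r' ->
  pos r' c' < pos r c.
Proof.
move=> c'r /sumn_drop_leq; rewrite /cell_position (sumn_drop r'); lia.
Qed.

Lemma cell_position_size r c : c < nth 0 la r -> pos r c < sumn la.
Proof.
move=> cr; have := sumn_drop_leq (leq0n r); rewrite drop0 sumn_drop.
by rewrite /cell_position; lia.
Qed.

Lemma cell_position_ltE r c r' c' : c < nth 0 la r -> c' < nth 0 la r' ->
  (pos r c < pos r' c') = (r' < r) || ((r == r') && (c < c')).
Proof.
move=> cr cr'; case: (ltngtP r r') => [rr|rr|<-] /=.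
- by have := cell_position_row c cr' rr; lia.
- exact: cell_position_row.
by rewrite /cell_position ltn_add2l.
Qed.

Lemma cell_position_inj r c r' c' : c < nth 0 la r -> c' < nth 0 la r' ->
  pos r c = pos r' c' -> (r, c) = (r', c').
Proof.
move=> cr cr' E; have := cell_position_ltE cr cr'.
have := cell_position_ltE cr' cr; rewrite E ltnn.
by case: (ltngtP r r') => //= <-; case: (ltngtP c c') => // <-.
Qed.

Lemma cell_positionP p : p < sumn la ->
  exists r c, c < nth 0 la r /\ p = pos r c.
Proof.
rewrite /cell_position; elim: la p => //= a l IHl p pa.
case: (ltnP p (sumn l)) => [/IHl[r [c [cr ->]]]|lp]; first by exists r.+1, c.
by exists 0, (p - sumn l); rewrite /= drop0; split; lia.
Qed.

Lemma index_cell_inj z r c r' c' : perm_eq z (iota 0 (sumn la)) ->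
  c < nth 0 la r -> c' < nth 0 la r' ->
  index (pos r c) z = index (pos r' c') z -> (r, c) = (r', c').
Proof.
move=> zn cr cr' E; apply: cell_position_inj => //; apply: (index_inj 0 _ _ E);
  by rewrite (perm_mem zn) mem_iota /= cell_position_size.
Qed.

(* This is why Knuth moves preserve linear extensions: a and y are the letters
   to be exchanged, and b is the adjacent letter that allows it. *)
Lemma linear_extension_incomparable z i ra ca rb cb ry cy :
    linear_extension la z ->
    ca < nth 0 la ra -> cb < nth 0 la rb -> cy < nth 0 la ry ->
    pos ra ca < pos rb cb -> pos rb cb < pos ry cy ->
    (index (pos ra ca) z = i /\ index (pos ry cy) z = i.+1) \/
      (index (pos ry cy) z = i /\ index (pos ra ca) z = i.+1) ->
    index (pos rb cb) z = i.+2 \/ (index (pos rb cb) z).+1 = i ->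
  ~~ ((ra <= ry) && (ca <= cy)) && ~~ ((ry <= ra) && (cy <= ca)).
Proof.
move=> /linear_extensionP[zn h] cra crb cry.
rewrite !cell_position_ltE // => ab bY ayi bi.
(* The indices i and i.+1 are taken by a and y; each case below produces a further cell there or an
   index that does not exist. *)
have btw r c : c < nth 0 la r -> index (pos r c) z = i \/ index (pos r c) z = i.+1 ->
    (r, c) = (ra, ca) \/ (r, c) = (ry, cy).
  move=> cr; case: ayi => -[<- <-].
    by case=> [/(index_cell_inj zn cr cra)|/(index_cell_inj zn cr cry)]; [left|right].
  by case=> [/(index_cell_inj zn cr cry)|/(index_cell_inj zn cr cra)]; [right|left].
apply/andP; split; apply/negP => /andP[rr cc].
  have [E1 E2] : ra = rb /\ rb = ry by lia.
  subst rb ry; rewrite !ltnn !eqxx /= in ab bY.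
  have ab' := h _ _ _ _ (leqnn ra) (ltnW ab) _ cra crb.
  have by' := h _ _ _ _ (leqnn ra) (ltnW bY) _ crb cry.
  have := ab' ltac:(apply/eqP=> -[]; lia); have := by' ltac:(apply/eqP=> -[]; lia).
  by case: ayi => -[-> ->]; case: bi => [->|<-]; lia.
have ry_ra : ry < ra by lia.
have ya := h _ _ _ _ rr cc ltac:(apply/eqP=> -[]; lia) cry cra.
have {ayi} [yi ai] : index (pos ry cy) z = i /\ index (pos ra ca) z = i.+1.
  by case: ayi => // -[ai yi]; lia.
(* Now y is below a in the cell order and immediately before it in z, so no cell lies between them:
   a is directly above y. *)
have ccE : cy = ca.
  case: (ltngtP cy ca) cc => // lt _.
  have cw : ca < nth 0 la ry by apply: leq_trans cra (part_geq rr).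
  have := h _ _ _ _ (leqnn ry) (ltnW lt) ltac:(apply/eqP=> -[]; lia) cry cw.
  have := h _ _ _ _ rr (leqnn ca) ltac:(apply/eqP=> -[]; lia) cw cra.
  by rewrite yi ai; lia.
subst cy.
have raE : ra = ry.+1.
  case: (ltngtP ra ry.+1) ry_ra => // lt _.
  have cw : ca < nth 0 la ry.+1 by apply: leq_trans cra (part_geq _); apply: ltnW.
  have := h _ _ _ _ (leqnSn ry) (leqnn ca) ltac:(apply/eqP=> -[]; lia) cry cw.
  have := h _ _ _ _ (ltnW lt) (leqnn ca) ltac:(apply/eqP=> -[]; lia) cw cra.
  by rewrite yi ai; lia.
(* In reading order b is between these two cells: to the right of a or to the left of y. The fourth
   corner of the rectangle spanned by a, y and b would have to take the index of a or y. *)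
have [/andP[/eqP rE cE]|/andP[/eqP rE cE]] :
  (rb == ra) && (ca < cb) \/ (rb == ry) && (cb < ca).
- by move: ab bY; lia.
- subst rb.
  have ab' := h _ _ _ _ (leqnn ra) (ltnW cE) ltac:(apply/eqP=> -[]; lia) cra crb.
  have cw : cb < nth 0 la ry by apply: leq_trans crb (part_geq rr).
  have h1 := h _ _ _ _ (leqnn ry) (ltnW cE) ltac:(apply/eqP=> -[]; lia) cry cw.
  have h2 := h _ _ _ _ rr (leqnn cb) ltac:(apply/eqP=> -[]; lia) cw crb.
  have [] := btw _ _ cw; first by right; lia.
    by case; lia.
  by case; lia.
subst rb.
have by' := h _ _ _ _ (leqnn ry) (ltnW cE) ltac:(apply/eqP=> -[]; lia) crb cry.
have cw : cb < nth 0 la ra by apply: ltn_trans cE cra.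
have h1 := h _ _ _ _ rr (leqnn cb) ltac:(apply/eqP=> -[]; lia) crb cw.
have h2 := h _ _ _ _ (leqnn ra) (ltnW cE) ltac:(apply/eqP=> -[]; lia) cw cra.
have [] := btw _ _ cw; first by left; lia.
  by case; lia.
by case; lia.
Qed.

Lemma index_swap (al be : seq nat) p q s : uniq (al ++ p :: q :: be) ->
  index s (al ++ q :: p :: be)
  = index (if s == p then q else if s == q then p else s) (al ++ p :: q :: be).
Proof.
rewrite cat_uniq /= !inE !negb_or => /and3P[_ /andP[pal /andP[qal _]] /andP[/andP[pq _] _]].
rewrite !index_cat; case: (s =P p) => [->|/eqP sp].
  by rewrite (negPf pal) (negPf qal) /= !eqxx (negPf pq) eq_sym (negPf pq).
case: (s =P q) => [->|/eqP sq].
  by rewrite (negPf pal) (negPf qal) /= !eqxx.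
by case: ifP => //= _; rewrite ![_ == s]eq_sym (negPf sp) (negPf sq).
Qed.

Lemma linear_extension_swap al be p q b :
    linear_extension la (al ++ p :: q :: be) ->
    (p < b < q) || (q < b < p) ->
    index b (al ++ p :: q :: be) = (size al).+2 \/
      (index b (al ++ p :: q :: be)).+1 = size al ->
  linear_extension la (al ++ q :: p :: be).
Proof.
set z := al ++ p :: q :: be => lz bpq bi; have /linear_extensionP[zn h] := lz.
have uz : uniq z by rewrite (perm_uniq zn) iota_uniq.
have mz i : (i \in z) = (i < sumn la) by rewrite (perm_mem zn) mem_iota.
have [pn qn] : p < sumn la /\ q < sumn la.
  by rewrite -!mz !mem_cat !inE !eqxx !orbT.
have bn : b < sumn la by case/orP: bpq => /andP[_ /ltn_trans]; apply.
have pi : index p z = size al.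
  move: uz; rewrite cat_uniq /= negb_or => /and3P[_ /andP[pal _] _].
  by rewrite index_cat (negPf pal) /= eqxx addn0.
have qi : index q z = (size al).+1.
  move: uz; rewrite cat_uniq /= !inE !negb_or.
  move=> /and3P[_ /and3P[_ qal _] /andP[/andP[pq _] _]].
  by rewrite index_cat (negPf qal) /= eqxx (negPf pq) addn1.
have [rp [cp [crp pE]]] := cell_positionP pn.
have [rq [cq [crq qE]]] := cell_positionP qn.
have [rb [cb [crb bE]]] := cell_positionP bn.
have inc : ~~ ((rp <= rq) && (cp <= cq)) && ~~ ((rq <= rp) && (cq <= cp)).
  case/orP: bpq => /andP[b1 b2].
    apply: (@linear_extension_incomparable z (size al) _ _ rb cb);
      rewrite -?pE -?qE -?bE //; by left.
  rewrite andbC; apply: (@linear_extension_incomparable z (size al) _ _ rb cb);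
    rewrite -?pE -?qE -?bE //; by right.
apply/linear_extensionP; split.
  apply: perm_trans zn; rewrite perm_cat2l.
  by rewrite -[q :: _]/([:: q] ++ [:: p] ++ be) perm_catCA.
move=> r c r' c' rr cc ne cr cr'; rewrite !(index_swap _ uz) -/z.
have lt := h r c r' c' rr cc ne cr cr'.
have ppos r0 c0 : c0 < nth 0 la r0 -> pos r0 c0 = p -> r0 = rp /\ c0 = cp.
  by move=> cr0; rewrite pE => /(cell_position_inj cr0 crp) [-> ->].
have qpos r0 c0 : c0 < nth 0 la r0 -> pos r0 c0 = q -> r0 = rq /\ c0 = cq.
  by move=> cr0; rewrite qE => /(cell_position_inj cr0 crq) [-> ->].
have inj s t : s < sumn la -> t < sumn la -> index s z = index t z -> s = t.
  by move=> sn tn; apply: (index_inj 0); rewrite mz.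
have sn := cell_position_size cr; have tn := cell_position_size cr'.
case: (_ =P p) => [sp|sp]; case: (_ =P p) => [tp|tp].
- by rewrite sp tp ltnn in lt.
- case: (_ =P q) => [tq|tq].
    have [e1 e2] := ppos _ _ cr sp; have [e3 e4] := qpos _ _ cr' tq; subst.
    by rewrite rr cc in inc.
  rewrite sp pi in lt; rewrite qi ltn_neqAle lt andbT -qi.
  by apply/eqP => /(inj _ _ qn tn) e; apply: tq.
- case: (_ =P q) => [sq|sq].
    by rewrite sq tp qi pi in lt; lia.
  by rewrite tp pi in lt; rewrite qi; apply: ltn_trans lt _.
case: (_ =P q) => [sq|sq]; case: (_ =P q) => [tq|tq] //.
- by rewrite sq tq ltnn in lt.
- by rewrite sq qi in lt; rewrite pi; apply: ltn_trans lt.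
rewrite tq qi ltnS in lt; rewrite pi ltn_neqAle lt andbT -pi.
by apply/eqP => /(inj _ _ sn pn).
Qed.

Lemma linear_extension_knuth : knuth_closed (linear_extension la).
Proof.
have un z : linear_extension la z -> uniq z.
  by move=> /linear_extensionP[zn _]; rewrite (perm_uniq zn) iota_uniq.
split=> al be a.
  move=> x y ax xy; rewrite -![_ ++ [:: _; _; _] ++ _]cat_rcons /=.
  have xal u v : uniq (rcons al x ++ u :: v :: be) ->
      (index x (rcons al x ++ u :: v :: be)).+1 = size (rcons al x).
    rewrite cat_uniq rcons_uniq => /andP[/andP[xal _] _].
    by rewrite cat_rcons index_cat (negPf xal) /= eqxx addn0 size_rcons.
  apply/idP/idP => le; have := un _ le => /xal xi;
    by apply: (linear_extension_swap le (b := x)); [rewrite ax xy ?orbT | right].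
move=> b y ab bY /=.
have bi u v : b != u -> b != v -> uniq (al ++ u :: v :: b :: be) ->
    index b (al ++ u :: v :: b :: be) = (size al).+2.
  move=> bu bv; rewrite cat_uniq => /and3P[_ /hasPn/(_ b) + _].
  rewrite !inE eqxx !orbT => /(_ isT) bal.
  by rewrite index_cat (negPf bal) /= eqxx ![_ == b]eq_sym (negPf bu) (negPf bv) addn2.
apply/idP/idP => le; have := un _ le => /bi xi;
  by apply: (linear_extension_swap le (b := b));
    [rewrite ab bY ?orbT | left; apply: xi; lia].
Qed.

(** Standardization breaks ties in reading order, from left to right in a row but from top to bottom
    in a column. This makes rows weakly and columns strictly increasing. *)
Lemma linear_extension_inv_std v : size v = sumn la ->
  reflect (forall r c, (c.+1 < nth 0 la r -> nth 0 v (pos r c) <= nth 0 v (pos r c.+1))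
     /\ (c < nth 0 la r.+1 -> nth 0 v (pos r c) < nth 0 v (pos r.+1 c)))
    (linear_extension la (inv_std v)).
Proof.
move=> sv; apply: (iffP (linear_extensionP _ _)) => [[_ h] r c|h].
  split=> cr.
    have := h r c r c.+1 (leqnn _) (leqnSn _) ltac:(apply/eqP=> -[]; lia) (ltnW cr) cr.
    rewrite index_inv_std ?sv ?cell_position_size //; last exact: ltnW.
    by rewrite /standard_lt; lia.
  have cr0 : c < nth 0 la r by apply: leq_trans cr (part_geq _).
  have := h r c r.+1 c (leqnSn _) (leqnn _) ltac:(apply/eqP=> -[]; lia) cr0 cr.
  rewrite index_inv_std ?sv ?cell_position_size //.
  by have := cell_position_row c cr (ltnSn r); rewrite /standard_lt; lia.
split; first by rewrite -sv perm_inv_std.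
move=> r c r' c' rr cc ne cr cr'; rewrite index_inv_std ?sv ?cell_position_size //.
have cr'' : c' < nth 0 la r by apply: leq_trans cr' (part_geq rr).
have le_row : nth 0 v (pos r c) <= nth 0 v (pos r c').
  elim: c' cc cr'' {cr' ne} => [|c' IHc]; first by rewrite leqn0 => /eqP->.
  rewrite leq_eqVlt => /orP[/eqP->//|cc] cr1.
  by apply: leq_trans (IHc cc (ltnW cr1)) _; case: (h r c') => + _; apply.
rewrite /standard_lt; case: (ltngtP r r') rr => // [rr _|rE _].
  suff: nth 0 v (pos r c') < nth 0 v (pos r' c') by lia.
  elim: r' rr cr' {ne} => // r' IHr; rewrite ltnS leq_eqVlt => /orP[/eqP<-|rr] cr1.
    by case: (h r c') => _; apply.
  have cr2 : c' < nth 0 la r' by apply: leq_trans cr1 (part_geq _).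
  by apply: ltn_trans (IHr rr cr2) _; case: (h r' c') => _; apply.
have : pos r c < pos r' c'.
  rewrite cell_position_ltE // rE ltnn eqxx /=.
  by move: ne; rewrite rE xpair_eqE eqxx /= ltn_neqAle cc => ->.
by rewrite -rE; lia.
Qed.
End Shape.

Lemma nth_reading la v r c : size v = sumn la -> c < nth 0 la r ->
  nth 0 (nth [::] (rev (reshape (rev la) v)) r) c = nth 0 v (cell_position la r c).
Proof.
elim: la v r => [|a la IHla] v r; first by rewrite nth_nil.
move=> /= sv; rewrite rev_cons reshape_rcons ?sumn_rev ?sv 1?addnC // rev_rcons.
case: r => [|r] /= cr; first by rewrite nth_drop /cell_position /= drop0.
rewrite IHla // ?size_takel ?sv ?leq_addl // nth_take //.
rewrite /cell_position; apply: leq_trans (_ : sumn (drop r la) <= _).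
  have -> : sumn (drop r la) = nth 0 la r + sumn (drop r.+1 la).
    case: (ltnP r (size la)) => rs; first by rewrite (drop_nth 0).
    by rewrite (nth_default _ rs) in cr.
  by lia.
by rewrite -[X in _ <= sumn X](cat_take_drop r) sumn_cat leq_addl.
Qed.

Lemma shape_reading (la v : seq nat) : size v = sumn la ->
  shape (rev (reshape (rev la) v)) = la.
Proof.
by move=> sv; rewrite /shape map_rev -/(shape _) reshapeKl ?revK ?sumn_rev ?sv.
Qed.

Lemma reading_ssyt_linear_extension la v : sorted geq la -> size v = sumn la ->
  reading_ssyt la v = linear_extension la (inv_std v).
Proof.
move=> sla sv; have sh := shape_reading sv.
have nr r c := @nth_reading la v r c sv.
rewrite /reading_ssyt; set t := rev _ in sh nr *.
have st r : size (nth [::] t r) = nth 0 la r by rewrite -sh nth_shape.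
have szt : size t = size la by rewrite -sh size_map.
apply/andP/(linear_extension_inv_std sla sv) => [[rows cols] r c|h].
  split=> cr.
    have rs : r < size t.
      by rewrite szt ltnNge; apply: contraTN cr => ?; rewrite nth_default.
    have /(all_nthP [::])/(_ r rs)/(sortedP 0)/(_ c) := rows.
    by rewrite st !nr // => [->|]; rewrite // ltnW.
  have rs : r.+1 < size t.
    by rewrite szt ltnNge; apply: contraTN cr => ?; rewrite nth_default.
  have /(sortedP [::])/(_ r rs)/allP/(_ c) := cols.
  rewrite mem_iota st add0n => /(_ cr); rewrite !nr //.
  exact: leq_trans cr (part_geq sla _).
split.
  apply/(all_nthP [::]) => r rs; apply/(sortedP 0) => c; rewrite st => cr.
  by rewrite !nr ?(ltnW cr) //; case: (h r c) => + _; apply.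
apply/(sortedP [::]) => r rs; apply/allP => c; rewrite mem_iota st add0n => /= cr.
rewrite !nr //; first by case: (h r c) => _; apply.
exact: leq_trans cr (part_geq sla _).
Qed.

(** A letter k.+1 added at the end is unmatched and supplies the second unmatched letter required by
    [inv_std_raise]. Its position is [size v], which the filter in G' erases. *)
Lemma inv_std_raise_knuth (G : pred (seq nat)) k v :
  knuth_closed G -> 0 < eps k v -> G (inv_std (raise k v)) = G (inv_std v).
Proof.
move=> G_closed ev.
pose G' := fun z => G (filter (fun i => i < size v) z).
have G'_closed : shifted_knuth_closed G' by apply: knuth_closed_shifted.
have p1 : phi k [:: k.+1] = 0 by rewrite /= gtn_eqF ?eqxx.
have e1 : eps k [:: k.+1] = 1 by rewrite /= eqxx.
have drop_last w : size w = size v -> G' (inv_std (w ++ [:: k.+1])) = G (inv_std w).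
  move=> sw; rewrite /G'; congr G; symmetry; apply: inv_stdE.
    apply: (@sub_in_sorted _ (fun i => i < size w) (standard_lt (w ++ [:: k.+1]))).
    - move=> i j iw jw; rewrite /standard_lt !nth_cat.
      by rewrite (iw : i < size w) (jw : j < size w).
    - by rewrite sw filter_all.
    - by apply: sorted_filter (@standard_lt_trans _) _ _ (sorted_inv_std _).
  move=> i; rewrite mem_filter mem_inv_std mem_iota size_cat /= -sw.
  by case: (ltnP i (size w)) => // iw; rewrite ltn_addr.
rewrite -[RHS]drop_last // -[LHS]drop_last ?size_raise //.
rewrite -raise_cat //; apply: inv_std_raise => //.
by rewrite eps_cat // e1; lia.
Qed.

Lemma reading_ssyt_raise la k v : sorted geq la -> size v = sumn la ->
  0 < eps k v -> reading_ssyt la (raise k v) = reading_ssyt la v.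
Proof.
move=> sla sv ev; rewrite !reading_ssyt_linear_extension ?size_raise //.
exact: inv_std_raise_knuth (linear_extension_knuth sla) ev.
Qed.

(** * Schur expansions *)

Local Open Scope ring_scope.

Lemma schur_symmetric la : sorted geq la -> adjacent_symmetric (schur la).
Proof.
move=> sla k m; rewrite !schur_reading; apply: raise_closed_symmetric.
by move=> i v; apply: reading_ssyt_raise.
Qed.

Lemma gen_series_of_size n H m : size m != n -> gen_series (of_size n H) m = 0.
Proof.
move=> sm; rewrite /gen_series; congr Posz.
rewrite -[RHS](count_pred0 (permutations m)); apply: eq_in_count => v.
by rewrite mem_permutations /of_size => /perm_size->; rewrite (negPf sm).
Qed.

Lemma dot_superstandard N n la (mu : {ffun 'I_N -> int}) :
    is_partition n la -> (n <= N)%N -> dominant mu ->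
  \sum_s (-1) ^+ odd_perm s * mult n (reading_ssyt la) (dot mu s)
    = (mu == wt N (superstandard_word la))%:Z.
Proof.
move=> pla nN dmu; have [sla _ sumla] := is_partitionP pla.
rewrite alternating_mult //; first exact: mult_reading_ssyt.
by move=> k v sv /ltnW ev; apply: reading_ssyt_raise; rewrite ?sumla.
Qed.

(** The difference g of the two sides is symmetric. Its signed sums vanish because that of H counts
    lattice words of weight mu, and that of each Schur function is 1 at its own shape and 0 at the
    others. *)
Theorem schur_expansion n H :
    raise_closed n H -> adjacent_symmetric (gen_series (of_size n H)) ->
  gen_series (of_size n H) =1 fun m => \sum_(la : partition_of n)
    (count (predI H lattice) (permutations (superstandard_word (parts la))))%:Z
      * schur (parts la) m.
Proof.
move=> Hr Hs m.
have plaP (la : partition_of n) := is_partitionP (part_bseqP la).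
have schurE (la : partition_of n) m' : schur (parts la) m'
    = gen_series (of_size n (reading_ssyt (parts la))) m'.
  by have [_ _ sumla] := plaP la; rewrite schur_reading {1}sumla.
have [sm|sm] := eqVneq (size m) n; last first.
  rewrite gen_series_of_size // big1 // => la _.
  by rewrite schurE gen_series_of_size ?mulr0.
(* Enough variables for the letters of m and for the at most n parts of each partition. *)
pose N := (n + (sumn m).+1)%N.
have nN : (n <= N)%N by apply: leq_addr.
have mw : m \in words N n.
  rewrite mem_words sm eqxx; apply/allP => x /leq_sumn xm.
  by rewrite /N addnS ltnS; apply: leq_trans xm (leq_addl _ _).
pose d (la : partition_of n) : int :=
  (count (predI H lattice) (permutations (superstandard_word (parts la))))%:Z.
have dE la : d la = mult n (predI H lattice) (wt N (superstandard_word (parts la))).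
  have laP := part_bseqP la.
  rewrite -gen_series_mult; last exact: superstandard_words.
  rewrite /d /gen_series; congr Posz; apply: eq_in_count => v.
  rewrite mem_permutations => /perm_size; rewrite size_superstandard /of_size => ->.
  by have [_ _ ->] := plaP la; rewrite eqxx.
pose g (al : {ffun 'I_N -> int}) : int :=
  mult n H al - \sum_(la : partition_of n) d la * mult n (reading_ssyt (parts la)) al.
suff g0 al : g al = 0.
  rewrite (gen_series_mult H mw); move/eqP: (g0 (wt N m)); rewrite subr_eq0 => /eqP ->.
  by apply: eq_bigr => la _; rewrite schurE (gen_series_mult _ mw).
apply: (@alternating_sums_eq0 N n) => {al} [al gal|al i j ji|mu _ _ dmu].
- have [v vw <-] : exists2 v, v \in words N n & wt N v = al.
    case: (mult n H al =P 0) => [al0|/eqP/mult_neq0 //].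
    case: (boolP [exists la : partition_of n, mult n (reading_ssyt (parts la)) al != 0]).
      by case/existsP => la /mult_neq0.
    move=> /existsPn h; case/eqP: gal; rewrite /g al0 big1 ?subr0 // => la _.
    by have := h la; rewrite negbK => /eqP->; rewrite mulr0.
  by split; [move=> i; rewrite ffunE | apply: sum_wt].
- rewrite /g mult_sym //; congr (_ - _); apply: eq_bigr => la _.
  rewrite mult_sym // => k m'; rewrite -!schurE; apply: schur_symmetric.
  by have [] := plaP la.
transitivity (mult n (predI H lattice) mu
  - \sum_(la : partition_of n) d la * (mu == wt N (superstandard_word (parts la)))%:Z).
  rewrite -alternating_mult // (eq_bigr (fun la : partition_of n =>
    \sum_s (-1) ^+ odd_perm s * (d la * mult n (reading_ssyt (parts la)) (dot mu s)))).
    rewrite exchange_big -sumrB /=; apply: eq_bigr => s _.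
    by rewrite -mulr_sumr -mulrBr.
  move=> la _; rewrite -(dot_superstandard (part_bseqP la) nN dmu) mulr_sumr.
  by apply: eq_bigr => s _; rewrite mulrCA.
(* At the weight of a shape the two terms agree by the choice of d; any other mu is not the weight
   of a lattice word. *)
case: (pickP (fun la : partition_of n => mu == wt N (superstandard_word (parts la)))).
  move=> la0 /eqP muE; rewrite (bigD1 la0) //= big1 => [|la /eqP ne].
    by rewrite dE muE eqxx mulr1 addr0 subrr.
  rewrite muE; case: eqP => [E|]; last by rewrite mulr0.
  by case: ne; apply: superstandard_inj nN (esym E).
move=> none; rewrite big1 => [|la _]; last by rewrite none mulr0.
rewrite subr0; apply/eqP; apply: contraTT isT.
rewrite /mult -count_sum eqz_nat -lt0n -has_count.
move=> /hasP[v vw /= /andP[/andP[_ lv] /eqP vmu]].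
have [la E] := lattice_content vw lv.
by have := none la; rewrite -E vmu eqxx.
Qed.

(** * Row insertion and lattice words *)

Local Open Scope nat_scope.

Lemma lattice_catl u s1 s2 : perm_eq s1 s2 -> lattice s1 = lattice s2 ->
  lattice (u ++ s1) = lattice (u ++ s2).
Proof.
move=> /seq.permP p12 l12; elim: u => //= x u ->.
by rewrite !count_cat !p12.
Qed.

(** The order of y and a matters only if y = a.+1. Then x = y, and the condition on x, which counts
    both following letters, is the strongest and is common to both sides. *)
Lemma lattice_swap1 a x y s : a < x -> x <= y ->
  lattice [:: x, y, a & s] = lattice [:: x, a, y & s].
Proof.
move=> ax xy /=; case L: (lattice s) => //=.
have ya : (y == a) = false by apply/eqP; lia.
have ay : (a == y) = false by apply/eqP; lia.
have ya1 : (y == a.-1) = false by apply/eqP; lia.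
rewrite ya ay ya1 !add0n.
case: (a =P y.-1) => [aE|_]; last first.
  by rewrite !add0n [in LHS](andbC ((a == 0) || _)) (addnCA (y == x)) (addnCA (y == x.-1)).
have xE : x = a.+1 by lia.
have yE : y = a.+1 by lia.
subst x y; have := lattice_count a L; rewrite /= eqxx.
by case: (_ || _) => //=; lia.
Qed.

(** The order of y and a matters only if y = a.+1. Then b = a, and this b already allows y to
    precede it. *)
Lemma lattice_swap2 a b y s : a <= b -> b < y ->
  lattice [:: y, a, b & s] = lattice [:: a, y, b & s].
Proof.
move=> ab bY /=; case L: (lattice s) => //=.
have ya : (y == a) = false by apply/eqP; lia.
have ay : (a == y) = false by apply/eqP; lia.
have ya1 : (y == a.-1) = false by apply/eqP; lia.
have yb : (b == y) = false by apply/eqP; lia.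
rewrite ya ay ya1 yb !add0n.
case: (a =P y.-1) => [aE|_]; last first.
  by rewrite !add0n; case: (_ || _); rewrite ?andbT ?andbF //= andbC.
have bE : b = a by lia.
have yE : y = a.+1 by lia.
subst b y; have := lattice_count a L; rewrite /= eqxx => h.
have -> : count_mem a.+1 s < 1 + (1 + count_mem a s) by move: h => /=; lia.
have -> : count_mem a.+1 s < 1 + count_mem a s by move: h => /=; lia.
by rewrite !andbT.
Qed.

(** * Lattice words recognized on their standardizations *)

Section LetterMap.
Variable beta : nat -> nat.
Hypothesis beta_mono : {homo beta : x y / x <= y}.

(* By [inv_std_map], q is the standardization of [map beta q] if this relation
   holds between any two letters of q, in this order. *)
Definition refines_std : rel nat := fun x y => (x <= y) || (beta y < beta x).

(** For the function [block] defined below, a permutation of 1, ..., n satisfies this when it is the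
    standardization of a lattice word of weight la. *)
Definition lattice_blocks (q : seq nat) : bool :=
  pairwise refines_std q && lattice (map beta q).

Lemma inv_std_map q : uniq q ->
  (inv_std (map beta q) == inv_std q) = pairwise refines_std q.
Proof.
move=> uq; apply/eqP/(pairwiseP 0) => [E i j|h].
  rewrite !inE => iq jq ij; rewrite /refines_std.
  case: (leqP (nth 0 q i) (nth 0 q j)) => //= ji.
  have : standard_lt q j i by rewrite /standard_lt ji.
  rewrite -index_inv_std // -E index_inv_std ?size_map // /standard_lt.
  by rewrite !(nth_map 0) //; lia.
apply: inv_stdE; last by rewrite size_map => i; rewrite mem_inv_std mem_iota.
apply: (@sub_in_sorted _ (fun i => i < size q) (standard_lt q)); last exact: sorted_inv_std.
  move=> i j iq jq; have {}iq : i < size q := iq; have {}jq : j < size q := jq.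
  rewrite /standard_lt !(nth_map 0) // nth_uniq //.
  case/orP=> [qij|/andP[/eqP->]]; last by rewrite ltnn.
  have := beta_mono (ltnW qij); rewrite leq_eqVlt => /orP[/eqP E|->] //.
  rewrite E eqxx ltnn /=; case: (ltngtP i j) => // [ji|ijE]; last by rewrite ijE ltnn in qij.
  by have := h j i jq iq ji; rewrite /refines_std E ltnn orbF leqNgt qij.
by apply/allP => i; rewrite mem_inv_std.
Qed.

Lemma lattice_blocks_knuth : knuth_closed lattice_blocks.
Proof.
have pw al s s' be : (forall P : pred nat, all P s = all P s') ->
   pairwise refines_std s = pairwise refines_std s' ->
   pairwise refines_std (al ++ s ++ be) = pairwise refines_std (al ++ s' ++ be).
  move=> a e; rewrite !pairwise_cat e; congr [&& _, _ & _ && _].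
    by apply: eq_all => x; rewrite /= !all_cat a.
  by rewrite /allrel a.
have lt al s s' be : perm_eq s s' ->
    lattice (map beta (s ++ be)) = lattice (map beta (s' ++ be)) ->
    lattice (map beta (al ++ s ++ be)) = lattice (map beta (al ++ s' ++ be)).
  move=> p; rewrite !(map_cat _ al); apply: lattice_catl.
  by apply: perm_map; rewrite perm_cat2r.
split=> al be a.
  move=> x y ax xy; rewrite /lattice_blocks.
  have bx := beta_mono (ltnW ax); have bxy := beta_mono (ltnW xy).
  have nR u v : u < v -> refines_std u v by rewrite /refines_std => /ltnW->.
  have eR u v : u < v -> refines_std v u = (beta u < beta v).
    by rewrite /refines_std ltnNge => /negPf->.
  rewrite (@pw al [:: x; y; a] [:: x; a; y]); last first.
  - have ay := ltn_trans ax xy; rewrite /= (nR x y) // (nR a y) // !eR //.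
    by case: (ltnP (beta a) (beta x)) => //= h; rewrite (leq_trans h bxy).
  - by move=> P /=; rewrite !andbT [P y && P a]andbC.
  case pR: (pairwise _ _) => //; rewrite !andTb.
  (* The larger x stands before a, so [refines_std] makes this strict; the images then satisfy the
     inequalities of a Knuth relation with repeated letters. *)
  have bax : beta a < beta x.
    move: pR; rewrite !pairwise_cat => /and3P[_ _ /and3P[_ /= /andP[/andP[]]]].
    by rewrite eR.
  apply: lt; first by apply/seq.permP => P /=; rewrite !addn0 [P y + P a]addnC.
  exact: lattice_swap1.
move=> b y ab bY; rewrite /lattice_blocks.
have bab := beta_mono (ltnW ab); have bby := beta_mono (ltnW bY).
have nR u v : u < v -> refines_std u v by rewrite /refines_std => /ltnW->.
have eR u v : u < v -> refines_std v u = (beta u < beta v).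
  by rewrite /refines_std ltnNge => /negPf->.
rewrite (@pw al [:: y; a; b] [:: a; y; b]); last first.
- have ay := ltn_trans ab bY; rewrite /= (nR a b) // (nR a y) // !eR //.
  case: (ltnP (beta b) (beta y)) => //= h; rewrite ?andbF //.
  by rewrite (leq_ltn_trans bab h).
- by move=> P /=; rewrite andbCA.
case pR: (pairwise _ _) => //; rewrite !andTb.
have bbY : beta b < beta y.
  move: pR; rewrite !pairwise_cat => /and3P[_ _ /and3P[_ /= /and3P[_ /andP[+ _] _]]].
  by rewrite eR.
apply: lt; first by apply/seq.permP => P /=; rewrite addnCA.
exact: lattice_swap2.
Qed.
End LetterMap.

(** * Row insertion as a sequence of Knuth moves *)

Section KnuthInsertion.
Variable G : pred (seq nat).
Hypothesis G_closed : knuth_closed G.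

Lemma knuth_left y r x : path ltn y r -> x < y ->
  equiv_in G (y :: rcons r x) (y :: x :: r).
Proof.
elim: r y => [|c r IHr] y //= /andP[yc cr] xy.
apply: (@equiv_trans _ (y :: c :: x :: r)).
  by apply: equiv_cons; apply: IHr; rewrite // (ltn_trans xy).
by move=> al be; apply: (G_closed.1 al (r ++ be)).
Qed.

Lemma knuth_right r y x : sorted ltn (rcons r x) -> x < y ->
  equiv_in G (r ++ [:: y; x]) (y :: rcons r x).
Proof.
elim: r => [|a r IHr] // sr xy.
apply: (@equiv_trans _ (a :: y :: rcons r x)).
  by apply: equiv_cons; apply: IHr; rewrite // (path_sorted sr).
rewrite rcons_cons; case E: (rcons r x) => [|b t]; first by case: (r) E.
have /= /andP[ab _] : sorted ltn (a :: b :: t) by rewrite -E.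
have bY : b < y.
  have : all (fun i => i < y) (b :: t).
    rewrite -E all_rcons xy; apply/allP => i ir; apply: ltn_trans xy.
    have := sr; rewrite rcons_cons -cats1 (sorted_pairwise ltn_trans) /=.
    by rewrite pairwise_cat => /andP[_ /andP[/allrelP h _]]; apply: h; rewrite ?mem_head.
  by case/andP.
by move=> al be; apply/esym; apply: (G_closed.2 al (t ++ be)).
Qed.

(* Row insertion of x, which bumps y. *)
Lemma knuth_bump r1 y r2 x : sorted ltn (r1 ++ y :: r2) ->
  all (fun i => i < x) r1 -> x < y ->
  equiv_in G (r1 ++ y :: rcons r2 x) (y :: r1 ++ x :: r2).
Proof.
move=> sr r1x xy; have [sr1 yr2] := cat_sorted2 sr.
apply: (@equiv_trans _ (r1 ++ y :: x :: r2)).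
  by apply: equiv_catl; apply: knuth_left.
have -> : r1 ++ y :: x :: r2 = (r1 ++ [:: y; x]) ++ r2 by rewrite -catA.
have -> : y :: r1 ++ x :: r2 = (y :: rcons r1 x) ++ r2 by rewrite /= cat_rcons.
apply: equiv_catr; apply: knuth_right => //.
rewrite -cats1 (sorted_pairwise ltn_trans) pairwise_cat -(sorted_pairwise ltn_trans) sr1 /=.
by rewrite !andbT; apply/allrelP => i j /(allP r1x) /= ix; rewrite inE => /eqP->.
Qed.
End KnuthInsertion.

(** Only the first column is followed through insertion: [lattice_rows] asks for no more. *)
Definition row_heads_increasing (t : seq (seq nat)) : bool :=
  sorted (fun r r' => head 0 r < head 0 r') t.

Definition increasing_rows (t : seq (seq nat)) : bool :=
  [&& all (sorted ltn) t, all (fun r => r != [::]) t & row_heads_increasing t].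

Lemma insert_split r x : sorted ltn r -> x \notin r ->
  let k := find (fun y => x < y) r in
  all (fun i => i < x) (take k r) /\
  (k < size r -> [/\ x < nth 0 r k, r = take k r ++ nth 0 r k :: drop k.+1 r
     & set_nth 0 r k x = take k r ++ x :: drop k.+1 r]) /\
  (size r <= k -> take k r = r /\ set_nth 0 r k x = rcons r x).
Proof.
move=> sr xr k; split.
  apply/(all_nthP 0) => i; rewrite size_take_min leq_min => /andP[ik ir].
  rewrite nth_take //; have := before_find 0 ik => /negbT; rewrite -leqNgt.
  rewrite leq_eqVlt => /orP[/eqP E|//].
  by move: xr; rewrite -E mem_nth.
split=> kr.
  split; first by have := @nth_find _ 0 (fun y => x < y) r; rewrite has_find; apply.
    by rewrite -drop_nth // cat_take_drop.
  apply: (@eq_from_nth _ 0).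
    rewrite size_set_nth size_cat /= size_take_min size_drop.
    by rewrite (minn_idPl (ltnW kr)) (maxn_idPr kr) addnS -addSn subnKC.
  move=> i _; rewrite nth_set_nth /= nth_cat size_take_min (minn_idPl (ltnW kr)).
  case: (ltngtP i k) => [ik|ki|->]; last by rewrite subnn.
    by rewrite nth_take.
  by rewrite -(subnSK ki) /= nth_drop addSn -addnS subnSK // subnKC // ltnW.
have -> : k = size r by apply/eqP; rewrite eqn_leq kr find_size.
rewrite take_size; split=> //.
by elim: (r) => //= y s ->.
Qed.

Lemma perm_rsk_insert x t : increasing_rows t -> uniq (x :: flatten t) ->
  perm_eq (flatten (rsk_insert x t)) (x :: flatten t).
Proof.
elim: t x => //= r t IHt x /and3P[/andP[sr st] /andP[r0 t0] hd].
rewrite mem_cat negb_or cat_uniq => /andP[/andP[xr xt] /and3P[ur urt ut]].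
have [_ [kl kg]] := insert_split sr xr; case: ltnP => k; last first.
  by have [_ ->] := kg k; rewrite cat_rcons perm_catC /= perm_cons perm_catC.
have [xy rE ->] := kl k; set y := nth 0 r _ in xy rE *.
have yr : y \in r by apply: mem_nth.
have hp : perm_eq (flatten (rsk_insert y t)) (y :: flatten t).
  apply: IHt; first by apply/and3P; split=> //; apply: path_sorted hd.
  rewrite /= ut andbT; apply: contraNN urt => yt; apply/hasP; by exists y.
rewrite [in X in perm_eq _ (x :: X ++ _)]rE.
apply/seq.permP => p; have := seq.permP hp p; rewrite /= !count_cat /= => ->.
by clear; lia.
Qed.

Lemma head_rsk_insert x t : increasing_rows t -> x \notin flatten t ->
  head 0 (head [::] (rsk_insert x t))
  = if t == [::] then x else minn x (head 0 (head [::] t)).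
Proof.
case: t => //= r t /and3P[/andP[sr _] /andP[r0 _] _].
rewrite mem_cat negb_or => /andP[xr _].
case: r sr r0 xr => //= y r _ _; rewrite inE negb_or => /andP[xy _].
by rewrite /minn; case: (ltnP x y).
Qed.

Lemma increasing_rows_rsk_insert x t : increasing_rows t -> uniq (x :: flatten t) ->
  increasing_rows (rsk_insert x t).
Proof.
elim: t x => //= r t IHt x irt; have /and3P[/andP[sr st] /andP[r0 t0] hd] := irt.
rewrite mem_cat negb_or cat_uniq => /andP[/andP[xr xt] /and3P[ur urt ut]].
have it : increasing_rows t by apply/and3P; split=> //; apply: path_sorted hd.
have [all_lt [kl kg]] := insert_split sr xr; case: ltnP => k; last first.
  have [tE ->] := kg k; rewrite tE in all_lt.
  apply/and3P; split; [apply/andP; split=> // | apply/andP; split=> // | ].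
  - rewrite -cats1 (sorted_pairwise ltn_trans) pairwise_cat -(sorted_pairwise ltn_trans) sr.
    by rewrite /= andbT; apply/allrelP => i j /(allP all_lt) /= ix; rewrite inE => /eqP->.
  - by rewrite -size_eq0 size_rcons.
  by case: (r) r0 hd => // z r' _; case: (t).
have [xy rE ->] := kl k; set y := nth 0 r _ in xy rE *.
have yr : y \in r by apply: mem_nth.
have yt : y \notin flatten t.
  by apply: contraNN urt => yt; apply/hasP; exists y.
have /and3P[s1 s2 s3] : increasing_rows (rsk_insert y t) by apply: IHt; rewrite /= ?yt.
have sr' := sr; rewrite rE in sr'.
apply/and3P; split; [apply/andP; split=> // | apply/andP; split=> // | ].
- move: sr'; rewrite !(sorted_pairwise ltn_trans) !pairwise_cat /=.
  move=> /and3P[h1 h2 /andP[h3 h4]]; rewrite h2 h4 !andbT /=.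
  apply/andP; split.
    apply/allrelP => i j ii; rewrite inE => /orP[/eqP->|jj].
      exact: (allP all_lt).
    by move/allrelP: h1; apply; rewrite // inE jj orbT.
  by apply: sub_all h3 => i; apply: ltn_trans.
- by rewrite -size_eq0 size_cat /= addnS.
suff lt : head 0 (take (find (fun y0 => x < y0) r) r
      ++ x :: drop (find (fun y0 => x < y0) r).+1 r)
    < head 0 (head [::] (rsk_insert y t)).
  by case: (rsk_insert y t) s3 lt => //= r1 t1 -> ->.
rewrite head_rsk_insert //.
set h := head 0 _.
have [hh hy] : h <= head 0 r /\ h < y.
  rewrite /h [in X in _ <= X]rE; case: (take _ r) sr' all_lt => [|a u] /=.
    by rewrite (ltnW xy) xy.
  by move=> _ /andP[ax _]; rewrite leqnn (ltn_trans ax xy).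
case: t hd {IHt irt st t0 xt urt ut it yt s1 s2 s3} => //= r' t /andP[hr _].
by rewrite leq_min hy (leq_ltn_trans hh hr).
Qed.

(** By [knuth_bump] the bumped letter comes out at the left of its row, which is the end of the
    reading word of the rows above, ready to be inserted there. *)
Lemma rsk_insert_knuth (G : pred (seq nat)) x t : knuth_closed G ->
    increasing_rows t -> uniq (x :: flatten t) ->
  equiv_in G (rcons (flatten (rev t)) x) (flatten (rev (rsk_insert x t))).
Proof.
move=> G_closed; elim: t x => [|r t IHt] x; first by move=> _ _; apply: equiv_refl.
rewrite /= => /and3P[/andP[sr st] /andP[r0 t0] hd].
rewrite mem_cat negb_or cat_uniq => /andP[/andP[xr xt] /and3P[ur urt ut]].
have it : increasing_rows t by apply/and3P; split=> //; apply: path_sorted hd.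
have [all_lt [kl kg]] := insert_split sr xr; case: ltnP => k; last first.
  have [_ ->] := kg k; rewrite !rev_cons !flatten_rcons -rcons_cat.
  exact: equiv_refl.
have [xy rE ->] := kl k; set y := nth 0 r _ in xy rE *.
have yr : y \in r by apply: mem_nth.
have yt : y \notin flatten t.
  by apply: contraNN urt => yt; apply/hasP; exists y.
rewrite !rev_cons !flatten_rcons rcons_cat.
have bump := knuth_bump (G := G) G_closed.
apply: (@equiv_trans _ (rcons (flatten (rev t)) y ++
    (take (find (fun y0 => x < y0) r) r ++ x :: drop (find (fun y0 => x < y0) r).+1 r))).
  rewrite cat_rcons; apply: equiv_catl; rewrite [in rcons r x]rE rcons_cat rcons_cons.
  by apply: bump => //; rewrite -rE.
by apply: equiv_catr; apply: IHt; rewrite //= yt.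
Qed.

Lemma rsk_P_knuth (G : pred (seq nat)) q : knuth_closed G -> uniq q ->
  [/\ increasing_rows (rsk_P q), perm_eq (flatten (rsk_P q)) q
    & G q = G (flatten (rev (rsk_P q)))].
Proof.
move=> G_closed uq.
suff: [/\ increasing_rows (rsk_P q), perm_eq (flatten (rsk_P q)) q
    & equiv_in G q (flatten (rev (rsk_P q)))].
  by case=> h1 h2 /(_ [::] [::]); rewrite !cats0.
elim/last_ind: q uq => [|q x IHq]; first by split=> //; apply: equiv_refl.
rewrite rcons_uniq => /andP[xq uq]; have [h1 h2 h3] := IHq uq.
have uxt : uniq (x :: flatten (rsk_P q)).
  by rewrite /= (perm_mem h2) xq (perm_uniq h2).
rewrite /rsk_P foldl_rcons -/(rsk_P q); split.
- exact: increasing_rows_rsk_insert.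
- apply: perm_trans (perm_rsk_insert h1 uxt) _.
  by rewrite perm_sym perm_rcons perm_cons perm_sym.
apply: equiv_trans (rsk_insert_knuth G_closed h1 uxt).
by rewrite -!cats1; apply: equiv_catr.
Qed.

Lemma map_inv_std v : [seq nth 0 v i | i <- inv_std v] = sort leq v.
Proof.
apply: (sorted_eq leq_trans anti_leq); last first.
- rewrite perm_sym perm_sort perm_sym -[X in perm_eq _ X](mkseq_nth 0).
  exact: perm_map (perm_inv_std v).
- exact: sort_sorted leq_total _.
rewrite sorted_map; apply: sub_sorted (sorted_inv_std v) => i j.
by rewrite /standard_lt /=; lia.
Qed.

Lemma sorted_constant_rows i la :
  sorted leq (flatten (constant_rows i la)) /\
  all (fun x => i <= x < i + size la) (flatten (constant_rows i la)).
Proof.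
elim: la i => //= a la IHla i; have [h1 h2] := IHla i.+1; split.
  rewrite (sorted_pairwise leq_trans) pairwise_cat -!(sorted_pairwise leq_trans) h1 andbT.
  apply/andP; split.
    by apply/allrelP => x y; rewrite mem_nseq => /andP[_ /eqP->] /(allP h2); lia.
  by elim: a => //= -[|a] //= ->; rewrite leqnn.
rewrite all_cat all_nseq; apply/andP; split; first by lia.
by apply: sub_all h2 => x; lia.
Qed.

Lemma pairwise_refines_rows beta t i la : {homo beta : x y / x <= y} ->
  all (sorted ltn) t -> map (map beta) t = constant_rows i la ->
  pairwise (refines_std beta) (flatten (rev t)).
Proof.
move=> bm; elim: t i la => [|r t IHt] i [|a la] //= /andP[sr st] [rE tE].
rewrite rev_cons flatten_rcons pairwise_cat (IHt i.+1 la) //=.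
apply/andP; split; last first.
  move: sr; rewrite (sorted_pairwise ltn_trans); apply: sub_pairwise => x y.
  by rewrite /refines_std => /ltnW->.
apply/allrelP => x y xt yr; rewrite /refines_std.
have -> : beta y = i.
  by have := map_f beta yr; rewrite rE mem_nseq => /andP[_ /eqP].
have : beta x \in flatten (constant_rows i.+1 la).
  rewrite -tE -map_flatten; apply: map_f.
  by have /perm_mem <- : perm_eq (flatten (rev t)) (flatten t)
    by apply: perm_flatten; rewrite perm_rev.
have [_ /allP h] := sorted_constant_rows i.+1 la.
by move=> /h /andP[-> _]; rewrite orbT.
Qed.

Section Blocks.
Variables (n : nat) (la : seq nat).
Hypothesis la_part : is_partition n la.

(* Beyond n the default value keeps this function nondecreasing. *)
Definition block (x : nat) : nat := nth (size la) (superstandard_word la) x.-1.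

Lemma size_superstandard_n : size (superstandard_word la) = n.
Proof. by have [_ _ <-] := is_partitionP la_part; rewrite size_superstandard. Qed.

Lemma block_mono : {homo block : x y / x <= y}.
Proof.
move=> x y xy; have [s b] := sorted_constant_rows 0 la.
have xy' : x.-1 <= y.-1 by lia.
rewrite /block; case: (ltnP y.-1 (size (superstandard_word la))) => yn.
  by apply: (sorted_leq_nth leq_trans leqnn); rewrite ?inE // (leq_ltn_trans xy').
rewrite [X in _ <= X]nth_default //.
case: (ltnP x.-1 (size (superstandard_word la))) => xn; last by rewrite nth_default.
by have /(all_nthP (size la))/(_ _ xn)/andP[_ /ltnW] := b.
Qed.

Lemma map_block : map block (iota 1 n) = superstandard_word la.
Proof.
apply: (@eq_from_nth _ (size la)); rewrite size_map size_iota ?size_superstandard_n //.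
by move=> i ilt; rewrite (nth_map 0) ?size_iota // nth_iota.
Qed.

(** By [lattice_rows] the i-th row of t consists of values whose block is i, so the content gives
    the shape la. As [block] is nondecreasing, the rows concatenated from the bottom increase and
    must be 1, ..., n. *)
Lemma lattice_blocks_rows t : increasing_rows t -> perm_eq (flatten t) (iota 1 n) ->
  lattice_blocks block (flatten (rev t)) = (t == U la).
Proof.
move=> /and3P[st t0 hd] tn; have [sla la1 sumla] := is_partitionP la_part.
have bm := block_mono.
apply/andP/eqP => [[pR lt]|tE].
  have rows : map (map block) t = constant_rows 0 (shape t).
    have -> : shape t = shape (map (map block) t).
      by rewrite /shape -map_comp; apply: eq_map => r /=; rewrite size_map.
    apply: (@lattice_rows 0 _ [::]) => //.
    - rewrite all_map; apply: sub_all st => r /=; rewrite sorted_map.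
      by apply: sub_sorted => x y /ltnW; apply: bm.
    - by rewrite all_map; apply: sub_all t0 => -[].
    - elim: (t) pR t0 hd => // r [|r' t'] // IHt pR /andP[r0 t0] /andP[hr hd].
      move: pR; rewrite rev_cons flatten_rcons pairwise_cat => /and3P[/allrelP h p1 _].
      apply/andP; split; last exact: IHt.
      case: r r' r0 t0 hr h {hd IHt p1} => // x r [|y r'] // _ _ /= xy h.
      have := h y x _ _; rewrite /refines_std leqNgt xy; apply; last exact: mem_head.
      by rewrite rev_cons flatten_rcons mem_cat mem_head orbT.
    - by rewrite orbT.
    by rewrite cats0 -map_rev -map_flatten.
  have szt : shape t = la.
    apply: positive_nth_inj => // [|i].
      by rewrite all_map; apply: sub_all t0 => r /=; rewrite lt0n size_eq0.
    rewrite -count_superstandard -(count_superstandard la) -map_block.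
    rewrite /superstandard_word -rows -map_flatten.
    by apply/seq.permP; apply: perm_map.
  have sf : sorted ltn (flatten t).
    elim: (t) (0) (shape t) st rows => [|r t' IHt] i [|a mu] //= /andP[sr st] [rE tE].
    rewrite (sorted_pairwise ltn_trans) pairwise_cat -!(sorted_pairwise ltn_trans) sr /=.
    rewrite (IHt i.+1 mu) // andbT; apply/allrelP => x y xr yt.
    have bx : block x = i by have := map_f block xr; rewrite rE mem_nseq => /andP[_ /eqP].
    have [_ /allP/(_ (block y))] := sorted_constant_rows i.+1 mu.
    rewrite -tE -map_flatten map_f // => /(_ isT)/andP[iy _].
    by rewrite ltnNge; apply/negP => /bm; rewrite bx leqNgt iy.
  have fE : flatten t = iota 1 n.
    apply: (irr_sorted_eq ltn_trans ltnn sf (iota_ltn_sorted _ _)).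
    exact: perm_mem tn.
  by rewrite /U sumla -fE -szt flattenK.
have sn : size (iota 1 n) = sumn la by rewrite size_iota.
have fE : flatten t = iota 1 n by rewrite tE /U sumla reshapeKr ?sn.
have rows : map (map block) t = constant_rows 0 la.
  have -> : map (map block) t = reshape la (map block (flatten t)).
    rewrite map_flatten -[in LHS](flattenK (map (map block) t)); congr (reshape _ _).
    rewrite /shape -map_comp (eq_map (g := size)) => [|r /=]; last by rewrite size_map.
    by rewrite -/(shape t) tE /U sumla reshapeKl ?sn.
  rewrite fE map_block; have := flattenK (constant_rows 0 la).
  by rewrite shape_constant_rows.
split; last first.
  rewrite map_flatten map_rev rows -[X in lattice X]cats0.
  exact: lattice_constant_rows.
exact: pairwise_refines_rows rows.
Qed.

Lemma SYam_lattice_blocks q : perm_eq q (iota 1 n) ->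
  SYam la q = lattice_blocks block q.
Proof.
move=> qn; have [sla la1 sumla] := is_partitionP la_part.
have uq : uniq q by rewrite (perm_uniq qn) iota_uniq.
have [ir pr ->] := rsk_P_knuth (lattice_blocks_knuth block_mono) uq.
by rewrite lattice_blocks_rows ?(perm_trans pr) // /SYam sumla qn.
Qed.

(** Weight and standardization determine a word, as they give its sorted letters and the places
    where they go; the only candidate here is [map block q]. *)
Lemma count_lattice_SYam q : perm_eq q (iota 1 n) ->
  count (fun v => (inv_std v == inv_std q) && lattice v)
    (permutations (superstandard_word la)) = SYam la q.
Proof.
move=> qn; have uq : uniq q by rewrite (perm_uniq qn) iota_uniq.
have bq : perm_eq (map block q) (superstandard_word la).
  by rewrite -map_block; apply: perm_map.
have sq : [seq nth 0 q i | i <- inv_std q] = iota 1 n.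
  rewrite map_inv_std; apply: (sorted_eq leq_trans anti_leq).
  - exact: sort_sorted leq_total _.
  - exact: iota_sorted.
  - by rewrite perm_sort.
rewrite SYam_lattice_blocks // (@eq_in_count _ _
  (fun v => (v == map block q) && lattice_blocks block q)); last first.
  move=> v; rewrite mem_permutations => vb.
  rewrite /lattice_blocks -(inv_std_map block_mono uq).
  apply/andP/andP => [[/eqP E lv]|[/eqP-> /andP[]]] //.
  suff vE : v = map block q by rewrite -vE E !eqxx.
  have sv : size v = size q.
    by rewrite (perm_size vb) size_superstandard_n (perm_size qn) size_iota.
  have vq : [seq nth 0 v i | i <- inv_std q] = [seq block (nth 0 q i) | i <- inv_std q].
    rewrite (map_comp block (nth 0 q)) sq map_block -E map_inv_std.
    apply: (sorted_eq leq_trans anti_leq).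
    - exact: sort_sorted leq_total _.
    - by have [] := sorted_constant_rows 0 la.
    - by rewrite perm_sort.
  apply: (@eq_from_nth _ 0); rewrite ?size_map // => i iv.
  rewrite (nth_map 0) -?sv //; have /eq_in_map := vq; apply.
  by rewrite mem_inv_std -sv.
case: (lattice_blocks _ _); last first.
  by rewrite (eq_count (a2 := pred0)) ?count_pred0 // => v; rewrite andbF.
rewrite (eq_count (a2 := pred1 (map block q))) => [|v]; last by rewrite andbT.
by rewrite count_uniq_mem ?permutations_uniq // mem_permutations bq.
Qed.
End Blocks.

(** * Fundamental quasisymmetric functions *)

Section WordsOfPermutations.
Variable n : nat.
Implicit Types p : 'S_n.

Lemma size_word p : size (word p) = n.
Proof. by rewrite size_map size_enum_ord. Qed.

Lemma nth_word p (k : 'I_n) : nth 0 (word p) k = (p k).+1.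
Proof. by rewrite (nth_map k) ?size_enum_ord // nth_ord_enum. Qed.

Lemma perm_word p : perm_eq (word p) (iota 1 n).
Proof.
rewrite /word (map_comp S (fun k => nat_of_ord (p k))) -[1]/(1 + 0) iotaDl.
apply: perm_map; rewrite -val_enum_ord (map_comp val p); apply: perm_map.
apply: uniq_perm; rewrite ?enum_uniq ?(map_inj_uniq perm_inj) ?enum_uniq // => i.
rewrite mem_enum; apply/mapP; exists (p^-1 i)%g; rewrite ?mem_enum //.
by rewrite permKV.
Qed.

Lemma word_inj : injective (@word n).
Proof.
move=> p p' E; apply/permP => k; apply/val_inj.
by have := nth_word p k; rewrite E nth_word => -[].
Qed.

Lemma word_surj q : perm_eq q (iota 1 n) -> exists p, word p = q.
Proof.
move=> qn; have sq : size q = n by rewrite (perm_size qn) size_iota.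
have uq : uniq q by rewrite (perm_uniq qn) iota_uniq.
have qk (k : 'I_n) : 0 < nth 0 q k <= n.
  have : nth 0 q k \in q by rewrite mem_nth ?sq.
  by rewrite (perm_mem qn) mem_iota add1n.
have lt (k : 'I_n) : (nth 0 q k).-1 < n by have := qk k; lia.
have f_inj : injective (fun k : 'I_n => Ordinal (lt k)).
  move=> i j /(congr1 val) /= E; apply/val_inj/eqP.
  have /andP[qi _] := qk i; have /andP[qj _] := qk j.
  have /eqP : nth 0 q i = nth 0 q j by rewrite -(prednK qi) E prednK.
  by rewrite nth_uniq ?sq.
exists (perm f_inj); apply: (@eq_from_nth _ 0); rewrite size_word ?sq // => i iN.
rewrite (nth_word _ (Ordinal iN)) permE /= prednK //.
by have /andP[] := qk (Ordinal iN).
Qed.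

Definition perm_of_word (q : seq nat) : 'S_n :=
  odflt 1%g [pick p | word p == q].

Lemma perm_of_wordK q : perm_eq q (iota 1 n) -> word (perm_of_word q) = q.
Proof.
move=> /word_surj[p pE]; rewrite /perm_of_word; case: pickP => [p' /eqP//|].
by move=> /(_ p); rewrite pE eqxx.
Qed.

(** For a permutation, [inv_std] is the one-line notation of its inverse, from 0. *)
Lemma index_inv_std_word p (k : 'I_n) : index (val k) (inv_std (word p)) = p k.
Proof.
have zn : (val k : nat) \in inv_std (word p) by rewrite mem_inv_std size_word ltn_ord.
have E := map_inv_std (word p).
have sE : sort leq (word p) = iota 1 n.
  apply: (sorted_eq leq_trans anti_leq).
  - exact: sort_sorted leq_total _.
  - exact: iota_sorted.
  - by rewrite perm_sort perm_word.
set i := index _ _; have iN : i < n.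
  by rewrite -index_mem in zn; rewrite (perm_size (perm_inv_std _)) size_iota size_word in zn.
have : nth 0 [seq nth 0 (word p) i | i <- inv_std (word p)] i = (p k).+1.
  rewrite (nth_map 0); last by rewrite (perm_size (perm_inv_std _)) size_iota size_word.
  by rewrite nth_index // nth_word.
by rewrite E sE nth_iota // add1n => -[].
Qed.

Lemma inv_std_word_inj p p' : inv_std (word p) = inv_std (word p') -> p = p'.
Proof.
by move=> E; apply/permP => k; apply/val_inj; rewrite /= -!index_inv_std_word E.
Qed.

Lemma inv_std_word_surj z : perm_eq z (iota 0 n) -> exists p, inv_std (word p) = z.
Proof.
move=> zn; have sz : size z = n by rewrite (perm_size zn) size_iota.
have uz : uniq z by rewrite (perm_uniq zn) iota_uniq.
have mz i : (i \in z) = (i < n) by rewrite (perm_mem zn) mem_iota.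
pose q := [seq (index k z).+1 | k <- iota 0 n].
have qn : perm_eq q (iota 1 n).
  rewrite /q (map_comp S) -[1]/(1 + 0) iotaDl; apply: perm_map.
  apply: (@perm_trans _ (map (index^~ z) z)); first by rewrite perm_map // perm_sym.
  suff -> : map (index^~ z) z = iota 0 n by [].
  apply: (@eq_from_nth _ 0); rewrite size_map sz ?size_iota // => i iN.
  by rewrite (nth_map 0) ?sz // index_uniq ?sz // nth_iota.
have [p pE] := word_surj qn; exists p; rewrite pE; apply: inv_stdE; last first.
  by move=> i; rewrite /q size_map size_iota mz mem_iota.
apply/(sortedP 0) => i; rewrite sz => iN.
have qz j : j < n -> nth 0 q (nth 0 z j) = j.+1.
  move=> jn; have zj : nth 0 z j < n by rewrite -mz mem_nth ?sz.
  by rewrite (nth_map 0) ?size_iota // nth_iota // index_uniq ?sz.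
by rewrite /standard_lt !qz ?(ltnW iN) // ltnS ltnSn.
Qed.

(** A monomial has a single weakly increasing rearrangement. *)
Lemma FE D m : F n D m = Posz ((size m == n) &&
  all (fun k => (nth 0 (sort leq m) k.-1 == nth 0 (sort leq m) k) ==> (k \notin D))
    (iota 1 n.-1)).
Proof.
rewrite /F /gen_series; congr Posz.
rewrite (@eq_in_count _ _ (fun j => (j == sort leq m) && ((size m == n) &&
  all (fun k => (nth 0 (sort leq m) k.-1 == nth 0 (sort leq m) k) ==> (k \notin D))
    (iota 1 n.-1)))); last first.
  move=> j; rewrite mem_permutations => jm.
  apply/and3P/andP => [[sj srt cj]|[/eqP-> /andP[sm cm]]]; last first.
    by rewrite size_sort; split=> //; apply: sort_sorted leq_total _.
  have jE : j = sort leq m.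
    apply: (sorted_eq leq_trans anti_leq) => //; first exact: sort_sorted leq_total _.
    by rewrite perm_sym perm_sort perm_sym.
  by rewrite -jE -(perm_size jm) sj cj.
case: ((size m == n) && all _ _); last first.
  by rewrite (eq_count (a2 := pred0)) ?count_pred0 // => v; rewrite andbF.
rewrite (eq_count (a2 := pred1 (sort leq m))) => [|v]; last by rewrite andbT.
by rewrite count_uniq_mem ?permutations_uniq // mem_permutations perm_sort perm_refl.
Qed.

Lemma mem_ID p k : (k \in ID p) =
  (0 < k < n) && (nth 0 (inv_std (word p)) k < nth 0 (inv_std (word p)) k.-1).
Proof.
rewrite /ID mem_filter mem_iota andbC.
have -> : (0 < k < 1 + n.-1) = (0 < k < n) by lia.
case: (boolP (0 < k < n)) => //= /andP[k0 kn].
have sz : size (inv_std (word p)) = n.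
  by rewrite (perm_size (perm_inv_std _)) size_iota size_word.
have wz i : i < n -> index i.+1 (word p) = nth 0 (inv_std (word p)) i.
  move=> iN; have zi : nth 0 (inv_std (word p)) i < n.
    by rewrite -[X in _ < X](size_word p) -mem_inv_std mem_nth ?sz.
  have uw : uniq (word p) by rewrite (perm_uniq (perm_word p)) iota_uniq.
  rewrite -[RHS](@index_uniq _ 0 _ (word p)) ?size_word //; congr index.
  rewrite (nth_word p (Ordinal zi)) -index_inv_std_word /= index_uniq ?sz //.
  by rewrite (perm_uniq (perm_inv_std _)) iota_uniq.
by rewrite wz // -{2}(prednK k0) wz // (leq_ltn_trans (leq_pred _)).
Qed.

Lemma F_ID p m : F n (ID p) m =
  gen_series (of_size n (fun v => inv_std v == inv_std (word p))) m.
Proof.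
have [sm|sm] := eqVneq (size m) n; last first.
  by rewrite FE (negPf sm) gen_series_of_size.
set z := inv_std (word p); set s := sort leq m.
have ss : size s = n by rewrite size_sort.
have sz : size z = n by rewrite (perm_size (perm_inv_std _)) size_iota size_word.
have mz i : (i \in z) = (i < n) by rewrite mem_inv_std size_word.
have uz : uniq z by rewrite (perm_uniq (perm_inv_std _)) iota_uniq.
(* The only candidate: the sorted letters of m are written at the positions listed by z. It
   standardizes to p exactly when equal letters stand at increasing positions. *)
pose v0 := [seq nth 0 s (index i z) | i <- iota 0 n].
have sv0 : size v0 = n by rewrite size_map size_iota.
have v0z i : i < n -> nth 0 v0 (nth 0 z i) = nth 0 s i.
  move=> iN; have zi : nth 0 z i < n by rewrite -mz mem_nth ?sz.
  by rewrite (nth_map 0) ?size_iota // nth_iota // index_uniq ?sz.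
have v0m : perm_eq v0 m.
  rewrite perm_sym -(perm_sort leq) perm_sym /v0 -/s.
  apply: (@perm_trans _ [seq nth 0 s (index i z) | i <- z]).
    by apply: perm_map; rewrite perm_sym -[X in iota 0 X](size_word p) perm_inv_std.
  suff -> : [seq nth 0 s (index i z) | i <- z] = s by [].
  apply: (@eq_from_nth _ 0); rewrite size_map sz ?ss // => i iN.
  by rewrite (nth_map 0) ?sz // index_uniq ?sz.
rewrite FE sm eqxx /gen_series /=; congr Posz.
rewrite (@eq_in_count _ _ (fun v => (v == v0) && (inv_std v0 == z))); last first.
  move=> v; rewrite mem_permutations => vm; rewrite /of_size (perm_size vm) sm eqxx /=.
  apply/eqP/andP => [E|[/eqP-> /eqP//]].
  suff vE : v = v0 by rewrite -vE E !eqxx.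
  apply: (@eq_from_nth _ 0); rewrite (perm_size vm) sm ?sv0 // => i iN.
  rewrite (nth_map 0) ?size_iota // nth_iota //= add0n /s.
  have -> : sort leq m = sort leq v.
    by apply/esym/(perm_sortP leq_total leq_trans anti_leq).
  by rewrite -map_inv_std E (nth_map 0) ?index_mem ?mz // nth_index ?mz.
suff -> : (inv_std v0 == z) = all (fun k => (nth 0 s k.-1 == nth 0 s k) ==> (k \notin ID p))
    (iota 1 n.-1).
  case: (all _ _); last first.
    by rewrite (eq_count (a2 := pred0)) ?count_pred0 // => v; rewrite andbF.
  rewrite (eq_count (a2 := pred1 v0)) => [|v]; last by rewrite andbT.
  by rewrite count_uniq_mem ?permutations_uniq // mem_permutations v0m.
have srt : sorted leq s by apply: sort_sorted leq_total _.
apply/eqP/allP => [E k|h].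
  rewrite mem_iota => kn; apply/implyP => /eqP sk; rewrite mem_ID; apply/negP => /andP[_ zk].
  have := sorted_inv_std v0; rewrite E => /(sortedP 0)/(_ k.-1).
  rewrite sz prednK; last by lia.
  by rewrite /standard_lt !v0z ?sk; rewrite -/z in zk; lia.
apply: inv_stdE; last by move=> i; rewrite sv0 mz mem_iota.
apply/(sortedP 0) => i; rewrite sz => iN; rewrite /standard_lt !v0z ?(ltnW iN) //.
have := (sortedP 0 srt) i; rewrite ss iN => /(_ isT).
rewrite leq_eqVlt => /orP[/eqP sE|->//].
have := h i.+1; rewrite mem_iota /= sE eqxx ltnn /= mem_ID -/z /= => hi.
have {hi} : ~~ ((i.+1 < n) && (nth 0 z i.+1 < nth 0 z i)) by apply: hi; lia.
rewrite iN /= -leqNgt leq_eqVlt nth_uniq ?sz ?(ltnW iN) // => /orP[/eqP|->//].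
by lia.
Qed.
End WordsOfPermutations.

Local Open Scope ring_scope.

Lemma count_by_standardization n (W : pred 'S_n) (G : pred (seq nat)) Q s :
    (forall p, G (inv_std (word p)) = W p) -> all (fun v => size v == n) s ->
  (count (fun v => G (inv_std v) && Q v) s)%:Z
  = \sum_(p | W p) (count (fun v => (inv_std v == inv_std (word p)) && Q v) s)%:Z.
Proof.
move=> GW; elim: s => [|v s IHs] /=; first by rewrite big1.
move=> /andP[/eqP sv /IHs ih]; rewrite PoszD ih.
under [RHS]eq_bigr do rewrite PoszD; rewrite big_split /=; congr (_ + _).
have [p0 p0E] := inv_std_word_surj (perm_inv_std v); rewrite sv in p0 p0E *.
rewrite -p0E GW big_mkcond (bigD1 p0) //= eqxx big1 ?addr0; first by case: (W p0).
move=> p pp0; case: (W p) => //; case: eqP => // /inv_std_word_inj E.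
by rewrite E eqxx in pp0.
Qed.

(** Passing to inverses turns a window of four values, on which h_i acts, into four consecutive
    letters. *)
Definition inv_words n (W : {set 'S_n}) : pred (seq nat) :=
  fun z => [exists p in W, inv_std (word p) == z].

Lemma inv_words_word n (W : {set 'S_n}) p : inv_words W (inv_std (word p)) = (p \in W).
Proof.
apply/existsP/idP => [[p' /andP[pW /eqP/inv_std_word_inj <-]]//|pW].
by exists p; rewrite pW eqxx.
Qed.

Lemma ID_series_gen n (G : pred (seq nat)) m :
  gen_series (of_size n (fun v => G (inv_std v))) m
  = \sum_(p : 'S_n | G (inv_std (word p))) F n (ID p) m.
Proof.
have [sm|sm] := eqVneq (size m) n; last first.
  by rewrite gen_series_of_size // big1 // => p _; rewrite F_ID gen_series_of_size.
under eq_bigr do rewrite F_ID /gen_series.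
have sv : all (fun v => size v == n) (permutations m).
  by apply/allP => v; rewrite mem_permutations => /perm_size->; rewrite sm.
have := @count_by_standardization n (fun p => G (inv_std (word p))) G predT _
  (fun p => erefl) sv.
rewrite /gen_series; under eq_count do rewrite andbT.
under [in X in _ = X]eq_bigr => p _ do under eq_count do rewrite andbT.
move=> E; rewrite -[LHS]/(Posz _) (eq_in_count (a2 := fun v => G (inv_std v))).
  rewrite E; apply: eq_bigr => p _; congr Posz; apply: eq_in_count => v.
  by move=> /(allP sv) /eqP vs; rewrite /of_size vs eqxx.
by move=> v /(allP sv) /eqP vs; rewrite /of_size vs eqxx.
Qed.

Lemma ID_series_inv_words n (W : {set 'S_n}) :
  ID_series W =1 gen_series (of_size n (fun v => inv_words W (inv_std v))).
Proof.
move=> m; rewrite ID_series_gen; apply: eq_bigl => p.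
by rewrite inv_words_word.
Qed.

Lemma closed_schur_expansion n (W : {set 'S_n}) :
    shifted_knuth_closed (inv_words W) -> adjacent_symmetric (ID_series W) ->
  ID_series W =1 fun m => \sum_(la : partition_of n)
    #|[set p in W | SYam (parts la) (word p)]|%:Z * schur (parts la) m.
Proof.
move=> Wc Ws m; rewrite ID_series_inv_words schur_expansion; last first.
- by move=> k m'; rewrite -!ID_series_inv_words.
- exact: raise_closed_inv_std.
apply: eq_bigr => la _; congr (_ * _).
have laP := part_bseqP la; have [_ _ sla] := is_partitionP laP.
rewrite -sum1_card (big_morph Posz PoszD (erefl (Posz 0))).
rewrite (@count_by_standardization n (mem W)) => [|p|]; last first.
- apply/allP => v; rewrite mem_permutations => /perm_size->.
  by rewrite size_superstandard sla.
- exact: inv_words_word.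
rewrite [RHS](eq_bigl (fun p => (p \in W) && SYam (parts la) (word p))); last first.
  by move=> p; rewrite inE.
rewrite big_mkcondr /=; apply: eq_bigr => p _.
by rewrite (count_lattice_SYam laP (perm_word p)); case: SYam.
Qed.

(** * The action of h_i on windows of inverse permutations *)

(** The inverse of the permutation [fl w]. When w is a window of the inverse of p, this is the
    pattern of p to which [h1] applies, see [filter_window]. *)
Definition window_pattern (w : seq nat) : seq nat :=
  [seq (index x w).+1 | x <- sort leq w].

Lemma fl_shift c w : fl (map (addn c) w) = fl w.
Proof.
rewrite /fl -map_comp; apply: eq_map => a /=; rewrite count_map; congr _.+1.
by apply: eq_count => b /=; rewrite ltn_add2l.
Qed.

Lemma fl_standard w : perm_eq w (iota 1 (size w)) -> fl w = w.
Proof.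
move=> ws; rewrite /fl -[RHS]map_id; apply/eq_in_map => a aw.
rewrite (seq.permP ws); move: aw; rewrite (perm_mem ws) mem_iota => /andP[a1 an].
have -> : size w = (a.-1 + (size w - a.-1))%N by lia.
rewrite iotaD count_cat (@eq_in_count _ _ predT) => [|b]; last by rewrite mem_iota /=; lia.
rewrite count_predT size_iota.
rewrite (@eq_in_count _ _ pred0) => [|b]; last by rewrite mem_iota /=; lia.
by rewrite count_pred0 addn0 prednK.
Qed.

Lemma perm_window_pattern w : uniq w ->
  perm_eq (window_pattern w) (iota 1 (size w)).
Proof.
move=> uw; rewrite /window_pattern (map_comp S) -[1%N]/(1 + 0)%N iotaDl; apply: perm_map.
apply: (@perm_trans _ (map (index^~ w) w)); first by rewrite perm_map // perm_sort.
suff -> : map (index^~ w) w = iota 0 (size w) by [].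
apply: (@eq_from_nth _ 0%N); rewrite size_map ?size_iota // => i iN.
by rewrite (nth_map 0%N) // index_uniq // nth_iota.
Qed.

Lemma size_window_pattern w : size (window_pattern w) = size w.
Proof. by rewrite size_map size_sort. Qed.

Lemma in_window_index n (p : 'S_n) al w be (k : 'I_n) :
    inv_std (word p) = al ++ w ++ be -> size w = 4%N ->
  in_window (size al).+1 (p k).+1 = (val k \in w).
Proof.
move=> E sw; rewrite /in_window -(index_inv_std_word p k) E.
have uz : uniq (al ++ w ++ be) by rewrite -E (perm_uniq (perm_inv_std _)) iota_uniq.
have kz : val k \in al ++ w ++ be by rewrite -E mem_inv_std size_word ltn_ord.
rewrite !index_cat; move: kz uz; rewrite !mem_cat !cat_uniq => kz.
case: ifP kz => [kal _|kal] /=.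
  move=> /and3P[_ /hasPn h _]; have /negbTE -> : val k \notin w.
    by apply: contraL kal => kw; apply: h; rewrite mem_cat kw.
  by move: kal; rewrite -index_mem /=; lia.
case: ifP => [kw _ _|kw _ _]; last by rewrite sw; lia.
by move: kw; rewrite -index_mem sw /=; lia.
Qed.

Lemma filter_window n (p : 'S_n) al w be :
    inv_std (word p) = al ++ w ++ be -> size w = 4%N ->
  fl (filter (in_window (size al).+1) (word p)) = window_pattern w.
Proof.
move=> E sw.
have uz : uniq (al ++ w ++ be) by rewrite -E (perm_uniq (perm_inv_std _)) iota_uniq.
have uw : uniq w by move: uz; rewrite !cat_uniq => /and3P[_ _ /and3P[]].
have wn k : k \in w -> (k < n)%N.
  by move=> kw; rewrite -(size_word p) -mem_inv_std E !mem_cat kw orbT.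
have -> : filter (in_window (size al).+1) (word p) = map (addn (size al)) (window_pattern w).
  have wE : word p = [seq (index k (al ++ w ++ be)).+1 | k <- iota 0 n].
    rewrite -E -val_enum_ord -[RHS]map_comp; apply: eq_map => k.
    by rewrite /comp index_inv_std_word.
  rewrite wE filter_map -map_comp.
  have -> : filter (preim (fun k => (index k (al ++ w ++ be)).+1) (in_window (size al).+1))
      (iota 0 n) = sort leq w.
    apply: (irr_sorted_eq ltn_trans ltnn).
    - exact: sorted_filter ltn_trans _ _ (iota_ltn_sorted _ _).
    - by rewrite ltn_sorted_uniq_leq sort_uniq uw sort_sorted //; apply: leq_total.
    move=> k; rewrite mem_filter mem_iota mem_sort add0n /=.
    case: (ltnP k n) => kn; last by rewrite andbF; apply/esym; apply: contraTF kn => /wn; lia.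
    by rewrite andbT -(in_window_index (Ordinal kn) E sw) -index_inv_std_word E.
  apply/eq_in_map => k; rewrite mem_sort => kw /=.
  rewrite addnS !index_cat kw ifF //.
  move: uz; rewrite cat_uniq => /and3P[_ /hasPn h _].
  by apply/negbTE/h; rewrite mem_cat kw.
rewrite fl_shift fl_standard // size_window_pattern; exact: perm_window_pattern.
Qed.

Lemma is_h_window n (p p' : 'S_n) al w w' be :
    inv_std (word p) = al ++ w ++ be -> inv_std (word p') = al ++ w' ++ be ->
    size w = 4%N -> perm_eq w' w -> window_pattern w' = h1 (window_pattern w) ->
  is_h (size al).+1 p p'.
Proof.
move=> E E' sw ww hw; have sw' : size w' = 4%N by rewrite (perm_size ww).
apply/andP; split; last by rewrite (filter_window E sw) (filter_window E' sw') hw.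
apply/forallP => k; apply/implyP; rewrite (in_window_index k E sw) => kw.
rewrite -val_eqE /= -!index_inv_std_word E E' !index_cat.
by rewrite (perm_mem ww) (negPf kw) sw sw'.
Qed.

Lemma union_closed_window n (C : {set 'S_n}) al w w' be :
    union_of_sde_classes C -> size w = 4%N -> perm_eq w' w ->
    window_pattern w' = h1 (window_pattern w) ->
  inv_words C (al ++ w ++ be) -> inv_words C (al ++ w' ++ be).
Proof.
move=> [A ->] sw ww hw /existsP[p /andP[/bigcupP[p0 p0A]]].
rewrite inE => p0p /eqP E.
have zn : perm_eq (al ++ w' ++ be) (iota 0 n).
  rewrite -[X in iota 0 X](size_word p) perm_sym -(permPl (perm_inv_std (word p))).
  by rewrite E perm_cat2l perm_cat2r perm_sym.
have [p' E'] := inv_std_word_surj zn.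
apply/existsP; exists p'; rewrite E' eqxx andbT; apply/bigcupP; exists p0 => //.
rewrite inE; apply: connect_trans p0p (connect1 _); apply/hasP.
exists (size al).+1; last exact: is_h_window E E' sw ww hw.
rewrite mem_iota add1n ltnS /=.
have := perm_size zn; rewrite !size_cat size_iota (perm_size ww) sw => <-.
by rewrite ltnS -addnBA // -[X in (X < _)%N]addn0 ltn_add2l.
Qed.

(** * Shifted dual equivalence on inverse words *)

Local Open Scope nat_scope.

Lemma window_pattern_map (f : nat -> nat) u :
  {mono f : x y / x <= y} -> window_pattern (map f u) = window_pattern u.
Proof.
move=> fm; have fi : injective f := incn_inj fm.
have E : sort leq (map f u) = map f (sort leq u).
  apply: (sorted_eq leq_trans anti_leq).
  - exact: sort_sorted leq_total _.
  - rewrite sorted_map; apply: sub_sorted (sort_sorted leq_total u) => x y.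
    by rewrite /= fm.
  - by rewrite perm_sort perm_map // perm_sym perm_sort.
rewrite /window_pattern E -map_comp.
by apply: eq_map => x /=; rewrite index_map.
Qed.

Section UnionOfClasses.
Variables (n : nat) (C : {set 'S_n}).
Hypothesis C_union : union_of_sde_classes C.

(** Reduces a move to a computation on concrete patterns in 0, 1, 2, 3. The default s3 + i merely
    keeps f increasing beyond 3. *)
Lemma union_closed_pattern (s0 s1 s2 s3 : nat) u u' al be :
    s0 < s1 -> s1 < s2 -> s2 < s3 -> size u = 4 -> perm_eq u' u ->
    window_pattern u' = h1 (window_pattern u) ->
    window_pattern u = h1 (window_pattern u') ->
    let f i := nth (s3 + i) [:: s0; s1; s2; s3] i in
  inv_words C (al ++ map f u ++ be) = inv_words C (al ++ map f u' ++ be).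
Proof.
move=> s01 s12 s23 su uu hu hu' f.
have fm : {mono f : x y / x <= y}.
  apply: leq_mono => i j; rewrite /f.
  by case: i => [|[|[|[|i]]]]; case: j => [|[|[|[|j]]]] /=; rewrite ?nth_nil; lia.
by apply/idP/idP; apply: union_closed_window; rewrite // ?size_map ?(perm_size uu) //
  ?window_pattern_map // perm_map // perm_sym.
Qed.

(** The first shifted Knuth move with complemented letters, the effect on inverses of reversing
    permutations. The three places of w among the other letters give three patterns. *)
Lemma union_closed_rev1 al be a x y w :
    y < x -> x < a -> w < a -> w != x -> w != y ->
  inv_words C (al ++ [:: x; y; a; w] ++ be) = inv_words C (al ++ [:: x; a; y; w] ++ be).
Proof.
move=> yx xa wa /eqP wx /eqP wy; case: (ltngtP w y) => [h|h|] //.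
  exact: (@union_closed_pattern w y x a [:: 2; 1; 3; 0] [:: 2; 3; 1; 0]).
case: (ltngtP w x) => [h'|h'|] //.
  exact: (@union_closed_pattern y w x a [:: 2; 0; 3; 1] [:: 2; 3; 0; 1]).
exact: (@union_closed_pattern y x w a [:: 1; 0; 3; 2] [:: 1; 3; 0; 2]).
Qed.

Lemma union_closed_rev2 al be a b y w :
    y < b -> b < a -> w < b -> w != y ->
  inv_words C (al ++ [:: y; a; b; w] ++ be) = inv_words C (al ++ [:: a; y; b; w] ++ be).
Proof.
move=> yb ba wb /eqP wy; case: (ltngtP w y) => [h|h|] //.
  exact: (@union_closed_pattern w y b a [:: 1; 3; 2; 0] [:: 3; 1; 2; 0]).
exact: (@union_closed_pattern y w b a [:: 0; 3; 2; 1] [:: 3; 0; 2; 1]).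
Qed.

(** The flip of permutations complements and also reverses their inverses, so the fourth letter now
    comes first. *)
Lemma union_closed_flip1 al be a x y w :
    y < x -> x < a -> w < a -> w != x -> w != y ->
  inv_words C (al ++ [:: w; a; y; x] ++ be) = inv_words C (al ++ [:: w; y; a; x] ++ be).
Proof.
move=> yx xa wa /eqP wx /eqP wy; case: (ltngtP w y) => [h|h|] //.
  exact: (@union_closed_pattern w y x a [:: 0; 3; 1; 2] [:: 0; 1; 3; 2]).
case: (ltngtP w x) => [h'|h'|] //.
  exact: (@union_closed_pattern y w x a [:: 1; 3; 0; 2] [:: 1; 0; 3; 2]).
exact: (@union_closed_pattern y x w a [:: 2; 3; 0; 1] [:: 2; 0; 3; 1]).
Qed.

Lemma union_closed_flip2 al be a b y w :
    y < b -> b < a -> w < b -> w != y ->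
  inv_words C (al ++ [:: w; b; a; y] ++ be) = inv_words C (al ++ [:: w; b; y; a] ++ be).
Proof.
move=> yb ba wb /eqP wy; case: (ltngtP w y) => [h|h|] //.
  exact: (@union_closed_pattern w y b a [:: 0; 2; 3; 1] [:: 0; 2; 1; 3]).
exact: (@union_closed_pattern y w b a [:: 1; 2; 3; 0] [:: 1; 2; 0; 3]).
Qed.
End UnionOfClasses.

(** Without repeated letters there are no ties, whose order would be changed by reversal. *)
Lemma inv_std_rev v : uniq v ->
  inv_std (rev v) = [seq (size v).-1 - i | i <- inv_std v].
Proof.
move=> uv; apply: inv_stdE; last first.
  move=> i; rewrite size_rev mem_iota add0n /=; apply/mapP/idP => [[j]|iv].
    by rewrite mem_inv_std /= => jv ->; lia.
  exists ((size v).-1 - i); first by rewrite mem_inv_std; move: iv => /=; lia.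
  by move: iv => /=; lia.
rewrite sorted_map; apply: (@sub_in_sorted _ (fun i => i < size v) (standard_lt v)).
- move=> i j iv jv; have {}iv : i < size v := iv; have {}jv : j < size v := jv.
  have [i1 j1] : (size v).-1 - i < size v /\ (size v).-1 - j < size v by lia.
  rewrite /standard_lt /= !nth_rev //.
  have -> : size v - ((size v).-1 - i).+1 = i by lia.
  have -> : size v - ((size v).-1 - j).+1 = j by lia.
  rewrite nth_uniq //; case: (i =P j) => [->|_] /=; last by rewrite !orbF.
  by rewrite !ltnn.
- by apply/allP => i; rewrite mem_inv_std.
exact: sorted_inv_std.
Qed.

(** Repeated letters are allowed here: reversing letters and positions together reverses the whole
    order [standard_lt], ties included. *)
Lemma inv_std_flip M v : all (fun x => x <= M) v ->
  inv_std (rev (map (subn M) v)) = rev [seq (size v).-1 - i | i <- inv_std v].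
Proof.
move=> /allP vM; apply: inv_stdE; last first.
  move=> i; rewrite size_rev size_map mem_rev mem_iota add0n /=; apply/mapP/idP => [[j]|iv].
    by rewrite mem_inv_std /= => jv ->; lia.
  exists ((size v).-1 - i); first by rewrite mem_inv_std; move: iv => /=; lia.
  by move: iv => /=; lia.
rewrite rev_sorted sorted_map.
apply: (@sub_in_sorted _ (fun i => i < size v) (standard_lt v)).
- move=> i j iv jv; have {}iv : i < size v := iv; have {}jv : j < size v := jv.
  have := vM _ (mem_nth 0 iv); have := vM _ (mem_nth 0 jv).
  have [i1 j1] : (size v).-1 - i < size v /\ (size v).-1 - j < size v by lia.
  rewrite /standard_lt /= !nth_rev ?size_map //.
  have -> : size v - ((size v).-1 - i).+1 = i by lia.
  have -> : size v - ((size v).-1 - j).+1 = j by lia.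
  by rewrite !(nth_map 0) //; move: (nth 0 v i) (nth 0 v j); clear -iv jv; lia.
- by apply/allP => i; rewrite mem_inv_std.
exact: sorted_inv_std.
Qed.

Lemma perm_subn_iota n : perm_eq (map (subn n.+1) (iota 1 n)) (iota 1 n).
Proof.
apply: uniq_perm; rewrite ?iota_uniq //.
  rewrite map_inj_in_uniq ?iota_uniq // => i j; rewrite !mem_iota; lia.
move=> i; rewrite mem_iota; apply/mapP/idP => [[j]|h].
  by rewrite mem_iota => h ->; lia.
by exists (n.+1 - i); rewrite ?mem_iota; lia.
Qed.

(** * Transport of sets of permutations by reversal and flip *)

Section WordTransform.
Variables (n : nat) (t phi : seq nat -> seq nat).
Hypothesis t_inj : forall p p' : 'S_n, t (word p) = t (word p') -> p = p'.
Hypothesis t_perm : forall p : 'S_n, perm_eq (t (word p)) (iota 1 n).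
Hypothesis phi_inv_std : forall p : 'S_n,
  inv_std (t (word p)) = phi (inv_std (word p)).
Hypothesis phi_perm : forall z, perm_eq z (iota 0 n) -> perm_eq (phi z) (iota 0 n).
Hypothesis phiK : forall z, perm_eq z (iota 0 n) -> phi (phi z) = z.

Definition transform (p : 'S_n) : 'S_n := perm_of_word n (t (word p)).

Lemma word_transform p : word (transform p) = t (word p).
Proof. exact: perm_of_wordK. Qed.

Lemma transform_inj : injective transform.
Proof. by move=> p p' /(congr1 (@word n)); rewrite !word_transform => /t_inj. Qed.

Lemma inv_words_transform (C : {set 'S_n}) z :
  inv_words (transform @: C) z = perm_eq z (iota 0 n) && inv_words C (phi z).
Proof.
apply/existsP/andP => [[p' /andP[/imsetP[p pC ->] /eqP <-]]|[zn /existsP[p /andP[pC /eqP pE]]]].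
  have zp := perm_inv_std (word p); rewrite size_word in zp.
  rewrite word_transform phi_inv_std phiK // phi_perm //; split=> //.
  by apply/existsP; exists p; rewrite pC eqxx.
exists (transform p); rewrite imset_f //= word_transform phi_inv_std pE.
by rewrite phiK.
Qed.

Lemma ID_series_transform (C : {set 'S_n}) m :
  ID_series (transform @: C) m = (\sum_(p in C) F n (ID (transform p)) m)%R.
Proof. by rewrite /ID_series big_imset // => p p' _ _; apply: transform_inj. Qed.

Lemma card_transform (C : {set 'S_n}) (P : pred (seq nat)) :
  #|[set p in transform @: C | P (word p)]| = #|[set p in C | P (t (word p))]|.
Proof.
rewrite -[RHS](card_imset _ transform_inj); congr #|pred_of_set _|.
apply/setP => p'; rewrite inE; apply/andP/imsetP => [[/imsetP[p pC ->] h]|[p + ->]].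
  by exists p; rewrite // inE pC -word_transform.
by rewrite inE word_transform => /andP[pC ->]; rewrite imset_f.
Qed.
End WordTransform.

Definition rev_perm n : 'S_n -> 'S_n := transform rev.
Definition flip_seq n (q : seq nat) : seq nat := rev (map (subn n.+1) q).
Definition flip_perm n : 'S_n -> 'S_n := transform (flip_seq n).

Section RevFlip.
Variable n : nat.
Implicit Types (p : 'S_n) (C : {set 'S_n}).

Let rev_phi (z : seq nat) := [seq n.-1 - i | i <- z].
Let flip_phi (z : seq nat) := rev (rev_phi z).

Lemma rev_phi_perm z : perm_eq z (iota 0 n) -> perm_eq (rev_phi z) (iota 0 n).
Proof.
move=> zn; apply: perm_trans (perm_map _ zn) _.
apply: uniq_perm; rewrite ?iota_uniq //.
  rewrite map_inj_in_uniq ?iota_uniq // => i j; rewrite !mem_iota; lia.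
move=> i; rewrite mem_iota; apply/mapP/idP => [[j]|h].
  by rewrite mem_iota => h ->; lia.
by exists (n.-1 - i); rewrite ?mem_iota; lia.
Qed.

Lemma rev_phiK z : perm_eq z (iota 0 n) -> rev_phi (rev_phi z) = z.
Proof.
move=> zn; rewrite /rev_phi -map_comp map_id_in // => i.
by rewrite (perm_mem zn) mem_iota /=; lia.
Qed.

Lemma rev_phi_word p : inv_std (rev (word p)) = rev_phi (inv_std (word p)).
Proof. by rewrite inv_std_rev ?(perm_uniq (perm_word p)) ?iota_uniq // size_word. Qed.

Lemma flip_phi_word p :
  inv_std (rev (map (subn n.+1) (word p))) = flip_phi (inv_std (word p)).
Proof.
rewrite inv_std_flip ?size_word //; apply/allP => x.
by rewrite (perm_mem (perm_word p)) mem_iota; lia.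
Qed.

Lemma flip_phi_perm z : perm_eq z (iota 0 n) -> perm_eq (flip_phi z) (iota 0 n).
Proof. by move=> zn; rewrite /flip_phi perm_rev rev_phi_perm. Qed.

Lemma flip_phiK z : perm_eq z (iota 0 n) -> flip_phi (flip_phi z) = z.
Proof. by move=> zn; rewrite /flip_phi /rev_phi map_rev revK; apply: rev_phiK. Qed.

Lemma rev_word_perm p : perm_eq (rev (word p)) (iota 1 n).
Proof. by rewrite perm_rev perm_word. Qed.

Lemma flip_word_perm p : perm_eq (rev (map (subn n.+1) (word p))) (iota 1 n).
Proof.
rewrite perm_rev; apply: perm_trans (perm_map _ (perm_word p)) _.
exact: perm_subn_iota.
Qed.

Lemma rev_word_inj p p' : rev (word p) = rev (word p') -> p = p'.
Proof. by move=> /(can_inj revK)/word_inj. Qed.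

Lemma flip_word_inj p p' : rev (map (subn n.+1) (word p))
  = rev (map (subn n.+1) (word p')) -> p = p'.
Proof.
move=> /(can_inj revK) E; apply: word_inj.
have K (p0 : 'S_n) : map (subn n.+1) (map (subn n.+1) (word p0)) = word p0.
  rewrite -map_comp map_id_in // => i.
  by rewrite (perm_mem (perm_word p0)) mem_iota /=; lia.
by rewrite -K E K.
Qed.

Lemma word_rev_perm p : word (rev_perm p) = rev_word p.
Proof. exact: word_transform rev_word_perm p. Qed.

Lemma word_flip_perm p : word (flip_perm p) = flip_word p.
Proof.
rewrite (@word_transform n (flip_seq n) flip_word_perm p) /flip_word /rev_word map_rev.
by congr rev.
Qed.

Lemma perm_eq_window (al w w' be : seq nat) (N : seq nat) : perm_eq w w' ->
  perm_eq (al ++ w ++ be) N = perm_eq (al ++ w' ++ be) N.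
Proof.
move=> ww; suff /permPl-> : perm_eq (al ++ w ++ be) (al ++ w' ++ be) by [].
by rewrite perm_cat2l perm_cat2r.
Qed.

Lemma window_letters al w be i : perm_eq (al ++ w ++ be) (iota 0 n) -> i \in w -> i < n.
Proof.
by move=> /perm_mem/(_ i); rewrite mem_iota !mem_cat /= => <- ->; rewrite orbT.
Qed.

Lemma rev_union_closed C : union_of_sde_classes C ->
  shifted_knuth_closed (inv_words (@rev_perm n @: C)).
Proof.
move=> hC.
have E z := inv_words_transform rev_word_perm rev_phi_word rev_phi_perm rev_phiK C z.
split=> al be a.
  move=> x y w ax xy aw wx wy; rewrite !E.
  rewrite (@perm_eq_window _ [:: x; a; y; w] [:: x; y; a; w]); last first.
    by apply/seq.permP => P /=; clear; lia.
  case zn: (perm_eq _ _) => //; rewrite !andTb; have lt := window_letters zn.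
  have xn : x < n by apply: lt; rewrite !inE eqxx.
  have yn : y < n by apply: lt; rewrite !inE eqxx orbT.
  have wn : w < n by apply: lt; rewrite !inE eqxx !orbT.
  rewrite /rev_phi !map_cat; apply: (union_closed_rev1 hC); lia.
move=> b y w ab bY bw wy; rewrite !E.
rewrite (@perm_eq_window _ [:: a; y; b; w] [:: y; a; b; w]); last first.
  by apply/seq.permP => P /=; clear; lia.
case zn: (perm_eq _ _) => //; rewrite !andTb; have lt := window_letters zn.
have yn : y < n by apply: lt; rewrite !inE eqxx.
have wn : w < n by apply: lt; rewrite !inE eqxx !orbT.
rewrite /rev_phi !map_cat; apply: (union_closed_rev2 hC); lia.
Qed.

Lemma flip_union_closed C : union_of_sde_classes C ->
  shifted_knuth_closed (inv_words (@flip_perm n @: C)).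
Proof.
move=> hC.
have E z := @inv_words_transform n (flip_seq n) _ flip_word_perm flip_phi_word
  flip_phi_perm flip_phiK C z.
split=> al be a.
  move=> x y w ax xy aw wx wy; rewrite !E.
  rewrite (@perm_eq_window _ [:: x; a; y; w] [:: x; y; a; w]); last first.
    by apply/seq.permP => P /=; clear; lia.
  case zn: (perm_eq _ _) => //; rewrite !andTb; have lt := window_letters zn.
  have xn : x < n by apply: lt; rewrite !inE eqxx.
  have yn : y < n by apply: lt; rewrite !inE eqxx orbT.
  have wn : w < n by apply: lt; rewrite !inE eqxx !orbT.
  rewrite /flip_phi /rev_phi !map_cat !rev_cat -!catA.
  apply: (union_closed_flip1 hC); lia.
move=> b y w ab bY bw wy; rewrite !E.
rewrite (@perm_eq_window _ [:: a; y; b; w] [:: y; a; b; w]); last first.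
  by apply/seq.permP => P /=; clear; lia.
case zn: (perm_eq _ _) => //; rewrite !andTb; have lt := window_letters zn.
have yn : y < n by apply: lt; rewrite !inE eqxx.
have wn : w < n by apply: lt; rewrite !inE eqxx !orbT.
rewrite /flip_phi /rev_phi !map_cat !rev_cat -!catA.
apply: (union_closed_flip2 hC); lia.
Qed.

(** Infinitely many variables cannot be reversed; fixing those above M gives a bijection of all
    letters that reverses the ones occurring in a given monomial. *)
Definition reverse_letters (M x : nat) : nat := if x <= M then M - x else x.

Lemma reverse_lettersK M : involutive (reverse_letters M).
Proof. by move=> x; rewrite /reverse_letters; case: (leqP x M) => h; case: leqP; lia. Qed.

Lemma F_flip p m :
  F n (ID (flip_perm p)) m = F n (ID p) (map (reverse_letters (sumn m)) m).
Proof.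
pose M := sumn m; pose s := reverse_letters M.
rewrite !F_ID word_flip_perm.
have -> : flip_word p = rev (map (subn n.+1) (word p)).
  by rewrite /flip_word /rev_word map_rev.
rewrite flip_phi_word -/M -/s.
have zp := perm_inv_std (word p); rewrite size_word in zp.
have sK v : map s (map s v) = v.
  by rewrite -map_comp map_id_in // => x _ /=; apply: reverse_lettersK.
apply: (@gen_series_reindex _ _ (fun v => rev (map s v)) (fun v => rev (map s v))) => v vm.
  split; [by rewrite perm_rev perm_map | by rewrite map_rev revK sK | ].
  rewrite /of_size size_rev size_map; case: eqP => //= sv.
  have vM : all (fun x => x <= M) v.
    by apply/allP => x; rewrite (perm_mem vm) => /leq_sumn.
  have -> : map s v = map (subn M) v.
    by apply/eq_in_map => x /(allP vM) xM; rewrite /s /reverse_letters xM.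
  rewrite inv_std_flip // sv -/(rev_phi _) -/(flip_phi _).
  have zv := perm_inv_std v; rewrite sv in zv.
  by apply/eqP/eqP => [<-|->]; rewrite flip_phiK.
split; last by rewrite map_rev revK sK.
by rewrite perm_rev -[X in perm_eq _ X](sK m) perm_map.
Qed.
End RevFlip.

(** * Complementing descent sets *)

Local Open Scope ring_scope.

Lemma mem_ID_rev n (p : 'S_n) k :
  (k \in ID (rev_perm p)) = (0 < k < n)%N && (k \notin ID p).
Proof.
rewrite !mem_ID word_rev_perm /rev_word rev_phi_word.
case: (boolP (0 < k < n)%N) => //= /andP[k0 kn].
have sz : size (inv_std (word p)) = n.
  by rewrite (perm_size (perm_inv_std _)) size_iota size_word.
have zn i : (i < n)%N -> (nth 0 (inv_std (word p)) i < n)%N.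
  by move=> iN; rewrite -[X in (_ < X)%N](size_word p) -mem_inv_std mem_nth ?sz.
have uz : uniq (inv_std (word p)) by rewrite (perm_uniq (perm_inv_std _)) iota_uniq.
have k1n : (k.-1 < n)%N by apply: leq_ltn_trans (leq_pred _) kn.
have := zn _ kn; have := zn _ k1n.
have : nth 0 (inv_std (word p)) k != nth 0 (inv_std (word p)) k.-1.
  by rewrite nth_uniq ?sz //; lia.
rewrite !(nth_map 0%N) ?sz //.
by move: (nth _ _ _) (nth _ _ _) => a b; clear -k0; lia.
Qed.

Lemma eq_F n D D' m : D =i D' -> F n D m = F n D' m.
Proof.
move=> DD; rewrite !FE; congr (Posz (nat_of_bool (_ && _))).
by apply: eq_all => k; rewrite DD.
Qed.

Section Omega.
Variable n : nat.
Implicit Types (p : 'S_n) (E : {set 'I_n}) (c : 'S_n -> int).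

Definition ID_set p : {set 'I_n} := [set i | val i \in ID p].

(** By induction on the size of E, the contributions of the proper subsets vanish. *)
Lemma moebius c : (forall E, \sum_(p | ID_set p \subset E) c p = 0) ->
  forall E, \sum_(p | ID_set p == E) c p = 0.
Proof.
move=> h E; have [k] := ubnP #|E|; elim: k E => // k IHk E Ek.
have := h E; rewrite (partition_big ID_set (fun E' => E' \subset E)) //=.
rewrite (bigD1 E) //= [X in _ + X = _]big1 => [|E' /andP[sE nE]].
  rewrite addr0 => hE; rewrite -[RHS]hE; apply: eq_bigl => p /=.
  by case: eqP => [->|]; rewrite ?subxx ?andbF.
rewrite (eq_bigl (fun p => ID_set p == E')) => [|p]; last first.
  by case: eqP => [->|]; rewrite ?sE ?andbF.
apply: IHk; apply: leq_trans (proper_card _) Ek.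
by rewrite properEneq nE.
Qed.

(* The word of the monomial x_0^(a_0) x_1^(a_1) ... whose exponents are the
   lengths of the blocks cut out by E. *)
Definition block_word E : seq nat :=
  [seq count (fun e => [exists i in E, val i == e]) (iota 1 k) | k <- iota 0 n].

(** The word increases between its k-th and its next letter exactly when k is in E, so descents are
    forbidden elsewhere. *)
Lemma F_block_word p E : F n (ID p) (block_word E) = (ID_set p \subset E)%:Z.
Proof.
have sb : size (block_word E) = n by rewrite size_map size_iota.
pose memE e := [exists i in E, val i == e].
have nb k : (0 < k < n)%N ->
    nth 0 (block_word E) k = (nth 0 (block_word E) k.-1 + memE k)%N.
  move=> kn; rewrite !(nth_map 0%N) ?size_iota; try lia.
  rewrite !nth_iota; try lia.
  have -> : (0 + k = k.-1 + 1)%N by lia.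
  rewrite iotaD count_cat /= add0n addn0 -/(memE _); congr (_ + nat_of_bool (memE _))%N; lia.
have srt : sorted leq (block_word E).
  apply/(sortedP 0%N) => i; rewrite sb => iN.
  by rewrite (nb i.+1) // leq_addr.
rewrite FE sb eqxx (sorted_sort leq_trans srt) /=; congr (Posz (nat_of_bool _)).
apply/allP/subsetP => [h i|h k].
  rewrite inE /= => ip; have kn : (0 < i < n)%N by move: ip; rewrite mem_ID => /andP[].
  have := h i; rewrite mem_iota (nb _ kn) ip.
  case: (boolP (memE i)) => [/existsP[j /andP[jE /eqP/val_inj <-]] //|_].
  by rewrite addn0 eqxx /= => /(_ ltac:(lia)).
rewrite mem_iota => kn; have kn' : (0 < k < n)%N by lia.
rewrite (nb _ kn'); apply/implyP => /eqP Ek; apply/negP => kp.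
have {Ek} : ~~ memE k by apply/negP => hk; move: Ek; rewrite hk; lia.
case/existsP; have kN : (k < n)%N by lia.
exists (Ordinal kN) => /=; rewrite eqxx andbT; apply: h.
by rewrite inE.
Qed.

(* The fundamental quasisymmetric functions are linearly independent, so
   complementing the descent sets is well defined on their combinations. *)
Lemma complement_ID_eq0 c : (forall m, \sum_p c p * F n (ID p) m = 0) ->
  forall m, \sum_p c p * F n (ID (rev_perm p)) m = 0.
Proof.
move=> h m; rewrite (partition_big ID_set predT) //= big1 // => E _.
case: (pickP (fun p => ID_set p == E)) => [p0 /eqP p0E|none]; last first.
  by rewrite big_pred0.
rewrite (eq_bigr (fun p => c p * F n (ID (rev_perm p0)) m)) => [|p /eqP pE].
  rewrite -mulr_suml moebius ?mul0r // => E'.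
  rewrite big_mkcond -[RHS](h (block_word E')); apply: eq_bigr => p _.
  by rewrite F_block_word; case: (_ \subset _); rewrite ?mulr1 ?mulr0.
congr (_ * _); apply: eq_F => k; rewrite !mem_ID_rev.
case: (boolP (0 < k < n)%N) => //= /andP[_ kn].
have /setP/(_ (Ordinal kn)) : ID_set p = ID_set p0 by rewrite pE p0E.
by rewrite !inE /= => ->.
Qed.
End Omega.

(** * Conjugate shapes and transposed tableaux *)

Section Conjugate.
Variable la : seq nat.
Hypothesis la_sorted : sorted geq la.

(** The rows longer than c are an initial segment of the rows, since la is nonincreasing; their
    number is the c-th part of the conjugate. *)
Lemma conj_cell r c : (r < nth 0 (conj_part la) c)%N = (c < nth 0 la r)%N.
Proof.
have -> : nth 0%N (conj_part la) c = count (fun x => c < x)%N la.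
  rewrite /conj_part; case: (ltnP c (head 0 la)%N) => ch.
    by rewrite (nth_map 0%N) ?size_iota // nth_iota.
  rewrite nth_default ?size_map ?size_iota //; apply/esym/eqP.
  rewrite -leqn0 leqNgt -has_count; apply/hasPn => x xl; rewrite -leqNgt.
  by apply: leq_trans ch; rewrite -nth0 -(nth_index 0%N xl) part_geq.
elim: la la_sorted r => [|a l IHl] sl r; first by rewrite nth_nil !ltn0.
have IH := IHl (path_sorted sl).
rewrite /=; case: (ltnP c a) => ca.
  by case: r => [|r] /=; [rewrite ca add1n | rewrite add1n ltnS IH].
have h0 : (c < nth 0 l 0)%N = false.
  apply/negbTE; rewrite -leqNgt; apply: leq_trans ca.
  by case: (l) sl => //= b l' /andP[].
have l0 : count (fun x => c < x)%N l = 0%N.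
  by apply/eqP; rewrite -leqn0 leqNgt IH h0.
rewrite add0n l0 ltn0; case: r => [|r] /=; first by rewrite ltnNge ca.
by rewrite -IH l0 ltn0.
Qed.

Lemma sorted_conj_part : sorted geq (conj_part la).
Proof.
apply/(sortedP 0%N) => i _ /=; rewrite leqNgt conj_cell.
apply/negP => h; have : (i < nth 0 la (nth 0 (conj_part la) i))%N by apply: ltnW.
by rewrite -conj_cell ltnn.
Qed.

Lemma sumn_conj_part : sumn (conj_part la) = sumn la.
Proof.
suff key (l : seq nat) H : all (fun x => x <= H)%N l ->
    sumn [seq count (fun x => i < x)%N l | i <- iota 0 H] = sumn l.
  apply: key; apply/allP => x xl.
  by rewrite -nth0 -(nth_index 0%N xl) part_geq.
elim: l => [|a l IHl] /=; first by move=> _; elim: (iota 0 H).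
move=> /andP[aH /IHl <-].
have aE : a = sumn [seq (i < a)%N : nat | i <- iota 0 H].
  rewrite -[in LHS](size_iota 0 a) -count_predT sumnE big_map.
  have -> : H = (a + (H - a))%N by rewrite subnKC.
  rewrite iotaD big_cat /= [X in (_ + X)%N]big1_seq => [|i].
    rewrite addn0 -sum1_count big_seq [RHS]big_seq; apply: eq_bigr => i.
    by rewrite mem_iota => /andP[_ ->].
  by rewrite mem_iota add0n /= => /andP[ai _]; rewrite ltnNge ai.
rewrite [X in _ = (X + _)%N]aE; elim: (iota 0 H) => //= i s ->.
by rewrite addnACA.
Qed.

Lemma transpose_perm : {t : 'S_(sumn la) | forall (k : 'I_(sumn la)) r c,
  (c < nth 0 la r)%N -> val k = cell_position la r c ->
  val (t k) = cell_position (conj_part la) c r}.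
Proof.
(* The cell at position k is found by search and transposed; for k below the size of the diagram the
   default is not reached. *)
pose tau k := let rc := nth (0, 0)%N (cells la)
    (find (fun rc => cell_position la rc.1 rc.2 == k) (cells la)) in
  cell_position (conj_part la) rc.2 rc.1.
have tauE r c : (c < nth 0 la r)%N ->
    tau (cell_position la r c) = cell_position (conj_part la) c r.
  move=> cr; rewrite /tau; set P := fun rc => _.
  have hasP : has P (cells la) by apply/hasP; exists (r, c); rewrite ?mem_cells /P /=.
  have := nth_find (0, 0)%N hasP.
  have : nth (0, 0)%N (cells la) (find P (cells la)) \in cells la.
    by rewrite mem_nth -?has_find.
  case: (nth _ _ _) => r' c'; rewrite mem_cells => cr' /eqP /=.
  by move=> /(cell_position_inj la_sorted cr' cr)[-> ->].
have tau_lt (k : 'I_(sumn la)) : (tau k < sumn la)%N.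
  have [r [c [cr ->]]] := cell_positionP la_sorted (ltn_ord k).
  rewrite tauE // -[X in (_ < X)%N]sumn_conj_part.
  by apply: (cell_position_size sorted_conj_part); rewrite conj_cell.
have tau_inj : injective (fun k => Ordinal (tau_lt k)).
  move=> i j /(congr1 val) /=.
  have [r [c [cr iE]]] := cell_positionP la_sorted (ltn_ord i).
  have [r' [c' [cr' jE]]] := cell_positionP la_sorted (ltn_ord j).
  rewrite iE jE !tauE // => E; apply/val_inj; rewrite /= iE jE.
  by have [-> ->] := cell_position_inj sorted_conj_part
    (etrans (conj_cell r c) cr) (etrans (conj_cell r' c') cr') E.
exists (perm tau_inj) => k r c cr kE.
by rewrite permE /= kE tauE.
Qed.
End Conjugate.

Lemma schur_linear_extensions la m : sorted geq la ->
  schur la m = \sum_(p : 'S_(sumn la) | linear_extension la (inv_std (word p)))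
    F (sumn la) (ID p) m.
Proof.
move=> sla; rewrite schur_reading -ID_series_gen /gen_series; congr Posz.
apply: eq_count => v; rewrite /of_size; case: eqP => //= sv.
exact: reading_ssyt_linear_extension.
Qed.

Section Transpose.
Variable la : seq nat.
Hypothesis la_sorted : sorted geq la.
Local Notation n := (sumn la).
Variable t : 'S_n.
Hypothesis tE : forall (k : 'I_n) r c, (c < nth 0 la r)%N ->
  val k = cell_position la r c -> val (t k) = cell_position (conj_part la) c r.

Let z (p : 'S_n) := inv_std (word p).
Let pos := cell_position la.
Let pos' := cell_position (conj_part la).

Lemma index_transpose (p : 'S_n) r c : (c < nth 0 la r)%N ->
  index (pos r c) (z (t * p)%g) = index (pos' c r) (z p).
Proof.
move=> cr; have kn := cell_position_size la_sorted cr.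
rewrite -[pos r c]/(val (Ordinal kn)) /z index_inv_std_word permM.
by rewrite -index_inv_std_word (tE cr).
Qed.

Lemma linear_extension_transpose (p : 'S_n) :
  linear_extension la (z (t * p)%g) = linear_extension (conj_part la) (z p).
Proof.
have zn (p0 : 'S_n) : perm_eq (z p0) (iota 0 n).
  by have := perm_inv_std (word p0); rewrite size_word.
apply/linear_extensionP/linear_extensionP => -[_ h]; split.
- by rewrite sumn_conj_part.
- move=> c r c' r' cc rr ne; rewrite !conj_cell // => cr cr'.
  rewrite -!index_transpose //; apply: h => //.
  by apply: contra ne => /eqP[-> ->].
- exact: zn.
move=> r c r' c' rr cc ne cr cr'; rewrite !index_transpose //.
apply: h; rewrite ?conj_cell //.
by apply: contra ne => /eqP[-> ->].
Qed.

(* Two consecutive entries of a linear extension are either incomparable or a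
   covering pair, so exactly one of the reading orders of the diagram and of
   its transpose sees a descent. *)
Lemma ID_transpose (p : 'S_n) : linear_extension la (z (t * p)%g) ->
  ID (rev_perm (t * p)%g) =i ID p.
Proof.
move=> /linear_extensionP[zn h] k.
rewrite mem_ID_rev !mem_ID; case: (boolP (0 < k < n)%N) => //= /andP[k0 kn].
have k1n : (k.-1 < n)%N by apply: leq_ltn_trans (leq_pred _) kn.
set q := (t * p)%g in zn h *; rewrite -/(z q) -/(z p).
have sz (p0 : 'S_n) : size (z p0) = n.
  by rewrite (perm_size (perm_inv_std _)) size_iota size_word.
have uz (p0 : 'S_n) : uniq (z p0) by rewrite (perm_uniq (perm_inv_std _)) iota_uniq.
have zlt i : (i < n)%N -> (nth 0 (z q) i < n)%N.
  by move=> iN; rewrite -[X in (_ < X)%N](size_word q) -mem_inv_std mem_nth ?sz.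
have [r [c [cr xE]]] := cell_positionP la_sorted (zlt _ k1n).
have [r' [c' [cr' yE]]] := cell_positionP la_sorted (zlt _ kn).
have ix : index (pos r c) (z q) = k.-1 by rewrite /pos -xE index_uniq ?sz.
have iy : index (pos r' c') (z q) = k by rewrite /pos -yE index_uniq ?sz.
have x'E : nth 0%N (z p) k.-1 = pos' c r.
  by rewrite -ix index_transpose // nth_index // mem_inv_std size_word
    -[X in (_ < X)%N](sumn_conj_part la_sorted)
    (cell_position_size (sorted_conj_part la_sorted)) ?conj_cell.
have y'E : nth 0%N (z p) k = pos' c' r'.
  by rewrite -{1}iy index_transpose // nth_index // mem_inv_std size_word
    -[X in (_ < X)%N](sumn_conj_part la_sorted)
    (cell_position_size (sorted_conj_part la_sorted)) ?conj_cell.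
rewrite xE yE x'E y'E /pos' cell_position_ltE //.
rewrite (cell_position_ltE (sorted_conj_part la_sorted)) ?conj_cell //.
have ne : (r, c) != (r', c').
  by apply/eqP => -[e1 e2]; move: ix iy; rewrite e1 e2 => ->; lia.
have nyx : ~~ ((r' <= r) && (c' <= c))%N.
  apply/negP => /andP[rr cc]; have := h _ _ _ _ rr cc.
  by rewrite eq_sym => /(_ ne cr' cr); rewrite -/(pos _ _) -/(pos _ _) ix iy; lia.
have nxy : ~~ ((r < r') && (c < c'))%N.
  apply/negP => /andP[rr cc].
  have cw : (c' < nth 0 la r)%N by apply: leq_trans cr' (part_geq la_sorted (ltnW rr)).
  have := h r c r c' (leqnn _) (ltnW cc) ltac:(apply/eqP=> -[]; lia) cr cw.
  have := h r c' r' c' (ltnW rr) (leqnn _) ltac:(apply/eqP=> -[]; lia) cw cr'.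
  by rewrite -/(pos _ _) -/(pos _ _) -/(pos _ _) ix iy; lia.
clear -nyx nxy; lia.
Qed.
End Transpose.

Lemma schur_conj_linear_extensions la m : sorted geq la ->
  schur (conj_part la) m
  = \sum_(p : 'S_(sumn la) | linear_extension la (inv_std (word p)))
      F (sumn la) (ID (rev_perm p)) m.
Proof.
move=> sla; have [t tE] := transpose_perm sla.
rewrite schur_linear_extensions; last exact: sorted_conj_part.
rewrite (reindex_inj (mulgI t)) /= sumn_conj_part //.
rewrite [RHS](eq_bigl _ _ (linear_extension_transpose sla tE)).
apply: eq_bigr => p hp; apply: eq_F => k.
by rewrite (ID_transpose sla tE) // linear_extension_transpose.
Qed.

Lemma schur_partition n la m : is_partition n la ->
  schur la m = \sum_(p : 'S_n | linear_extension la (inv_std (word p))) F n (ID p) m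
  /\ schur (conj_part la) m
    = \sum_(p : 'S_n | linear_extension la (inv_std (word p))) F n (ID (rev_perm p)) m.
Proof.
move=> /is_partitionP[sla _ <-].
by rewrite -schur_linear_extensions // -schur_conj_linear_extensions.
Qed.

(** Both sides of the hypothesis are combinations of fundamental functions, Schur functions through
    standard tableaux. Complementing the descent sets in their difference reverses the permutations
    of W and conjugates the shapes. *)
Lemma omega_schur_expansion n (W : {set 'S_n}) (d : partition_of n -> int) :
    ID_series W =1 (fun m => \sum_la d la * schur (parts la) m) ->
  forall m, \sum_(p in W) F n (ID (rev_perm p)) m
    = \sum_(la : partition_of n) d la * schur (conj_part (parts la)) m.
Proof.
move=> hW m.
pose le (la : partition_of n) (p : 'S_n) := linear_extension (parts la) (inv_std (word p)).
pose c (p : 'S_n) : int := (p \in W)%:Z - \sum_la d la * (le la p)%:Z.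
have sumc (f : 'S_n -> int) : \sum_p c p * f p
    = \sum_(p in W) f p - \sum_la d la * \sum_(p | le la p) f p.
  rewrite /c; under eq_bigr do rewrite mulrBl mulr_suml.
  rewrite sumrB; congr (_ - _).
    rewrite [RHS]big_mkcond; apply: eq_bigr => p _.
    by case: (p \in W); rewrite ?mul1r ?mul0r.
  rewrite exchange_big; apply: eq_bigr => la _; rewrite mulr_sumr [RHS]big_mkcond.
  by apply: eq_bigr => p _; case: (le la p); rewrite ?mulr1 ?mulr0 ?mul0r.
have schurE (la : partition_of n) m' := schur_partition m' (part_bseqP la).
have c0 m' : \sum_p c p * F n (ID p) m' = 0.
  rewrite sumc -/(ID_series W m') hW; apply/eqP; rewrite subr_eq0; apply/eqP.
  by apply: eq_bigr => la _; have [-> _] := schurE la m'.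
have := complement_ID_eq0 c0 m; rewrite (sumc (fun p => F n (ID (rev_perm p)) m)).
move=> /eqP; rewrite subr_eq0 => /eqP ->.
by apply: eq_bigr => la _; have [_ ->] := schurE la m.
Qed.

Lemma rev_permK n : involutive (@rev_perm n).
Proof.
by move=> p; apply: word_inj; rewrite !word_rev_perm /rev_word word_rev_perm revK.
Qed.

(** Flipping permutations amounts to reversing the variables that matter for a given monomial, which
    leaves a symmetric series unchanged. *)
Lemma ID_series_flip n (C : {set 'S_n}) : symmetric_series (ID_series C) ->
  ID_series (@flip_perm n @: C) =1 ID_series C.
Proof.
move=> hsym m; rewrite (ID_series_transform (@flip_word_inj n) (@flip_word_perm n)).
rewrite (eq_bigr _ (fun p _ => F_flip p m)) -/(ID_series C _) hsym //.
exact: Bijective (@reverse_lettersK (sumn m)) (@reverse_lettersK (sumn m)).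
Qed.

Theorem corollary4p6 (n : nat) (C : {set 'S_n})
    (hC : union_of_sde_classes C)
    (hsym : symmetric_series (ID_series C)) :
  [/\ ID_series C =1
        (fun m => \sum_(la : partition_of n)
           #|[set p in C | SYam (parts la) (rev_word p)]|%:Z
             * schur (conj_part (parts la)) m),
      ID_series C =1
        (fun m => \sum_(la : partition_of n)
           #|[set p in C | SYam (parts la) (flip_word p)]|%:Z
             * schur (parts la) m)
    & schur_positive n (ID_series C)].
Proof.
have adj_symC : adjacent_symmetric (ID_series C).
  move=> k m; apply: hsym.
  exact: Bijective (@swap_lettersK k) (@swap_lettersK k).
have flip_expansion : ID_series C =1 (fun m => \sum_(la : partition_of n)
    #|[set p in C | SYam (parts la) (flip_word p)]|%:Z * schur (parts la) m).
  move=> m; rewrite -ID_series_flip // closed_schur_expansion.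
  - apply: eq_bigr => la _; congr (_%:Z * _).
    rewrite (card_transform (@flip_word_inj n) (@flip_word_perm n)).
    apply: eq_card => p; rewrite !inE; congr (_ && SYam _ _).
    by rewrite -word_flip_perm (word_transform (@flip_word_perm n)).
  - exact: flip_union_closed.
  by move=> k m'; rewrite !ID_series_flip.
split=> // [m|]; last by exists (fun la => #|[set p in C | SYam (parts la) (flip_word p)]|).
have rev_series m' : ID_series (@rev_perm n @: C) m'
    = \sum_(p in C) F n (ID (rev_perm p)) m'.
  exact: (ID_series_transform (@rev_word_inj n) (@rev_word_perm n)).
have rev_expansion := omega_schur_expansion flip_expansion.
(* The symmetry of the reversed series is not assumed: it comes from its expansion in conjugate
   Schur functions, obtained from the flip expansion. *)
have rev_sym : adjacent_symmetric (ID_series (@rev_perm n @: C)).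
  move=> k m'; rewrite !rev_series !rev_expansion; apply: eq_bigr => la _.
  congr (_ * _); apply: schur_symmetric; apply: sorted_conj_part.
  by have [] := is_partitionP (part_bseqP la).
(* The expansion of the reversed set is carried back to C by complementing descent sets once more,
   which conjugates the shapes. *)
have := omega_schur_expansion (closed_schur_expansion (rev_union_closed hC) rev_sym) m.
rewrite big_imset /=; last by move=> p p' _ _; apply: (can_inj (@rev_permK n)).
under eq_bigr do rewrite rev_permK.
rewrite -/(ID_series C m) => ->; apply: eq_bigr => la _; congr (_%:Z * _).
rewrite (card_transform (@rev_word_inj n) (@rev_word_perm n)).
by apply: eq_card => p; rewrite !inE.
Qed.
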